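(* Let $\kappa=(\kappa_1,\dots,\kappa_d)\in[0,\infty)^d$, $\vartheta\ge0$, $t\in[0,T]$. The $\kappa$-Ornstein--Uhlenbeck semigroup acts on the Brownian signature by $$\mathbf{T}^\kappa_\vartheta\widehat{\mathbb{W}}_t=\exp\Big(\sum_{i=1}^d\frac{1-e^{-2\kappa_i\vartheta}}{2}\,\mathbf{\Psi}^{0}_{ii}\Big)\Big(\prod_{i=1}^d\mathbf{J}_i^{\kappa_i\vartheta}\Big)\widehat{\mathbb{W}}_t .$$ Moreover $\widehat{\mathbb{W}}_t\in\mathrm{Dom}(\mathbf{L}^\kappa)$ (componentwise) and $$\mathbf{L}^\kappa\widehat{\mathbb{W}}_t=\sum_{i=1}^d\kappa_i\big(\mathbf{\Psi}^0_{ii}-\mathbf{\Lambda}_i\big)\widehat{\mathbb{W}}_t .$$ Identifying $\mathbf{T}^\kappa_\vartheta$ and $\mathbf{L}^\kappa$ with the linear operators on $T((\mathbb{R}^{d+1}))$ appearing on the right-hand sides, their adjoint operators on $T(\mathbb{R}^{d+1})$ are $$(\mathbf{T}^\kappa_\vartheta)^*=\Big(\prod_{i=1}^d\mathbf{J}_i^{\kappa_i\vartheta}\Big)\exp\Big(\sum_{i=1}^d\frac{1-e^{-2\kappa_i\vartheta}}{2}\,\mathbf{\Psi}^{ii}_{0}\Big),\qquad(\mathbf{L}^\kappa)^*=\sum_{i=1}^d\kappa_i\big(\mathbf{\Psi}^{ii}_0-\mathbf{\Lambda}_i\big).$$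
   Context: $T>0$ fixed; $W$ is a $d$-dimensional Brownian motion with generated filtration $(\mathcal{F}^W_t)_{t\in[0,T]}$; $\widehat W_t=(t,W^1_t,\dots,W^d_t)$, with component $0$ being time. Tensor algebra. $V$ is the set of finite words (including the empty word $\varnothing$) in the alphabet $\{0,1,\dots,d\}$; $T((\mathbb{R}^{d+1}))=\prod_{n\ge0}(\mathbb{R}^{d+1})^{\otimes n}$, elements written $x=\sum_{v\in V}x^vv$ (words identified with basis tensors), and $T(\mathbb{R}^{d+1})$ is the subspace of elements with finitely many nonzero coordinates; pairing $\langle\ell,x\rangle=\sum_v\ell^vx^v$ for $\ell\in T(\mathbb{R}^{d+1})$, $x\in T((\mathbb{R}^{d+1}))$. For a continuous linear $\mathbf{A}:T((\mathbb{R}^{d+1}))\to T((\mathbb{R}^{d+1}))$ (product topology), its adjoint $\mathbf{A}^*:T(\mathbb{R}^{d+1})\to T(\mathbb{R}^{d+1})$ is defined by $\langle\ell,\mathbf{A}x\rangle=\langle\mathbf{A}^*\ell,x\rangle$. The Brownian signature is $\widehat{\mathbb{W}}_t=\big(\int_{0\le u_1\le\cdots\le u_n\le t}\circ d\widehat W^{i_1}_{u_1}\cdots\circ d\widehat W^{i_n}_{u_n}\big)_{i_1\cdots i_n\in V}$ (Stratonovich iterated integrals). Operators. For words $w,u$, $\mathbf{\Psi}^w_u(x)=\sum_{v_0,v_1\in V}x^{v_0wv_1}\,(v_0uv_1)$; here $ii$ denotes the two-letter word. $\mathbf{J}^\vartheta_i(x)=\sum_ve^{-|v|_i\vartheta}x^vv$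 and $\mathbf{\Lambda}_i(x)=\sum_v|v|_ix^vv$, where $|v|_i$ is the number of occurrences of the letter $i$ in $v$. $\exp$ of an operator is its power series and products denote composition. Ornstein--Uhlenbeck semigroup. Any $F\in L^2(\Omega,\mathcal{F}^W_T,\mathbb{P})$ is written as a measurable functional $F=F(W)$. Let $W^\perp$ be a $d$-dimensional Brownian motion independent of $W$ and $B^{\vartheta,\kappa}_t=\big(e^{-\kappa_i\vartheta}W^i_t+\sqrt{1-e^{-2\kappa_i\vartheta}}\,W^{\perp,i}_t\big)_{i=1,\dots,d}$. Then $\mathbf{T}^\kappa_\vartheta F(W)=\mathbb{E}[F(B^{\vartheta,\kappa})\mid\mathcal{F}^W_T]$ and its generator is $\mathbf{L}^\kappa=\frac{d}{d\vartheta}\big|_{\vartheta=0}\mathbf{T}^\kappa_\vartheta$ (in $L^2$, with domain $\mathrm{Dom}(\mathbf{L}^\kappa)$ the set of $F$ for which this derivative exists). Both are applied to $\widehat{\mathbb{W}}_t$ componentwise. *)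

(* Defs.v *)
From HB Require Import structures.
From mathcomp Require Import all_boot all_order all_algebra.
From mathcomp Require Import all_classical all_reals all_analysis.
Set Implicit Arguments.
Unset Strict Implicit.
Unset Printing Implicit Defensive.
Import Order.TTheory GRing.Theory Num.Theory.
Import numFieldNormedType.Exports.
Local Open Scope classical_set_scope.
Local Open Scope ring_scope.

(* Words over {0, 1, ..., d}; the letter 0 is time, and i : 'I_d stands for the
   (i+1)-st Brownian letter. *)
Notation word d := (seq 'I_d.+1).
Definition letter0 (d : nat) : 'I_d.+1 := ord0.
Definition letter (d : nat) (i : 'I_d) : 'I_d.+1 := lift ord0 i.

(* T((R^{d+1})), by coordinates; T(R^{d+1}) is the subspace of those elements
   that satisfy [finitely_supported]. *)
Notation tseries R d := (word d -> R).

Section tensor_algebra.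
Context {R : realType} {d : nat}.
Implicit Types (x l : tseries R d) (w u v : word d) (A : tseries R d -> tseries R d).

Definition finitely_supported l : Prop := finite_set [set v | l v != 0].

Definition pairing l x : R := \sum_(v \in [set v | l v != 0]) l v * x v.

(* [Psi w u] is the operator with w as upper and u as lower index; the
   coordinate at v of the formal sum collects the pairs (v0, v1) with
   v0 u v1 = v, of which there are finitely many. *)
Definition Psi w u x : tseries R d := fun v =>
  \sum_(p \in [set p : word d * word d | p.1 ++ u ++ p.2 = v])
     x (p.1 ++ w ++ p.2).

Definition J (i : 'I_d) (a : R) x : tseries R d := fun v =>
  expR (- ((count_mem (letter i) v)%:R * a)) * x v.

Definition Lambda (i : 'I_d) x : tseries R d := fun v =>
  (count_mem (letter i) v)%:R * x v.

(* The power series converges in the product topology, i.e. coordinatewise. *)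
Definition exp_op A x : tseries R d := fun v =>
  limn (series (fun n => (n`!%:R)^-1 * iter n A x v)).

Definition prod_op (F : 'I_d -> tseries R d -> tseries R d) :
    tseries R d -> tseries R d :=
  \big[(fun f g => f \o g)/id]_(i < d) F i.

Definition continuous_linear A : Prop :=
  linear A /\ continuous (A : {ptws word d -> R} -> {ptws word d -> R}).

(* The restriction of [A'] to T(R^{d+1}) is the adjoint of [A]. *)
Definition is_adjoint A A' : Prop :=
  continuous_linear A /\
  forall l, finitely_supported l ->
    finitely_supported (A' l) /\ forall x, pairing l (A x) = pairing (A' l) x.

Definition ou_tensor (kappa : 'I_d -> R) (vartheta : R) :
    tseries R d -> tseries R d :=
  exp_op (\sum_(i < d) ((1 - expR (- (2 * kappa i * vartheta))) / 2)
            *: Psi [:: letter0 d] [:: letter i; letter i])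
  \o prod_op (fun i => J i (kappa i * vartheta)).

Definition generator_tensor (kappa : 'I_d -> R) : tseries R d -> tseries R d :=
  \sum_(i < d) kappa i *:
    (Psi [:: letter0 d] [:: letter i; letter i] - Lambda i).

End tensor_algebra.

(* Processes on [0, T] are indexed by all of R, but only their values at times
   in [0, T] are ever constrained or used. *)
Notation process R d U := (R -> 'I_d -> U -> R).

Section brownian_motion.
Context {R : realType} {d : nat}.

Definition generated_sigma {U : Type} (T : R) (X : process R d U) :
    set (set U) :=
  <<s [set E | exists s i (B : set R),
         [/\ 0 <= s <= T, measurable B & E = X s i @^-1` B]] >>.

Definition measurable_wrt {U : Type} (G : set (set U)) (f : U -> R) : Prop :=
  forall B : set R, measurable B -> G (f @^-1` B).

Context {disp : measure_display} {Omega : measurableType disp}.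
Variable P : probability Omega R.

Definition mutually_independent (I : finType) (X : I -> Omega -> R) : Prop :=
  forall B : I -> set R, (forall j, measurable (B j)) ->
    P (\bigcap_(j in [set: I]) (X j @^-1` B j))
    = (\prod_(j : I) P (X j @^-1` B j))%E.

Definition independent_sigma (G H : set (set Omega)) : Prop :=
  forall A B, G A -> H B -> P (A `&` B) = (P A * P B)%E.

(* Independent increments means that all the increments over consecutive
   intervals, of all the coordinates, are mutually independent. The second
   parameter of [normal_prob] is the standard deviation. *)
Definition brownian_motion (T : R) (W : process R d Omega) : Prop :=
  [/\ forall s i, 0 <= s <= T -> measurable_fun setT (W s i),
      forall i, {ae P, forall omega, W 0 i omega = 0},
      forall i, {ae P, forall omega,
        {within `[0, T], continuous (fun s => W s i omega)}},
      forall (n : nat) (tau : nat -> R), 0 <= tau 0%N -> tau n <= T ->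
        (forall k, (k < n)%N -> tau k < tau k.+1) ->
        mutually_independent (fun (p : 'I_n * 'I_d) omega =>
          W (tau p.1.+1) p.2 omega - W (tau p.1) p.2 omega)
    & forall s u i, 0 <= s -> s < u -> u <= T ->
        forall B : set R, measurable B ->
          P ((fun omega => W u i omega - W s i omega) @^-1` B)
          = normal_prob 0 (Num.sqrt (u - s)) B].

(* L^2(Omega, F^W_T, P), up to modification on null sets. *)
Definition L2_of (T : R) (W : process R d Omega) (F : Omega -> R) : Prop :=
  F \in Lfun P 2%:E /\
  exists2 F', measurable_wrt (generated_sigma T W) F' & F = F' %[ae P].

Section signature.
Variables (T : R) (W : process R d Omega).

Definition time_extended (s : R) (a : 'I_d.+1) (omega : Omega) : R :=
  if unlift ord0 a is Some i then W s i omega else s.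

Definition trapezoidal_sum (X Y : R -> Omega -> R) (s : seq R)
    (omega : Omega) : R :=
  \sum_(k < size s)
    (X (nth 0 (0 :: s) k) omega + X (nth 0 (0 :: s) k.+1) omega) / 2
    * (Y (nth 0 (0 :: s) k.+1) omega - Y (nth 0 (0 :: s) k) omega).

(* Z is a version of the Stratonovich integral of X against Y over [0, t]:
   the mean-square limit of the trapezoidal sums along the partitions
   0 < s_1 < ... < s_n = t as the mesh tends to 0. *)
Definition stratonovich_integral (X Y : R -> Omega -> R) (t : R)
    (Z : Omega -> R) : Prop :=
  L2_of T W Z /\
  forall e : R, 0 < e -> exists2 delta : R, 0 < delta &
    forall s : seq R, itv_partition 0 t s ->
      (forall k, (k < size s)%N ->
         nth 0 (0 :: s) k.+1 - nth 0 (0 :: s) k < delta) ->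
      ('N[P]_2%:E[EFin \o (fun omega =>
         (trapezoidal_sum X Y s omega - Z omega)%R)] <= e%:E)%E.

(* S t omega is the signature of the time-extended path over [0, t]. The last
   letter of a word is the outermost integrator. *)
Definition brownian_signature (S : R -> Omega -> tseries R d) : Prop :=
  (forall t, 0 <= t <= T -> forall omega, S t omega [::] = 1) /\
  (forall t, 0 <= t <= T -> forall (w : word d) (a : 'I_d.+1),
     stratonovich_integral (fun s omega => S s omega w)
       (fun s omega => time_extended s a omega) t
       (fun omega => S t omega (rcons w a))).

End signature.

Definition is_condexp (G : set (set Omega)) (X Y : Omega -> R) : Prop :=
  [/\ P.-integrable setT (EFin \o X), P.-integrable setT (EFin \o Y),
      measurable_wrt G Y
    & forall A, G A ->
        (\int[P]_(omega in A) (Y omega)%:E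
         = \int[P]_(omega in A) (X omega)%:E)%E].

Definition condexp (G : set (set Omega)) (X : Omega -> R) : Omega -> R :=
  xget (cst 0) [set Y | is_condexp G X Y].

Section ornstein_uhlenbeck.
Variables (T : R) (W Wperp : process R d Omega) (kappa : 'I_d -> R).

Definition path_of (X : process R d Omega) (omega : Omega) : R -> 'I_d -> R :=
  fun s i => X s i omega.

(* The sigma-algebra on path space is the one generated by the evaluations at
   the times in [0, T]. *)
Definition represents (Phi : (R -> 'I_d -> R) -> R) (F : Omega -> R) : Prop :=
  measurable_wrt (generated_sigma T (fun s i (x : R -> 'I_d -> R) => x s i)) Phi
  /\ F = Phi \o path_of W %[ae P].

Definition functional_of (F : Omega -> R) : (R -> 'I_d -> R) -> R :=
  xget (cst 0) [set Phi | represents Phi F].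

Definition ou_process (vartheta : R) : process R d Omega := fun s i omega =>
  expR (- (kappa i * vartheta)) * W s i omega
  + Num.sqrt (1 - expR (- (2 * kappa i * vartheta))) * Wperp s i omega.

Definition ou_semigroup (vartheta : R) (F : Omega -> R) : Omega -> R :=
  condexp (generated_sigma T W) (functional_of F \o path_of (ou_process vartheta)).

(* The derivative at 0 is one-sided: the semigroup is indexed by
   vartheta >= 0. *)
Definition is_generator (F G : Omega -> R) : Prop :=
  [/\ L2_of T W F, L2_of T W G
    & ('N[P]_2%:E[EFin \o (fun omega =>
        (vartheta^-1 * (ou_semigroup vartheta F omega - ou_semigroup 0 F omega)
         - G omega)%R)])%E @[vartheta --> 0^'+] --> 0%E].

Definition ou_domain (F : Omega -> R) : Prop := exists G, is_generator F G.

Definition ou_generator (F : Omega -> R) : Omega -> R :=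
  xget (cst 0) [set G | is_generator F G].

End ornstein_uhlenbeck.
End brownian_motion.

(* Main.v *)
(* Let E_w(x) be the w-coordinate of exp(sum_i c_i Psi^0_ii) (prod_i J_i^(kappa_i theta)) x, with
   c_i = (1 - e^(-2 kappa_i theta))/2. Extracting the last letter of the word turns the operator into
   the recursion
     E_(wa)(x) = e_a E_w(x^(.a)) + [w = w'a, a > 0] c_a E_(w')(x^(.0)),  e_i = e^(-kappa_i theta), e_0 = 1.
   A functional F(W) has a lift F(B), where B = e W + b W' is the rotated Brownian motion, W' the
   independent copy of W and b_i^2 = 2 c_i. Since B has the law of W, lifting preserves means and L2
   norms, hence L2 limits, so the lift of S^(wa)_t is the L2 limit of the trapezoidal sums of the lift
   of S^w against B. Tested against a bounded F^W_T-measurable Z, the part of these sums along W gives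
   the first term of the recursion, by induction on w. In the part along W' the sums of Ito type
   vanish, because W' is a Brownian motion in the filtration that knows all of W from the start; what
   remains is half the covariation of the lift of S^w with b_i W'^i, which is b_i^2/2 times the time
   integral of the lift of S^(w') if w = w'i and 0 otherwise: this is the second term.
   The error terms are controlled by S^(wa)_u - S^(wa)_s - S^w_s (W^a_u - W^a_s) = O(u - s) in L2,
   which follows from the orthogonality of the Ito sums.
   For the generator, E_w(x) is a finite sum of f(theta) x^v with every f differentiable at 0, and the
   recursion identifies the derivative with the w-coordinate of sum_i kappa_i (Psi^0_ii - Lambda_i) x. *)

Require Import Defs.
From HB Require Import structures.
From mathcomp Require Import all_boot all_order all_algebra.
From mathcomp Require Import all_classical all_reals all_analysis.
From mathcomp Require Import measurable_realfun interval_inference ring lra zify.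
Set Implicit Arguments.
Unset Strict Implicit.
Unset Printing Implicit Defensive.
Import Order.TTheory GRing.Theory Num.Theory.
Import numFieldNormedType.Exports.
Local Open Scope classical_set_scope.
Local Open Scope ring_scope.

(** * Operators on the tensor algebra *)

Section tensor_operators.
Context {R : realType} {d : nat}.
Implicit Types (x y l : tseries R d) (w u v : word d) (a b : 'I_d.+1) (A : tseries R d -> tseries R d).

(** Three obstacles shape the development. The signature is given one time at a time as an L2 limit,
    hence only up to null sets, and its definition grants no more than measurability for the whole
    path of W: adaptedness has to be won back from the approximating sums, and measurability is
    taken modulo null sets ([aem]). The semigroup applies an arbitrarily chosen representing
    functional to another path. This makes sense only because B and W have the same law on path
    space, which rests on the rotation invariance of the Gaussian density and on a pi-lambda
    argument for increments. No higher moments of the signature are at hand, so an L2 remainder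
    times an increment is known to lie in L1 only. That part is discarded in the limit of fine
    grids, where it vanishes in L1 while the L2 bound of the rest survives by weak lower
    semicontinuity. The induction over words compares means against variables of the path of W
    rather than conditional expectations, because an increment of W can then be absorbed into the
    test variable. *)

Definition splits u v : set (word d * word d) := [set p | p.1 ++ u ++ p.2 = v].

Lemma finite_splits u v : finite_set (splits u v).
Proof.
pose f k := (take k v, drop (k + size u) v).
apply: (@sub_finite_set _ _ (f @` `I_(size v).+1)); last exact/finite_image/finite_II.
move=> [v0 v1] /= e; exists (size v0).
  by rewrite /= ltnS -e size_cat leq_addr.
by rewrite /f -e take_size_cat// catA drop_size_cat ?size_cat.
Qed.

Lemma Psi_eq0 w u x v : (forall p, splits u v p -> x (p.1 ++ w ++ p.2) = 0) -> Psi w u x v = 0.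
Proof. by move=> h; apply: fsbig1 => p; exact: h. Qed.

Lemma Psi_linear w u k x y : Psi w u (k *: x + y) = k *: Psi w u x + Psi w u y.
Proof.
apply/funext => v; have fin := finite_splits u v.
transitivity (k * Psi w u x v + Psi w u y v) => //.
by rewrite /Psi mulr_fsumr -fsbig_split.
Qed.

Definition shift a x : tseries R d := fun v => x (rcons v a).

Lemma Psi_nil w a u x : Psi w (a :: u) x [::] = 0.
Proof. by apply: Psi_eq0 => -[[|b p] q]. Qed.

(* graft a (sum_v x^v v) = sum_v x^v (v a), whereas shift a extracts the words ending in a. *)
Definition graft a x : tseries R d := fun v =>
  if rev v is a' :: v' then if a' == a then x (rev v') else 0 else 0.

Lemma graft_nil a x : graft a x [::] = 0.
Proof. by []. Qed.

Lemma graft_rcons a x v b : graft a x (rcons v b) = (b == a)%:R * x v.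
Proof. by rewrite /graft rev_rcons revK; case: eqP; rewrite ?mul1r ?mul0r. Qed.

Lemma graftZ k a x : graft a (k *: x) = k *: graft a x.
Proof.
apply/funext => v; case/lastP: v => [|v b].
  by rewrite graft_nil; apply: esym; apply: mulr0.
rewrite graft_rcons; transitivity (k * graft a x (rcons v b)) => //.
by rewrite graft_rcons mulrCA.
Qed.

(** A factorization [v a = v0 b b v1] has either a nonempty [v1], which ends in [a] and yields a
    factorization of [v] (set [A]), or an empty one, which forces [a = b] and [v = v0 b] (set [B]).
    In the second case [x] is read at [v0 c], and [graft b] records the condition on [v]. *)
Lemma Psi_rcons c b x v a : Psi [:: c] [:: b; b] x (rcons v a) =
  Psi [:: c] [:: b; b] (shift a x) v +
  (a == b)%:R * graft b (shift c x) v.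
Proof.
pose A := [set p : word d * word d | splits [:: b; b] (rcons v a) p /\ p.2 != [::]].
pose B := [set p : word d * word d | splits [:: b; b] (rcons v a) p /\ p.2 = [::]].
have fin := finite_splits [:: b; b] (rcons v a).
have AB : splits [:: b; b] (rcons v a) = A `|` B.
  apply/seteqP; split=> [p hp|p [[]|[]]//].
  by case: (eqVneq p.2 [::]) => h; [right|left].
have finA : finite_set A by apply: sub_finite_set fin => p [].
have finB : finite_set B by apply: sub_finite_set fin => p [].
rewrite {1}/Psi -/(splits [:: b; b] (rcons v a)) AB fsbigU0//; last first.
  by move=> p [[_ /eqP h] [_]].
congr (_ + _).
  rewrite (@reindex_fsbig _ _ _ _ _ (fun p : word d * word d => (p.1, rcons p.2 a)) (splits [:: b; b] v) A).
    by apply: eq_fsbigr => p _; rewrite /shift /= rcons_cat.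
  split.
  - move=> [p q] /= h; split; last by rewrite -size_eq0 size_rcons.
    by rewrite -h /splits /= rcons_cat.
  - by move=> [p q] [p' q'] _ _ /= [-> /rcons_inj[->]].
  - move=> [p q]; case/lastP: q => [[]//|q a'] [/= h _].
    rewrite /splits /= -!rcons_cons -!rcons_cat in h; have [h1 h2] := rcons_inj h.
    by exists (p, q) => //=; rewrite h2.
case/lastP: v {fin AB finA finB A} @B => [|v b'] B.
  have -> : B = set0.
    apply/seteqP; split=> // -[p q] [/= h1 h2]; move: h1; rewrite h2 /splits /=.
    by move/(congr1 size); rewrite size_cat /= addn2.
  by rewrite fsbig_set0 graft_nil mulr0.
rewrite graft_rcons.
have [ab|ab] := eqVneq a b; last first.
  rewrite mul0r (_ : B = set0) ?fsbig_set0//; apply/seteqP; split=> // -[p q] [/= h1 h2].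
  move: h1; rewrite h2 /splits /= => h; move: ab; rewrite (_ : a = b) ?eqxx//.
  by have := congr1 (last c) h; rewrite last_cat /= last_rcons.
have [bb|bb] := eqVneq b' b; last first.
  rewrite mul0r mulr0 (_ : B = set0) ?fsbig_set0//; apply/seteqP; split=> // -[p q] [/= h1 h2].
  move: h1; rewrite h2 /splits /= => h; move: bb; rewrite (_ : b' = b) ?eqxx//.
  have := h; rewrite -[p ++ _]/(p ++ [:: b] ++ [:: b]) catA !cats1 => /rcons_inj[/rcons_inj[_ ->]//].
rewrite !mul1r (_ : B = [set (v, [::])]) ?fsbig_set1//= ?cats1//.
apply/seteqP; split=> [[p q] [/= h1 h2]|_ ->].
  move: h1; rewrite h2 /splits /=.
  by rewrite -[p ++ _]/(p ++ [:: b] ++ [:: b]) catA !cats1 => /rcons_inj[/rcons_inj[->]].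
by rewrite /B /splits /= ab bb -[v ++ _]/(v ++ [:: b] ++ [:: b]) catA !cats1.
Qed.

(** Extension by 0 to the time letter: time is neither damped nor contracted, so that all letters
    obey the same formulas. *)
Definition coef (c : 'I_d -> R) a : R := if unlift ord0 a is Some i then c i else 0.

Definition contraction (c : 'I_d -> R) : tseries R d -> tseries R d :=
  \sum_(i < d) c i *: Psi [:: letter0 d] [:: letter i; letter i].

Lemma sum_opE (F : 'I_d -> tseries R d -> tseries R d) (c : 'I_d -> R) x v :
  (\sum_(i < d) c i *: F i) x v = \sum_(i < d) c i * F i x v.
Proof. by rewrite !fct_sumE. Qed.

Lemma sum_op_linear (F : 'I_d -> tseries R d -> tseries R d) (c : 'I_d -> R) k x y :
  (forall i, F i (k *: x + y) = k *: F i x + F i y) ->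
  (\sum_(i < d) c i *: F i) (k *: x + y) =
  k *: (\sum_(i < d) c i *: F i) x + (\sum_(i < d) c i *: F i) y.
Proof.
move=> h; apply/funext => v.
transitivity (k * (\sum_(i < d) c i *: F i) x v + (\sum_(i < d) c i *: F i) y v) => //.
rewrite !sum_opE mulr_sumr -big_split; apply: eq_bigr => i _; rewrite h.
transitivity (c i * (k * F i x v + F i y v)) => //.
by rewrite mulrDr mulrCA.
Qed.

Section contraction.
Variable c : 'I_d -> R.
Local Notation D := (contraction c).

Lemma contraction_linear k x y : D (k *: x + y) = k *: D x + D y.
Proof. by apply: sum_op_linear => i; exact: Psi_linear. Qed.

Lemma contraction0 : D 0 = 0.
Proof. by have := contraction_linear (-1) 0 0; rewrite scaler0 add0r scaleN1r addNr. Qed.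

Lemma contractionZ k x : D (k *: x) = k *: D x.
Proof. by have := contraction_linear k x 0; rewrite contraction0 !addr0. Qed.

Lemma contraction_nil x : D x [::] = 0.
Proof. by rewrite /contraction sum_opE big1// => i _; rewrite Psi_nil mulr0. Qed.

Lemma contraction_rcons x v a :
  D x (rcons v a) = D (shift a x) v + coef c a * graft a (shift (letter0 d) x) v.
Proof.
rewrite /contraction !sum_opE; under eq_bigr do rewrite Psi_rcons mulrDr.
rewrite big_split; congr (_ + _); rewrite /coef; case: unliftP => [j ->|->].
  rewrite (bigD1 j)//= eqxx mul1r big1 ?addr0// => i ij.
  by rewrite (inj_eq lift_inj) eq_sym (negbTE ij) mul0r mulr0.
by rewrite mul0r big1// => i _; rewrite (negbTE (neq_lift _ _)) mul0r mulr0.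
Qed.

(** The operator turns one letter 0 into a pair [ii]; a final letter other than 0 is left alone,
    whence the commutation. *)
Lemma contraction_graft a x : a != letter0 d -> D (graft a x) = graft a (D x).
Proof.
move=> a0; apply/funext => v; case/lastP: v => [|v b]; first by rewrite contraction_nil graft_nil.
rewrite contraction_rcons graft_rcons.
have sg b' : shift b' (graft a x) = (b' == a)%:R *: x.
  by apply/funext => v'; rewrite /shift graft_rcons.
rewrite !sg contractionZ eq_sym [letter0 d == a]eq_sym (negbTE a0) scale0r.
by rewrite -[0](scale0r 0) graftZ scale0r [X in _ + X]mulr0 addr0 eq_sym.
Qed.

Lemma coef0 a : a = letter0 d -> coef c a = 0.
Proof. by move=> ->; rewrite /coef unlift_none. Qed.

(** Once the final 0 has become [aa], the last letter can no longer be replaced, so this happens at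
    most once in [n] steps. It can take any of the [n] places and commutes with the other steps,
    hence the factor [n], which at [n = 0] also cancels the meaningless [n.-1]. *)
Lemma iter_contraction_rcons n x a : shift a (iter n D x) =
  iter n D (shift a x) + (n%:R * coef c a) *: graft a (iter n.-1 D (shift (letter0 d) x)).
Proof.
elim: n x a => [|n IH] x a; first by rewrite mul0r scale0r addr0.
have IH0 y : shift (letter0 d) (iter n D y) = iter n D (shift (letter0 d) y).
  by rewrite IH coef0// mulr0 scale0r addr0.
have e : shift a (iter n.+1 D x) = D (shift a (iter n D x)) + coef c a *: graft a (iter n D (shift (letter0 d) x)).
  apply/funext => v; rewrite -IH0; exact: contraction_rcons.
rewrite e IH [X in D X]addrC contraction_linear /=; have [->|c0] := eqVneq (coef c a) 0.
  by rewrite !mulr0 !scale0r add0r.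
have a0 : a != letter0 d by apply: contra_neq c0; exact: coef0.
rewrite addrC addrA addrC; congr (_ + _).
rewrite contraction_graft// -natr1 mulrDl mul1r scalerDl addrC; congr (_ + _).
by case: n {IH IH0 e} => [|n]; rewrite ?mul0r ?scale0r.
Qed.

(** Every application reads words shorter by one letter, so the exponential series is a finite sum
    at each coordinate. *)
Lemma iter_contraction_eq0 n x v : (size v < n)%N -> iter n D x v = 0.
Proof.
elim: n v => // n IH v vn /=; rewrite /contraction sum_opE big1// => i _.
rewrite Psi_eq0 ?mulr0// => -[p q] /= h; apply: IH.
by move: vn; rewrite -h !size_cat /= !addnS !ltnS.
Qed.

Lemma exp_op_trunc A x v N : (forall n, (N <= n)%N -> iter n A x v = 0) ->
  exp_op A x v = \sum_(n < N) (n`!%:R)^-1 * iter n A x v.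
Proof.
move=> h; apply: lim_near_cst => //; exists N => // n /= Nn.
rewrite /series /= (big_cat_nat (n := N))//= big_mkord.
rewrite [X in _ + X](_ : _ = 0) ?addr0// big_nat_cond; apply: big1 => k /andP[/andP[Nk _] _].
by rewrite h// mulr0.
Qed.

Lemma exp_contractionE x v N : (size v < N)%N ->
  exp_op D x v = \sum_(n < N) (n`!%:R)^-1 * iter n D x v.
Proof.
by move=> vN; apply: exp_op_trunc => n Nn; apply: iter_contraction_eq0; exact: leq_trans Nn.
Qed.

Lemma exp_contraction_nil x : exp_op D x [::] = x [::].
Proof. by rewrite (@exp_contractionE x [::] 1)// big_ord1 /= invr1 mul1r. Qed.

Lemma exp_contractionZ k x : exp_op D (k *: x) = k *: exp_op D x.
Proof.
apply/funext => v; transitivity (k * exp_op D x v) => //.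
have itZ n : iter n D (k *: x) = k *: iter n D x.
  by elim: n => //= n ->; exact: contractionZ.
rewrite !(@exp_contractionE _ v (size v).+1)// mulr_sumr; apply: eq_bigr => n _.
rewrite itZ; transitivity (n`!%:R^-1 * (k * iter n D x v)) => //.
by rewrite mulrCA.
Qed.

(* Psi^0_ii acts on v a either inside v or by contracting the last two letters; these two actions
   commute and the second one can occur at most once. *)
Lemma exp_contraction_rcons x v a : exp_op D x (rcons v a) =
  exp_op D (shift a x) v + coef c a * graft a (exp_op D (shift (letter0 d) x)) v.
Proof.
set y := shift (letter0 d) x.
rewrite (@exp_contractionE _ (rcons v a) (size v).+2) ?size_rcons//.
rewrite (@exp_contractionE _ v (size v).+2)//.
have E n : iter n D x (rcons v a) =
    iter n D (shift a x) v + n%:R * coef c a * graft a (iter n.-1 D y) v.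
  by have := congr1 (fun f => f v) (iter_contraction_rcons n x a).
under eq_bigr do rewrite E mulrDr.
rewrite big_split /=; congr (_ + _).
rewrite big_ord_recl /= !mul0r mulr0 add0r.
have -> : graft a (exp_op D y) v = \sum_(n < (size v).+1) n`!%:R^-1 * graft a (iter n D y) v.
  case/lastP: v {E} => [|v b]; first by rewrite graft_nil big1// => n _; rewrite graft_nil mulr0.
  rewrite graft_rcons (@exp_contractionE _ v (size (rcons v b)).+1) ?size_rcons//.
  by rewrite mulr_sumr; apply: eq_bigr => n _; rewrite graft_rcons mulrCA.
rewrite mulr_sumr; apply: eq_bigr => n _.
rewrite /bump /= add1n factS natrM.
have n0 : (n.+1%:R : R) != 0 by rewrite pnatr_eq0.
have f0 : (n`!%:R : R) != 0 by rewrite pnatr_eq0 -lt0n fact_gt0.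
by rewrite add0n invfM -!mulrA [X in _ * X]mulrCA mulKf// mulrCA.
Qed.

End contraction.

(** The product of the operators [J] is diagonal; this is its eigenvalue on the word [v]. *)
Definition weight (s : 'I_d -> R) v : R := \prod_(i < d) expR (- ((count_mem (letter i) v)%:R * s i)).

Lemma prod_JE s x v : prod_op (fun i => J i (s i)) x v = weight s v * x v.
Proof.
rewrite /prod_op /weight; elim: (index_enum _) x => [|i r IH] x; first by rewrite !big_nil mul1r.
by rewrite !big_cons /= /J IH mulrA.
Qed.

Lemma weight_rcons s v a : weight s (rcons v a) = expR (- coef s a) * weight s v.
Proof.
rewrite /weight /coef.
under eq_bigr => i _ do rewrite -cats1 count_cat /= addn0 natrD mulrDl opprD expRD.
rewrite big_split mulrC; congr (_ * _) => /=; case: unliftP => [j ->|->].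
  rewrite (bigD1 j)//= eqxx mul1r big1 ?mulr1// => i ij.
  by rewrite (inj_eq lift_inj) eq_sym (negbTE ij) mul0r oppr0 expR0.
by rewrite oppr0 expR0 big1// => i _; rewrite (negbTE (neq_lift _ _)) mul0r oppr0 expR0.
Qed.

Lemma shift_prod_J s x a : shift a (prod_op (fun i => J i (s i)) x) =
  expR (- coef s a) *: prod_op (fun i => J i (s i)) (shift a x).
Proof.
apply/funext => v; rewrite /shift prod_JE weight_rcons -mulrA.
by transitivity (expR (- coef s a) * prod_op (fun i => J i (s i)) (shift a x) v) => //; rewrite prod_JE.
Qed.

(** * Recursion in the last letter for the semigroup and the generator *)

Section recursion.
Variables (kappa : 'I_d -> R).

Lemma ou_tensor_nil theta x : ou_tensor kappa theta x [::] = x [::].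
Proof.
rewrite /ou_tensor /= exp_contraction_nil prod_JE /weight big1 ?mul1r// => i _.
by rewrite mul0r oppr0 expR0.
Qed.

Lemma ou_tensor_rcons theta x v a : ou_tensor kappa theta x (rcons v a) =
  expR (- (coef kappa a * theta)) * ou_tensor kappa theta (shift a x) v +
  (1 - expR (- (2 * coef kappa a * theta))) / 2 *
    graft a (ou_tensor kappa theta (shift (letter0 d) x)) v.
Proof.
rewrite /ou_tensor /= exp_contraction_rcons !shift_prod_J.
(* Both parameters are functions of [kappa] that vanish at 0, so they commute with the extension by
   0. *)
have cE (g : R -> R) : g 0 = 0 -> coef (fun i => g (kappa i)) a = g (coef kappa a).
  by rewrite /coef; case: unlift.
have e0 : expR (- coef (fun i => kappa i * theta) (letter0 d)) = 1.
  by rewrite coef0// oppr0 expR0.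
rewrite e0 scale1r (cE (fun k => k * theta)) ?mul0r//.
rewrite (cE (fun k => (1 - expR (- (2 * k * theta))) / 2)); last first.
  by rewrite mulr0 mul0r oppr0 expR0 subrr mul0r.
by rewrite exp_contractionZ.
Qed.

Lemma generator_tensorE x v : generator_tensor kappa x v =
  contraction kappa x v - \sum_(i < d) kappa i * ((count_mem (letter i) v)%:R * x v).
Proof.
rewrite /generator_tensor /contraction !sum_opE -sumrB; apply: eq_bigr => i _.
by rewrite -mulrBr.
Qed.

Lemma generator_tensor_nil x : generator_tensor kappa x [::] = 0.
Proof.
by rewrite generator_tensorE contraction_nil big1 ?subr0// => i _; rewrite mul0r mulr0.
Qed.

Lemma generator_tensor_rcons x v a : generator_tensor kappa x (rcons v a) =
  generator_tensor kappa (shift a x) v - coef kappa a * shift a x v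
  + coef kappa a * graft a (shift (letter0 d) x) v.
Proof.
rewrite !generator_tensorE contraction_rcons.
have -> : \sum_(i < d) kappa i * ((count_mem (letter i) (rcons v a))%:R * x (rcons v a)) =
    \sum_(i < d) kappa i * ((count_mem (letter i) v)%:R * shift a x v) + coef kappa a * shift a x v.
  under eq_bigr => i _ do rewrite -cats1 count_cat /= addn0 natrD mulrDl mulrDr cats1.
  rewrite big_split /=; congr (_ + _); rewrite /coef; case: unliftP => [j ->|->].
    rewrite (bigD1 j)//= eqxx mul1r big1 ?addr0// => i ij.
    by rewrite (inj_eq lift_inj) eq_sym (negbTE ij) mul0r mulr0.
  by rewrite [RHS]mul0r big1// => i _; rewrite (negbTE (neq_lift _ _)) mul0r mulr0.
ring.
Qed.

End recursion.

(* The coefficients f of Phi are differentiable at 0 and Gamma is the derivative of Phi there. *)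
Definition expandable (Phi : R -> tseries R d -> R) (Gamma : tseries R d -> R) : Prop :=
  exists (I : finType) (f : I -> R -> R) (f' : I -> R) (v : I -> word d),
  [/\ forall theta x, Phi theta x = \sum_(p : I) f p theta * x (v p),
     forall p, is_derive (0 : R) 1 (f p) (f' p)
   & forall x, Gamma x = \sum_(p : I) f' p * x (v p)].

Lemma expandable_zero : expandable (fun _ _ => 0) (fun=> 0).
Proof.
exists void, (fun p => of_void _ p), (fun p => of_void _ p), (fun p => of_void _ p).
by split=> [theta x|[]|x]; rewrite big1// => -[].
Qed.

Lemma expandable_eval w : expandable (fun _ x => x w) (fun=> 0).
Proof.
exists unit, (fun _ _ => 1), (fun=> 0), (fun=> w); split=> [theta x|p|x].
- by rewrite (bigD1 tt)//= big1 ?addr0 ?mul1r// => -[].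
- exact: is_derive_cst.
- by rewrite big1// => p _; rewrite mul0r.
Qed.

Lemma expandableD Phi Phi' Gamma Gamma' : expandable Phi Gamma -> expandable Phi' Gamma' ->
  expandable (fun theta x => Phi theta x + Phi' theta x) (fun x => Gamma x + Gamma' x).
Proof.
move=> [I [f [f' [v [h1 h2 h3]]]]] [I' [g [g' [v' [h1' h2' h3']]]]].
exists (I + I')%type, (fun p => match p with inl i => f i | inr i => g i end),
  (fun p => match p with inl i => f' i | inr i => g' i end),
  (fun p => match p with inl i => v i | inr i => v' i end); split=> [theta x|[]//|x].
  by rewrite h1 h1' big_sumType.
by rewrite h3 h3' big_sumType.
Qed.

Lemma expandableM Phi Gamma (g : R -> R) (g' : R) : is_derive (0 : R) 1 g g' -> expandable Phi Gamma ->
  expandable (fun theta x => g theta * Phi theta x) (fun x => g' * Phi 0 x + g 0 * Gamma x).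
Proof.
move=> hg [I [f [f' [v [h1 h2 h3]]]]].
exists I, (fun p theta => g theta * f p theta), (fun p => g 0 * f' p + f p 0 * g'), v.
split=> [theta x|p|x].
- by rewrite h1 mulr_sumr; apply: eq_bigr => p _; rewrite mulrA.
- exact: is_deriveM.
- rewrite h1 h3 !mulr_sumr -big_split; apply: eq_bigr => p _ /=; ring.
Qed.

Lemma expandable_shift Phi Gamma a : expandable Phi Gamma ->
  expandable (fun theta x => Phi theta (shift a x)) (fun x => Gamma (shift a x)).
Proof.
move=> [I [f [f' [v [h1 h2 h3]]]]].
exists I, f, f', (fun p => rcons (v p) a).
by split=> [theta x|p|x]; [exact: h1|exact: h2|exact: h3].
Qed.

Lemma ou_tensor0 kappa x : ou_tensor kappa 0 x = x.
Proof.
apply/funext => v; elim/last_ind: v x => [|v a IH] x; first exact: ou_tensor_nil.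
by rewrite ou_tensor_rcons !mulr0 oppr0 expR0 subrr mul0r mul0r mul1r addr0 IH.
Qed.

(** Strong induction on the length, since the recursion drops up to two letters. At 0 its two
    coefficients have values 1 and 0 and derivatives [- k] and [k], so the product rule reproduces
    the recursion of the generator. *)
Lemma ou_tensor_expandable kappa w :
  expandable (fun theta x => ou_tensor kappa theta x w) (fun x => generator_tensor kappa x w).
Proof.
have [n] := ubnP (size w); elim: n w => // n IH w; case/lastP: w => [_|v a].
  have := expandable_eval [::].
  congr expandable; first by do 2 apply/funext => ?; rewrite ou_tensor_nil.
  by apply/funext => x; rewrite generator_tensor_nil.
rewrite size_rcons ltnS => vn.
pose k := coef kappa a.
have e1 : is_derive (0 : R) 1 (fun t => expR (- (k * t))) (- k).
  by apply: is_derive_eq; rewrite !mulr0 oppr0 expR0; rewrite /GRing.scale /=; ring.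
have e2 : is_derive (0 : R) 1 (fun t => (1 - expR (- (2 * k * t))) / 2) k.
  by apply: is_derive_eq; rewrite !mulr0 oppr0 expR0; rewrite /GRing.scale /=; field.
have h1 := expandableM e1 (expandable_shift a (IH v vn)).
(* Any derivative will do here: the product rule multiplies it by [(1 - 1) / 2 = 0]. *)
have [Gm hG] : exists Gm, expandable (fun theta x => graft a (ou_tensor kappa theta (shift (letter0 d) x)) v) Gm.
  case/lastP: v vn {h1} => [|v b] vn.
    by exists (fun=> 0); exact: expandable_zero.
  have vn' : (size v < n)%N by apply: leq_trans vn; rewrite size_rcons ltnS.
  have := expandableM (is_derive_cst ((b == a)%:R : R) (0 : R) 1) (expandable_shift (letter0 d) (IH v vn')).
  set Gm := (X in expandable _ X) => h; exists Gm; move: h; congr expandable.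
  by do 2 apply/funext => ?; rewrite graft_rcons.
have h2 := expandableM e2 hG.
have := expandableD h1 h2; congr expandable.
  by do 2 apply/funext => ?; rewrite ou_tensor_rcons.
apply/funext => x; rewrite generator_tensor_rcons !ou_tensor0 !mulr0 oppr0 expR0 subrr !mul0r addr0 mul1r -/k.
ring.
Qed.

(** * Continuity in the product topology, and adjoints *)

Lemma coordinatewise_cvg (F : set_system {ptws word d -> R}) (f : {ptws word d -> R}) : Filter F ->
  (forall v, (fun g : tseries R d => g v) @ F --> f v) -> F --> f.
Proof.
move=> FF h; apply/cvg_sup => v; apply/cvg_image.
  by rewrite eqEsubset; split=> // y _; exists (fun=> y).
move=> Q /h Qv; exists ((fun g : tseries R d => g v) @^-1` Q) => //.
by rewrite eqEsubset; split=> [y [g Qg <-]//|y Qy]; exists (fun=> y).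
Qed.

(** Each coordinate of the image is a finite linear combination of coordinates, which the product
    topology makes continuous. *)
Lemma row_finite_continuous_linear A : (forall v, exists (I : finType) (f : I -> R) (u : I -> word d),
  forall x, A x v = \sum_(p : I) f p * x (u p)) -> continuous_linear A.
Proof.
move=> h; split=> [k x y|x].
  apply/funext => v; have [I [f [u e]]] := h v.
  transitivity (k * A x v + A y v) => //.
  rewrite !e mulr_sumr -big_split; apply: eq_bigr => p _ /=.
  transitivity (f p * (k * x (u p) + y (u p))) => //; ring.
have FA : Filter (fmap A (nbhs x)) by exact: (@fmap_filter _ _ A (nbhs x) (nbhs_filter x)).
refine (@coordinatewise_cvg (fmap A (nbhs x)) (A x) FA _) => v; have [I [f [u e]]] := h v.
have eA : (fun g : tseries R d => A g v) = fun g => \sum_(p : I) f p * g (u p).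
  by apply/funext => g; exact: e.
rewrite e -[X in X --> _]/(fmap (fun g : tseries R d => A g v) (nbhs x)) eA.
have hp p : g (u p) @[g --> nbhs x] --> x (u p) by exact: (@proj_continuous _ (fun _ => R) (u p) x).
move: hp {FA}; move: (nbhs x) (nbhs_filter x) => G FG hp.
apply: cvg_big => [|p _]; first exact: add_continuous.
by apply: cvgM; [exact: cvg_cst|exact: hp].
Qed.

(** The alphabet is finite, so a bound on the length of words expresses finite support; it provides
    an explicit summation range for the pairing. *)
Definition vanishes_from N l := forall v, (N <= size v)%N -> l v = 0.

Definition words N : seq (word d) := flatten [seq [seq val t | t <- enum {: n.-tuple 'I_d.+1}] | n <- iota 0 N].

Lemma mem_words N v : (v \in words N) = (size v < N)%N.
Proof.
apply/flattenP/idP => [[s /mapP[n]]|vN].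
  by rewrite mem_iota add0n => /andP[_ nN] -> /mapP[t _ ->]; rewrite size_tuple.
exists [seq val t | t <- enum {: (size v).-tuple 'I_d.+1}]; first by apply/mapP; exists (size v); rewrite ?mem_iota.
by apply/mapP; exists (in_tuple v); rewrite ?mem_enum.
Qed.

Lemma pairing_words N l x : vanishes_from N l -> pairing l x = \sum_(v <- undup (words N)) l v * x v.
Proof.
move=> lN; rewrite /pairing [RHS]fsbig_seq ?undup_uniq//.
rewrite (@fsbig_widen _ _ _ _ [set v | l v != 0] [set` undup (words N)])//.
  move=> v /= lv; rewrite mem_undup mem_words ltnNge; apply: contra lv => Nv.
  by rewrite lN.
by move=> v /= [_ /negP]; rewrite negbK => /eqP ->; rewrite mul0r.
Qed.

Lemma finitely_supportedP l : finitely_supported l <-> exists N, vanishes_from N l.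
Proof.
split=> [fl|[N lN]]; last first.
  apply: (@sub_finite_set _ _ [set` words N]); last exact: finite_seq.
  by move=> v /= lv; rewrite mem_words ltnNge; apply: contra lv => Nv; rewrite lN.
have [s es] := (finite_seqP _).1 fl.
exists (\max_(v <- s) size v).+1 => v sv; apply/eqP; apply: contraTT sv => lv.
rewrite -ltnNge ltnS; apply: (leq_bigmax_seq v) => //.
by have : [set` s] v; [rewrite -es|].
Qed.

(** The algebraic half of [is_adjoint], without continuity and with supports measured by length. In
    this form it passes to sums, differences, compositions and exponentials. *)
Definition transposes A A' := forall l N, vanishes_from N l ->
  (exists N', vanishes_from N' (A' l)) /\ forall x, pairing l (A x) = pairing (A' l) x.

Lemma transposes_comp A A' B B' : transposes A A' -> transposes B B' -> transposes (A \o B) (B' \o A').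
Proof.
move=> hA hB l N lN; have [[N' lN'] eA] := hA l N lN; have [h eB] := hB _ _ lN'.
by split=> // x /=; rewrite eA eB.
Qed.

Lemma transposes_sum (F F' : 'I_d -> tseries R d -> tseries R d) (c : 'I_d -> R) :
  (forall i, transposes (F i) (F' i)) ->
  transposes (\sum_(i < d) c i *: F i) (\sum_(i < d) c i *: F' i).
Proof.
move=> h l N lN.
have /choice[M hM] : forall i, exists M, vanishes_from M (F' i l).
  by move=> i; have [] := h i l N lN.
have vM : vanishes_from (\max_(i < d) M i) ((\sum_(i < d) c i *: F' i) l).
  move=> v Mv; rewrite sum_opE big1// => i _; rewrite (hM i) ?mulr0//.
  by apply: leq_trans Mv; exact: leq_bigmax.
split; first by exists (\max_(i < d) M i).
move=> x; rewrite (pairing_words _ lN) (pairing_words _ vM).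
under eq_bigr do rewrite sum_opE mulr_sumr.
under [RHS]eq_bigr do rewrite sum_opE mulr_suml.
rewrite exchange_big [RHS]exchange_big; apply: eq_bigr => i _ /=.
have vi : vanishes_from (\max_(i < d) M i) (F' i l).
  by move=> v Mv; apply: (hM i); apply: leq_trans Mv; exact: leq_bigmax.
have [_ /(_ x)] := h i l N lN.
rewrite (pairing_words _ lN) (pairing_words _ vi) => e.
under eq_bigr do rewrite mulrCA.
under [RHS]eq_bigr do rewrite -mulrA.
by rewrite -!mulr_sumr e.
Qed.

Lemma transposesB A A' B B' : transposes A A' -> transposes B B' -> transposes (A - B) (A' - B').
Proof.
move=> hA hB l N lN.
have [[M hM] eA] := hA l N lN; have [[M' hM'] eB] := hB l N lN.
have vM : vanishes_from (maxn M M') (A' l) by move=> v; rewrite geq_max => /andP[/hM].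
have vM' : vanishes_from (maxn M M') (B' l) by move=> v; rewrite geq_max => /andP[_ /hM'].
have vB : vanishes_from (maxn M M') ((A' - B') l).
  by move=> v Mv; transitivity (A' l v - B' l v) => //; rewrite vM// vM'// subr0.
split; first by exists (maxn M M').
move=> x; rewrite (pairing_words _ lN) (pairing_words _ vB).
transitivity (pairing l (A x) - pairing l (B x)).
  by rewrite !(pairing_words _ lN) -sumrB; apply: eq_bigr => v _; rewrite -mulrBr.
rewrite eA eB (pairing_words _ vM) (pairing_words _ vM') -sumrB.
by apply: eq_bigr => v _; rewrite -mulrBl.
Qed.

Lemma transposes_diagonal (m : word d -> R) : transposes (fun x v => m v * x v) (fun x v => m v * x v).
Proof.
move=> l N lN; have h : vanishes_from N (fun v => m v * l v) by move=> v Nv; rewrite lN// mulr0.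
split; first by exists N.
move=> x; rewrite (pairing_words _ lN) (pairing_words _ h).
by apply: eq_bigr => v _; rewrite mulrA [l v * _]mulrC.
Qed.

Lemma Psi_words M w u x v : (size v < M)%N -> Psi w u x v =
  \sum_(p <- undup [seq (p1, p2) | p1 <- words M, p2 <- words M])
     (if p.1 ++ u ++ p.2 == v then x (p.1 ++ w ++ p.2) else 0).
Proof.
move=> vM; rewrite fsbig_seq ?undup_uniq//.
transitivity (\sum_(p \in splits u v) (if p.1 ++ u ++ p.2 == v then x (p.1 ++ w ++ p.2) else 0)).
  by apply: eq_fsbigr => p /set_mem e; rewrite [p.1 ++ u ++ p.2]e eqxx.
apply: fsbig_widen.
- move=> [p q] /= h; rewrite mem_undup; apply/allpairsP; exists (p, q); rewrite !mem_words /=.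
  have := congr1 size h; rewrite !size_cat /= => e.
  by split=> //; apply: leq_ltn_trans vM; rewrite -e ?leq_addr// addnA leq_addl.
- by move=> p [_ /eqP/negbTE h] /=; rewrite h.
Qed.

Lemma Psi_vanishes w u l N : vanishes_from (N + size u) l -> vanishes_from (N + size w) (Psi u w l).
Proof.
move=> lN v vN; apply: Psi_eq0 => -[p q] /= h; apply: lN.
move: vN; rewrite -h /= !size_cat; lia.
Qed.

(** Both pairings equal the sum of [l (v0 u v1) * x (v0 w v1)] over all pairs [v0], [v1]; the rest
    is an exchange of finite sums over a common range of words. *)
Lemma transposes_Psi w u : transposes (Psi w u) (Psi u w).
Proof.
move=> l N0 lN0; pose N := N0.
(* A bound of the form [N + size u] becomes [N + size w] under the transpose, without truncated
   subtraction. *)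
have lN : vanishes_from (N + size u) l by move=> v h; apply: lN0; apply: leq_trans h; exact: leq_addr.
have vN := @Psi_vanishes w u l N lN.
split; first by exists (N + size w)%N.
move=> x; pose M := (N + size w + size u)%N.
have lM : vanishes_from M l by move=> v h; apply: lN; apply: leq_trans h; rewrite /M; lia.
have vM : vanishes_from M (Psi u w l) by move=> v h; apply: vN; apply: leq_trans h; rewrite /M; lia.
rewrite (pairing_words _ lM) (pairing_words _ vM).
have wM v : v \in undup (words M) -> (size v < M)%N by rewrite mem_undup mem_words.
rewrite big_seq; under eq_bigr => v /wM vs do rewrite (Psi_words _ _ _ vs) mulr_sumr.
rewrite -big_seq exchange_big.
rewrite [RHS]big_seq; under [RHS]eq_bigr => v /wM vs do rewrite (Psi_words _ _ _ vs) mulr_suml.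
rewrite -big_seq [RHS]exchange_big.
apply: eq_bigr => -[p q] _ /=.
have one (g : word d -> R) z : ((M <= size z)%N -> g z = 0) ->
    \sum_(v <- undup (words M)) (if z == v then g v else 0) = g z.
  move=> gz; have [zM|zM] := ltnP (size z) M.
    rewrite (bigD1_seq z) ?undup_uniq ?mem_undup ?mem_words//= eqxx big1 ?addr0// => v vz.
    by rewrite eq_sym (negbTE vz).
  rewrite big1_seq ?gz// => v /andP[_ /wM vM']; case: eqP => // e.
  by move: vM'; rewrite -e ltnNge zM.
transitivity (l (p ++ u ++ q) * x (p ++ w ++ q)).
  rewrite -(one (fun v => l v * x (p ++ w ++ q))); last by move=> h; rewrite lM ?mul0r.
  by apply: eq_bigr => v _; case: ifP => //; rewrite mulr0.
rewrite -(one (fun v => l (p ++ u ++ q) * x v)).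
  by apply: eq_bigr => v _; case: ifP => //; rewrite mul0r.
move=> h; rewrite lN ?mul0r//; move: h; rewrite /M !size_cat; lia.
Qed.

(** Both series are finite: [A'] lowers the length bound of the support by one, and the powers of
    [A] vanish at each coordinate from some point on. The powers are then transposed term by term.
    Bound 0 is a separate hypothesis because it cannot drop further. *)
Lemma transposes_exp A A' : transposes A A' ->
  (forall l N, vanishes_from N.+1 l -> vanishes_from N (A' l)) ->
  (forall l, vanishes_from 0 l -> vanishes_from 0 (A' l)) ->
  (forall n x v, (size v < n)%N -> iter n A x v = 0) ->
  transposes (exp_op A) (exp_op A').
Proof.
move=> h lower lower0 nil l N lN.
have it n : vanishes_from (N - n) (iter n A' l).
  elim: n => [|n IH]; first by rewrite subn0.
  rewrite subnS /=; move: IH; case: (N - n)%N => [|m] IH; [exact: lower0|exact: lower].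
have it0 n v : (N <= n)%N -> iter n A' l v = 0.
  by rewrite -subn_eq0 => /eqP e; apply: it; rewrite e.
have E v : exp_op A' l v = \sum_(n < N) (n`!%:R)^-1 * iter n A' l v.
  by apply: exp_op_trunc => n Nn; exact: it0.
have vE : vanishes_from N (exp_op A' l).
  move=> v Nv; rewrite E big1// => n _; rewrite it ?mulr0//.
  by apply: leq_trans Nv; exact: leq_subr.
split; first by exists N.
move=> x; rewrite (pairing_words _ lN) (pairing_words _ vE).
rewrite big_seq; under eq_bigr => v.
  rewrite mem_undup mem_words => vN.
  rewrite (@exp_op_trunc _ _ _ N); last by move=> n Nn; apply: nil; exact: leq_trans Nn.
  rewrite mulr_sumr; over.
rewrite -big_seq exchange_big /=; under [RHS]eq_bigr do rewrite E mulr_suml.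
rewrite [RHS]exchange_big; apply: eq_bigr => n _ /=.
have en y : pairing l (iter n A y) = pairing (iter n A' l) y.
  elim: (n : nat) y => // k IH y /=.
  by rewrite -iterS iterSr IH; have [_ ->] := h _ _ (it k).
have itN : vanishes_from N (iter n A' l).
  by move=> v Nv; apply: it; apply: leq_trans Nv; exact: leq_subr.
have := en x; rewrite (pairing_words _ lN) (pairing_words _ itN) => e.
under eq_bigr do rewrite mulrCA.
under [RHS]eq_bigr do rewrite -mulrA.
by rewrite -!mulr_sumr e.
Qed.

Lemma is_adjoint_transposes A A' : continuous_linear A -> transposes A A' -> is_adjoint A A'.
Proof.
move=> cA h; split=> // l /finitely_supportedP[N lN]; have [h1 h2] := h l N lN.
by split=> //; exact/finitely_supportedP.
Qed.

Lemma expandable_row Phi Gamma : expandable Phi Gamma ->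
  (forall theta, exists (I : finType) (f : I -> R) (u : I -> word d),
    forall x, Phi theta x = \sum_(p : I) f p * x (u p)) /\
  exists (I : finType) (f : I -> R) (u : I -> word d), forall x, Gamma x = \sum_(p : I) f p * x (u p).
Proof.
move=> [I [f [f' [v [h1 _ h3]]]]]; split; last by exists I, f', v.
by move=> theta; exists I, (f ^~ theta), v => x; exact: h1.
Qed.

Lemma ou_tensor_adjoint (kappa : 'I_d -> R) theta : is_adjoint (ou_tensor kappa theta)
  (prod_op (fun i => J i (kappa i * theta))
   \o exp_op (\sum_(i < d) ((1 - expR (- (2 * kappa i * theta))) / 2)
        *: Psi [:: letter i; letter i] [:: letter0 d])).
Proof.
apply: is_adjoint_transposes.
  by apply: row_finite_continuous_linear => v; have [h _] := expandable_row (ou_tensor_expandable kappa v).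
apply: transposes_comp; last first.
  rewrite (_ : prod_op _ = fun x v => weight (fun i => kappa i * theta) v * x v).
    exact: transposes_diagonal.
  by apply/funext => x; apply/funext => v; rewrite prod_JE.
have lower l N : vanishes_from N.+1 l -> vanishes_from N
    ((\sum_(i < d) ((1 - expR (- (2 * kappa i * theta))) / 2)
        *: Psi [:: letter i; letter i] [:: letter0 d]) l).
  move=> lN v Nv; rewrite sum_opE big1// => i _; rewrite Psi_eq0 ?mulr0// => -[p q] /= h.
  by apply: lN; move: Nv; rewrite -h !size_cat /=; lia.
apply: transposes_exp.
- by apply: transposes_sum => i; exact: transposes_Psi.
- exact: lower.
- by move=> l l0; apply: lower => v _; exact: l0.
- by move=> n x v; exact: iter_contraction_eq0.
Qed.

Lemma generator_tensor_adjoint (kappa : 'I_d -> R) : is_adjoint (generator_tensor kappa)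
  (\sum_(i < d) kappa i *: (Psi [:: letter i; letter i] [:: letter0 d] - Lambda i)).
Proof.
apply: is_adjoint_transposes.
  by apply: row_finite_continuous_linear => v; have [_ h] := expandable_row (ou_tensor_expandable kappa v).
apply: transposes_sum => i; apply: transposesB; first exact: transposes_Psi.
exact: transposes_diagonal.
Qed.

End tensor_operators.

(** * Square-integrable random variables *)

Definition L1 d (T : measurableType d) (R : realType) (P : probability T R) (X : T -> R) : Prop :=
  P.-integrable setT (EFin \o X).

Definition L2 d (T : measurableType d) (R : realType) (P : probability T R) (X : T -> R) : Prop :=
  measurable_fun setT X /\ L1 P (fun w => X w ^+ 2).

Definition mean d (T : measurableType d) (R : realType) (P : probability T R) (X : T -> R) : R :=
  \int[P]_w X w.

Definition nrm d (T : measurableType d) (R : realType) (P : probability T R) (X : T -> R) : R :=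
  Num.sqrt (mean P (fun w => X w ^+ 2)).

Section mean.
Context d (T : measurableType d) (R : realType) (P : probability T R).
Implicit Types (X Y Z : T -> R) (c : R).
Local Notation L1 := (L1 P).
Local Notation L2 := (L2 P).
Local Notation mean := (mean P).
Local Notation nrm := (nrm P).

Lemma L1_measurable X : L1 X -> measurable_fun setT X.
Proof. by move=> /measurable_int/measurable_EFinP. Qed.

Lemma L2_measurable X : L2 X -> measurable_fun setT X.
Proof. by case. Qed.

Lemma L1_sqr X : L2 X -> L1 (fun w => X w ^+ 2).
Proof. by case. Qed.

Lemma L1D X Y : L1 X -> L1 Y -> L1 (fun w => X w + Y w).
Proof. by move=> hX hY; exact: (integrableD measurableT hX hY). Qed.

Lemma L1Z c X : L1 X -> L1 (fun w => c * X w).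
Proof. by move=> hX; exact: (integrableZl measurableT c hX). Qed.

Lemma L1N X : L1 X -> L1 (fun w => - X w).
Proof.
move=> /(L1Z (-1)); apply: eq_integrable => // w _ /=.
by rewrite mulN1r.
Qed.

Lemma L1B X Y : L1 X -> L1 Y -> L1 (fun w => X w - Y w).
Proof. by move=> hX /L1N hY; apply: L1D. Qed.

Lemma L1_cst c : L1 (fun=> c).
Proof. exact: finite_measure_integrable_cst. Qed.

Lemma L1_sum (I : Type) (s : seq I) (F : I -> T -> R) :
  (forall i, L1 (F i)) -> L1 (fun w => \sum_(i <- s) F i w).
Proof.
move=> h; elim: s => [|i s IH].
  by under eq_fun do rewrite big_nil; exact: L1_cst.
by under eq_fun do rewrite big_cons; exact: L1D.
Qed.

Lemma L1_le X Y : measurable_fun setT X -> (forall w, `|X w| <= Y w) -> L1 Y -> L1 X.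
Proof.
move=> mX XY; apply: le_integrable => //; first exact/measurable_EFinP.
by move=> w _ /=; rewrite lee_fin (le_trans (XY w))// ler_norm.
Qed.

Lemma L1_abs X : L1 X -> L1 (fun w => `|X w|).
Proof.
move=> hX; apply: L1_le (fun w => _) (integrable_norm hX).
  by apply: measurableT_comp => //; exact: L1_measurable.
by move=> w /=; rewrite normr_id.
Qed.

Lemma meanD X Y : L1 X -> L1 Y -> mean (fun w => X w + Y w) = mean X + mean Y.
Proof. by move=> hX hY; exact: RintegralD. Qed.

Lemma meanB X Y : L1 X -> L1 Y -> mean (fun w => X w - Y w) = mean X - mean Y.
Proof. by move=> hX hY; exact: RintegralB. Qed.

Lemma meanZ c X : L1 X -> mean (fun w => c * X w) = c * mean X.
Proof. by move=> hX; exact: RintegralZl. Qed.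

Lemma mean_cst c : mean (fun=> c) = c.
Proof. by rewrite /mean Rintegral_cst// [X in fine X](@probability_setT _ _ _ P) mulr1. Qed.

Lemma mean_sum (I : Type) (s : seq I) (F : I -> T -> R) :
  (forall i, L1 (F i)) -> mean (fun w => \sum_(i <- s) F i w) = \sum_(i <- s) mean (F i).
Proof.
move=> h; elim: s => [|i s IH].
  by under [in LHS]eq_fun do rewrite big_nil; rewrite mean_cst big_nil.
under [in LHS]eq_fun do rewrite big_cons.
by rewrite meanD ?IH ?big_cons//; exact: L1_sum.
Qed.

Lemma eq_mean X Y : X =1 Y -> mean X = mean Y.
Proof. by move=> /funext ->. Qed.

Lemma mean_ge0 X : (forall w, 0 <= X w) -> 0 <= mean X.
Proof. by move=> h; apply: Rintegral_ge0 => w _. Qed.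

Lemma le_mean X Y : L1 X -> L1 Y -> (forall w, X w <= Y w) -> mean X <= mean Y.
Proof. by move=> hX hY h; apply: le_Rintegral. Qed.

Lemma mean_ae X Y : measurable_fun setT X -> measurable_fun setT Y -> X = Y %[ae P] ->
  mean X = mean Y.
Proof.
move=> mX mY XY; congr fine; apply: ae_eq_integral => //; try exact/measurable_EFinP.
by apply: filterS XY => w h _; rewrite h.
Qed.

Lemma L1_ae X Y : measurable_fun setT Y -> X = Y %[ae P] -> L1 X -> L1 Y.
Proof.
move=> mY XY hX; apply/integrableP; split; first exact/measurable_EFinP.
move/integrableP : (hX) => [_]; congr (_ < _)%E.
apply: ae_eq_integral => //.
- by apply: measurableT_comp => //; exact/measurable_EFinP/L1_measurable.
- by apply: measurableT_comp => //; exact/measurable_EFinP.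
- by apply: filterS XY => w h _ /=; rewrite h.
Qed.

Lemma L2_ae X Y : measurable_fun setT Y -> X = Y %[ae P] -> L2 X -> L2 Y.
Proof.
move=> mY XY [mX hX]; split => //; apply: L1_ae hX.
  exact: measurable_funX.
by apply: filterS XY => w h _; rewrite h.
Qed.

Lemma nrm_ae X Y : measurable_fun setT X -> measurable_fun setT Y -> X = Y %[ae P] ->
  nrm X = nrm Y.
Proof.
move=> mX mY XY; congr Num.sqrt; apply: mean_ae; try exact: measurable_funX.
by apply: filterS XY => w h _; rewrite h.
Qed.

Lemma L2M X Y : L2 X -> L2 Y -> L1 (fun w => X w * Y w).
Proof.
move=> [mX hX] [mY hY]; apply: (@L1_le _ (fun w => X w ^+ 2 + Y w ^+ 2)).
- exact: measurable_funM.
- move=> w; rewrite ler_norml; have := sqr_ge0 (X w + Y w); have := sqr_ge0 (X w - Y w).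
  by have := sqr_ge0 (X w); have := sqr_ge0 (Y w) => *; apply/andP; split; nra.
- exact: L1D.
Qed.

Lemma L2D X Y : L2 X -> L2 Y -> L2 (fun w => X w + Y w).
Proof.
move=> hX hY; have [[mX sX] [mY sY]] := (hX, hY); split; first exact: measurable_funD.
have -> : (fun w => (X w + Y w) ^+ 2) = (fun w => X w ^+ 2 + Y w ^+ 2 + 2 * (X w * Y w)).
  by apply/funext => w; ring.
by apply: L1D; [exact: L1D|apply: L1Z; exact: L2M].
Qed.

Lemma L2Z c X : L2 X -> L2 (fun w => c * X w).
Proof.
move=> [mX sX]; split; first exact: measurable_funM.
have -> : (fun w => (c * X w) ^+ 2) = (fun w => c ^+ 2 * X w ^+ 2).
  by apply/funext => w; rewrite exprMn.
exact: L1Z.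
Qed.

Lemma L2N X : L2 X -> L2 (fun w => - X w).
Proof.
move=> [mX sX]; split; first exact: measurable_funN.
by under eq_fun do rewrite sqrrN.
Qed.

Lemma L2B X Y : L2 X -> L2 Y -> L2 (fun w => X w - Y w).
Proof. by move=> hX /L2N hY; apply: L2D. Qed.

Lemma L2_cst c : L2 (fun=> c).
Proof. by split => //; exact: L1_cst. Qed.

Lemma L2_sum (I : Type) (s : seq I) (F : I -> T -> R) :
  (forall i, L2 (F i)) -> L2 (fun w => \sum_(i <- s) F i w).
Proof.
move=> h; elim: s => [|i s IH].
  by under eq_fun do rewrite big_nil; exact: L2_cst.
by under eq_fun do rewrite big_cons; exact: L2D.
Qed.

Lemma L2_L1 X : L2 X -> L1 X.
Proof.
move=> hX; have := L2M hX (L2_cst 1).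
by under eq_fun do rewrite mulr1.
Qed.

Lemma L2_boundedM Z K X : measurable_fun setT Z -> (forall w, `|Z w| <= K) -> L2 X ->
  L2 (fun w => Z w * X w).
Proof.
move=> mZ ZK [mX sX]; split; first exact: measurable_funM.
apply: (@L1_le _ (fun w => K ^+ 2 * X w ^+ 2)).
- by apply: measurable_funX; exact: measurable_funM.
- move=> w; rewrite normrX normrM exprMn -[in leRHS]real_normK ?num_real//.
  rewrite -[in leRHS](@real_normK _ (X w)) ?num_real// real_normK ?num_real//.
  by rewrite ler_wpM2r ?exprn_ge0// ler_sqr ?nnegrE ?(le_trans _ (ZK w)).
- exact: L1Z.
Qed.

Lemma L2_bounded Z K : measurable_fun setT Z -> (forall w, `|Z w| <= K) -> L2 Z.
Proof.
move=> mZ ZK; have := L2_boundedM mZ ZK (L2_cst 1).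
by under eq_fun do rewrite mulr1.
Qed.

Lemma L1_boundedM Z K X : measurable_fun setT Z -> (forall w, `|Z w| <= K) -> L1 X ->
  L1 (fun w => Z w * X w).
Proof.
move=> mZ ZK hX; apply: (@L1_le _ (fun w => K * `|X w|)).
- by apply: measurable_funM => //; exact: L1_measurable.
- by move=> w; rewrite normrM ler_wpM2r.
- by apply: L1Z; exact: L1_abs.
Qed.

Lemma nrm_ge0 X : 0 <= nrm X.
Proof. exact: sqrtr_ge0. Qed.

Lemma nrm_sqr X : nrm X ^+ 2 = mean (fun w => X w ^+ 2).
Proof. by rewrite sqr_sqrtr// mean_ge0// => w; exact: sqr_ge0. Qed.

(** Cauchy-Schwarz, read off from the nonnegative quadratic form [q u v], which is the mean of
    [(u X + v Y) ^+ 2]. *)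
Lemma mean_le_nrm X Y : L2 X -> L2 Y -> `|mean (fun w => X w * Y w)| <= nrm X * nrm Y.
Proof.
move=> hX hY; rewrite -ler_sqr ?nnegrE ?mulr_ge0 ?nrm_ge0//.
rewrite exprMn !nrm_sqr real_normK ?num_real//.
set a := mean _; set b := mean (fun w => X w ^+ 2); set c := mean (fun w => Y w ^+ 2).
have c0 : 0 <= c by apply: mean_ge0 => w; exact: sqr_ge0.
have q u v : 0 <= u ^+ 2 * b + 2 * u * v * a + v ^+ 2 * c.
  have -> : u ^+ 2 * b + 2 * u * v * a + v ^+ 2 * c =
    mean (fun w => (u * X w + v * Y w) ^+ 2).
    have -> : (fun w => (u * X w + v * Y w) ^+ 2) =
      (fun w => u ^+ 2 * X w ^+ 2 + 2 * u * v * (X w * Y w) + v ^+ 2 * Y w ^+ 2).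
      by apply/funext => w; ring.
    rewrite !(meanD, meanZ)//; try (exact: L2M || exact: L1_sqr).
    - by apply: L1Z; exact: L1_sqr.
    - by apply: L1Z; exact: L2M.
    - by apply: L1D; apply: L1Z; [exact: L1_sqr|exact: L2M].
    - by apply: L1Z; exact: L1_sqr.
  by apply: mean_ge0 => w; exact: sqr_ge0.
move: c0; rewrite le_eqVlt => /predU1P[c0|c0].
  have [->|a0] := eqVneq a 0; first by rewrite expr0n/= -c0 mulr0.
  (* With [c = 0] the form is affine in its second argument; this argument gives it the value -1. *)
  have := q 1 (- (b + 1) / (2 * a)); rewrite -c0.
  have -> : 1 ^+ 2 * b + 2 * 1 * (- (b + 1) / (2 * a)) * a + (- (b + 1) / (2 * a)) ^+ 2 * 0 = -1.
    by field.
  by rewrite ler0N1.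
have := q c (- a).
have -> : c ^+ 2 * b + 2 * c * - a * a + (- a) ^+ 2 * c = c * (b * c - a ^+ 2) by ring.
by rewrite pmulr_rge0// subr_ge0.
Qed.

Lemma nrmD X Y : L2 X -> L2 Y -> nrm (fun w => X w + Y w) <= nrm X + nrm Y.
Proof.
move=> hX hY; rewrite -ler_sqr ?nnegrE ?addr_ge0 ?nrm_ge0// nrm_sqr sqrrD !nrm_sqr.
have -> : (fun w => (X w + Y w) ^+ 2) = (fun w => X w ^+ 2 + Y w ^+ 2 + 2 * (X w * Y w)).
  by apply/funext => w; ring.
rewrite meanD ?meanD ?meanZ; try (exact: L2M || exact: L1_sqr).
- have := ler_normlW (mean_le_nrm hX hY); rewrite -mulr_natr; lra.
- by apply: L1D; exact: L1_sqr.
- by apply: L1Z; exact: L2M.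
Qed.

Lemma nrmZ c X : L2 X -> nrm (fun w => c * X w) = `|c| * nrm X.
Proof.
move=> [mX sX]; rewrite /nrm.
have -> : (fun w => (c * X w) ^+ 2) = (fun w => c ^+ 2 * X w ^+ 2).
  by apply/funext => w; rewrite exprMn.
by rewrite meanZ// sqrtrM ?sqr_ge0// sqrtr_sqr.
Qed.

Lemma nrmN X : nrm (fun w => - X w) = nrm X.
Proof. by congr Num.sqrt; apply: eq_mean => w; rewrite sqrrN. Qed.

Lemma nrmB X Y : L2 X -> L2 Y -> nrm (fun w => X w - Y w) <= nrm X + nrm Y.
Proof. by move=> hX hY; rewrite -(nrmN Y); apply: nrmD => //; exact: L2N. Qed.

Lemma nrm_cst c : nrm (fun=> c) = `|c|.
Proof. by rewrite /nrm mean_cst sqrtr_sqr. Qed.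

Lemma nrm_sum (I : Type) (s : seq I) (F : I -> T -> R) : (forall i, L2 (F i)) ->
  nrm (fun w => \sum_(i <- s) F i w) <= \sum_(i <- s) nrm (F i).
Proof.
move=> h; elim: s => [|i s IH].
  by under eq_fun do rewrite big_nil; rewrite nrm_cst normr0 big_nil.
under eq_fun do rewrite big_cons; rewrite big_cons.
apply: le_trans (nrmD _ _) _ => //; first exact: L2_sum.
by rewrite lerD2l.
Qed.

Lemma mean_abs_nrm X : L2 X -> mean (fun w => `|X w|) <= nrm X.
Proof.
move=> [mX sX].
have hX : L2 (fun w => `|X w|).
  split; first exact: measurableT_comp.
  by under eq_fun do rewrite real_normK ?num_real//.
have := mean_le_nrm hX (L2_cst 1); rewrite nrm_cst normr1 mulr1.
have -> : nrm (fun w => `|X w|) = nrm X.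
  by congr Num.sqrt; apply: eq_mean => w; rewrite real_normK ?num_real.
under eq_mean do rewrite mulr1.
by apply: le_trans; exact: ler_norm.
Qed.

Lemma mean_abs_le_nrm X Y : L2 X -> L2 Y ->
  mean (fun w => `|X w * Y w|) <= nrm X * nrm Y.
Proof.
have abs Z : L2 Z -> L2 (fun w => `|Z w|).
  move=> [mZ sZ]; split; first exact: measurableT_comp.
  by under eq_fun do rewrite real_normK ?num_real//.
have nabs Z : nrm (fun w => `|Z w|) = nrm Z.
  by congr Num.sqrt; apply: eq_mean => w; rewrite real_normK ?num_real.
move=> hX hY; have := mean_le_nrm (abs _ hX) (abs _ hY); rewrite !nabs.
under eq_mean do rewrite -normrM.
by apply: le_trans; exact: ler_norm.
Qed.

Lemma nrm_eq0_ae X : L2 X -> nrm X = 0 -> X = (fun=> 0) %[ae P].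
Proof.
move=> [mX sX] n0.
have m0 : mean (fun w => X w ^+ 2) = 0 by rewrite -nrm_sqr n0 expr0n.
have i0 : (\int[P]_w `|(X w ^+ 2)%:E| = 0)%E.
  under eq_integral do rewrite gee0_abs ?lee_fin ?sqr_ge0//.
  by rewrite -(fineK (integrable_fin_num measurableT sX)) [fine _]m0.
have /(ae_eq_integral_abs P measurableT) : measurable_fun setT (fun w => (X w ^+ 2)%:E).
  by apply/measurable_EFinP; exact: measurable_funX.
move=> [/(_ i0) h _]; apply: filterS h => w h hw.
by have := h hw => -[] /eqP; rewrite sqrf_eq0 => /eqP.
Qed.

Lemma L1_integral X : L1 X -> (\int[P]_w (X w)%:E)%E = (mean X)%:E.
Proof. by move=> hX; rewrite -[LHS]fineK//; exact: integrable_fin_num. Qed.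

Lemma Lnorm_nrm X : L2 X -> ('N[P]_2%:E[EFin \o X])%E = (nrm X)%:E.
Proof.
move=> [mX sX]; rewrite unlock.
have -> : (\int[P]_x (`|(EFin \o X) x| `^ 2) = (mean (fun w => X w ^+ 2))%:E)%E.
  rewrite -(L1_integral sX).
  by apply: eq_integral => w _ /=; rewrite powR_mulrn ?normr_ge0// real_normK ?num_real.
by rewrite poweR_EFin powR12_sqrt// mean_ge0// => w; exact: sqr_ge0.
Qed.

Lemma Lfun2P X : (X \in Lfun P 2%:E) <-> L2 X.
Proof.
split=> [h|hX].
  split; last exact: Lfun2_integrable_sqr.
  by move: h; rewrite inE => /andP[/[!inE]].
rewrite inE; apply/andP; split; first by rewrite inE/=; exact: L2_measurable.
by rewrite inE/= /finite_norm Lnorm_nrm// ltry.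
Qed.

Lemma Lnorm_lty_L2 X : measurable_fun setT X -> ('N[P]_2%:E[EFin \o X] < +oo)%E -> L2 X.
Proof.
move=> mX h; apply/Lfun2P; rewrite inE; apply/andP; split; first by rewrite inE.
by rewrite inE.
Qed.

Lemma nrm_sq_orthogonal n (M : nat -> T -> R) : (forall k, L2 (M k)) ->
  (forall k l, (l < k < n)%N -> mean (fun w => M l w * M k w) = 0) ->
  nrm (fun w => \sum_(k < n) M k w) ^+ 2 = \sum_(k < n) nrm (M k) ^+ 2.
Proof.
move=> hM; elim: n => [|n IH] h.
  by under eq_fun do rewrite big_ord0; rewrite nrm_cst normr0 expr0n big_ord0.
rewrite big_ord_recr/= -IH; last by move=> k l /andP[lk kn]; rewrite h// lk ltnW.
rewrite !nrm_sqr.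
have hS : L2 (fun w => \sum_(k < n) M k w) by exact: L2_sum.
have -> : mean (fun w => (\sum_(k < n.+1) M k w) ^+ 2) =
  mean (fun w => (\sum_(k < n) M k w) ^+ 2 + M n w ^+ 2 + 2 * (\sum_(k < n) M k w * M n w)).
  by apply: eq_mean => w; rewrite big_ord_recr/= -mulr_suml; ring.
have hs : forall k : 'I_n, L1 (fun w => M k w * M n w) by move=> k; exact: L2M.
rewrite meanD ?meanD ?meanZ ?mean_sum//.
- by rewrite big1 ?mulr0 ?addr0// => k _; rewrite h// ltn_ord ltnSn.
- exact: L1_sum.
- exact: L1_sqr.
- exact: L1_sqr.
- by apply: L1D; exact: L1_sqr.
- by apply: L1Z; exact: L1_sum.
Qed.

(** * Truncation and weak lower semicontinuity of the L2 norm *)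

Definition clip M (x : R) : R := Num.max (- M) (Num.min x M).

Lemma clip_abs M x : 0 <= M -> `|clip M x| <= M.
Proof.
move=> M0; rewrite /clip ler_norml le_max lexx/= ge_max ge_min lexx orbT andbT.
by rewrite -subr_ge0 opprK addr_ge0.
Qed.

Lemma clip_id M x : `|x| <= M -> clip M x = x.
Proof.
rewrite ler_norml => /andP[h1 h2]; rewrite /clip.
by rewrite (min_idPl h2); apply/max_idPr.
Qed.

Lemma clip_le_abs M x : 0 <= M -> `|clip M x| <= `|x|.
Proof.
move=> M0; have [h|h] := leP `|x| M; first by rewrite clip_id.
exact: (le_trans (clip_abs _ M0) (ltW h)).
Qed.

Lemma clip_sqr_le M x : 0 <= M -> clip M x ^+ 2 <= x * clip M x.
Proof.
move=> M0; rewrite /clip; case: (leP x M) => h1; case: (leP (- M) _) => h2; nra.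
Qed.

Lemma measurable_clip M X : measurable_fun setT X -> measurable_fun setT (fun w => clip M (X w)).
Proof.
by move=> mX; apply: measurable_maxr => //; apply: measurable_minr.
Qed.

(** Dominated convergence with bound [|X Y|]. It extends identities tested against bounded variables
    to square-integrable ones. *)
Lemma cvg_mean_clip X Y : measurable_fun setT X -> L1 Y -> L1 (fun w => X w * Y w) ->
  mean (fun w => clip n%:R (X w) * Y w) @[n --> \oo] --> mean (fun w => X w * Y w).
Proof.
move=> mX hY hXY.
have mY := L1_measurable hY.
have mC n : measurable_fun setT (fun w => clip n%:R (X w) * Y w).
  by apply: measurable_funM => //; exact: measurable_clip.
have : (\int[P]_w (clip n%:R (X w) * Y w)%:E)%E @[n --> \oo] -->
    (\int[P]_w (X w * Y w)%:E)%E.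
  apply: (@dominated_cvg _ _ _ P setT measurableT _ _ (fun w => `|X w * Y w|%:E)) => //.
  - by move=> n; exact/measurable_EFinP.
  - move=> w _; apply/fine_cvgP; split; first by near=> n.
    apply: cvg_near_cst; near=> n; rewrite /= clip_id//.
    by near: n; exact: nbhs_infty_ger.
  - exact: L1_abs.
  - by move=> n w _; rewrite /= lee_fin !normrM ler_wpM2r// clip_le_abs.
rewrite (L1_integral hXY) => /fine_cvg; exact.
Unshelve. all: end_near. Qed.

Lemma L2_clip M X : 0 <= M -> measurable_fun setT X -> L2 (fun w => clip M (X w)).
Proof.
move=> M0 mX; apply: (@L2_bounded _ M); first exact: measurable_clip.
by move=> w; exact: clip_abs.
Qed.

(* Weak lower semicontinuity of the L2 norm, tested against truncations of the limit. *)
Lemma nrm_le_L1_limit X (U : nat -> T -> R) K : L2 X -> (forall n, L2 (U n)) ->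
  (forall n, nrm (U n) <= K) -> mean (fun w => `|U n w - X w|) @[n --> \oo] --> 0 ->
  nrm X <= K.
Proof.
move=> hX hU UK cU; have K0 : 0 <= K := le_trans (nrm_ge0 _) (UK 0%N).
have mX := L2_measurable hX.
have hC M : 0 <= M -> L2 (fun w => clip M (X w)) by move=> M0; exact: L2_clip.
have step n : mean (fun w => X w * clip n%:R (X w)) <= K * nrm (fun w => clip n%:R (X w)).
  set Z := (fun w => clip n%:R (X w)).
  have hZ : L2 Z by exact: hC.
  have cv : K * nrm Z + n%:R * mean (fun w => `|U m w - X w|) @[m --> \oo] --> K * nrm Z.
    rewrite -[X in _ --> X]addr0; apply: cvgD; first exact: cvg_cst.
    by rewrite -(mulr0 n%:R); apply: cvgM => //; exact: cvg_cst.
  rewrite -(cvg_lim _ cv)//; apply: limr_ge; first by apply/cvg_ex; exists (K * nrm Z).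
  near=> m.
  have -> : mean (fun w => X w * Z w) =
      mean (fun w => U m w * Z w) - mean (fun w => Z w * (U m w - X w)).
    rewrite -meanB; first by apply: eq_mean => w; ring.
      exact: L2M.
    by apply: L2M => //; exact: L2B.
  apply: lerD.
    apply: (le_trans (ler_normlW (mean_le_nrm (hU m) hZ))).
    by rewrite ler_wpM2r// nrm_ge0.
  have h1 : L1 (fun w => Z w * (U m w - X w)) by apply: L2M => //; exact: L2B.
  have h2 : L1 (fun w => `|U m w - X w|) by apply: L1_abs; apply: L2_L1; exact: L2B.
  rewrite -meanZ//; rewrite lerNl.
  apply: (@le_trans _ _ (mean (fun w => -1 * (n%:R * `|U m w - X w|)))).
    by rewrite [leRHS]meanZ ?mulN1r//; exact: L1Z.
  apply: le_mean => //; first by apply: L1Z; exact: L1Z.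
  move=> w; rewrite mulN1r lerNl; apply: (le_trans (ler_norm _)).
  by rewrite normrN normrM ler_wpM2r// clip_abs.
have step2 n : mean (fun w => clip n%:R (X w) * X w) <= K ^+ 2.
  have := step n; set Z := (fun w => clip n%:R (X w)).
  have -> : mean (fun w => clip n%:R (X w) * X w) = mean (fun w => X w * Z w).
    by apply: eq_mean => w; rewrite mulrC.
  have hZ : L2 Z by exact: hC.
  have : nrm Z ^+ 2 <= mean (fun w => X w * Z w).
    rewrite nrm_sqr; apply: le_mean; [exact: L1_sqr|exact: L2M|].
    by move=> w; exact: clip_sqr_le.
  (* From [nrm Z ^+ 2 <= E[X Z] <= K * nrm Z] follows first [nrm Z <= K], then [E[X Z] <= K ^+
     2]. *)
  by have := nrm_ge0 Z; nra.
have := cvg_mean_clip mX (L2_L1 hX) (L2M hX hX).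
move=> cv; rewrite -ler_sqr ?nnegrE ?nrm_ge0// nrm_sqr.
have -> : mean (fun w => X w ^+ 2) = mean (fun w => X w * X w) by [].
rewrite -(cvg_lim _ cv)//; apply: limr_le; first by apply/cvg_ex; eexists; exact: cv.
by near=> n; exact: step2.
Unshelve. all: end_near. Qed.

End mean.

(** * Gaussian measures *)

Definition pushm d1 d2 (T1 : measurableType d1) (T2 : measurableType d2) (R : realType)
    (mu : {measure set T1 -> \bar R}) (f : T1 -> T2) (mf : measurable_fun setT f) :
    {measure set T2 -> \bar R} :=
  measure_function_pushforward__canonical__measure_function_Measure mu mf.

Section affine.
Variable R : realType.
Implicit Types (m c s t : R) (f : measurableTypeR R -> \bar R).
Local Notation leb := (@lebesgue_measure R).
Local Notation GR := (measurableTypeR R).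

Definition aff m c (x : R) : R := m + c * x.

Lemma measurable_affine m c : measurable_fun setT (aff m c : GR -> GR).
Proof. by apply: (@measurable_funD _ _ R) => //; apply: (@measurable_funM _ _ R). Qed.

(** Lebesgue measure is determined by its values on the intervals []x, y]]; a negative slope
    reverses the interval and swaps its open and closed ends. *)
Lemma lebesgue_affine m c A : c != 0 -> measurable A ->
  leb A = (`|c|%:E * leb (aff m c @^-1` A))%E.
Proof.
move=> c0 mA.
pose mu' : {measure set (measurableTypeR R) -> \bar R} :=
  mscale (NngNum (normr_ge0 c)) (pushm leb (measurable_affine m c)).
rewrite (@lebesgue_measure_unique R mu')// => {mA}A [[x y] _ <-].
have cc : `|c| != 0 by rewrite normr_eq0.
have -> : mu' `]x, y]%classic = (`|c|%:E * leb (aff m c @^-1` `]x, y]))%E by [].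
have [cn|cp] := ltP c 0.
  rewrite (_ : _ @^-1` _ = `[(y - m) / c, (x - m) / c[%classic).
    rewrite !lebesgue_measure_itv /= !lte_fin ltr_nM2r ?invr_lt0//.
    rewrite ltrBlDr subrK; case: ifPn => _; last by rewrite mule0.
    rewrite -!EFinB -EFinM; congr EFin; rewrite (ltr0_norm cn); field.
    by rewrite lt_eqF.
  apply/seteqP; split=> z /=; rewrite /aff !in_itv/= => /andP[h1 h2]; apply/andP; move: h1 h2.
    by rewrite ler_ndivrMr// ltr_ndivlMr// [z * c]mulrC => *; split; lra.
  by rewrite ler_ndivrMr// ltr_ndivlMr// [z * c]mulrC => *; split; lra.
have {}cp : 0 < c by rewrite lt_neqAle eq_sym c0.
rewrite (_ : _ @^-1` _ = `](x - m) / c, (y - m) / c]%classic).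
  rewrite !lebesgue_measure_itv /= !lte_fin ltr_pM2r ?invr_gt0//.
  rewrite ltrBlDr subrK; case: ifPn => _; last by rewrite mule0.
  rewrite -!EFinB -EFinM; congr EFin; rewrite (gtr0_norm cp); field.
  by rewrite gt_eqF.
apply/seteqP; split=> z /=; rewrite /aff !in_itv/= => /andP[h1 h2]; apply/andP; move: h1 h2.
  by rewrite ler_pdivlMr// ltr_pdivrMr// [z * c]mulrC => *; split; lra.
by rewrite ler_pdivlMr// ltr_pdivrMr// [z * c]mulrC => *; split; lra.
Qed.

Lemma integral_affine m c f : c != 0 -> measurable_fun setT f ->
  (forall x, 0 <= f x)%E ->
  (\int[leb]_x f x = `|c|%:E * \int[leb]_x f (aff m c x))%E.
Proof.
move=> c0 mf f0.
rewrite (@eq_measure_integral _ _ _ setT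
  (mscale (NngNum (normr_ge0 c)) (pushm leb (measurable_affine m c)))); last first.
  by move=> A mA _; exact: lebesgue_affine.
rewrite ge0_integral_mscale//= ge0_integral_pushforward//.
exact: measurable_affine.
Qed.

End affine.

Section normal.
Variable R : realType.
Implicit Types (m c s t a b : R) (f : measurableTypeR R -> \bar R).
Local Notation leb := (@lebesgue_measure R).
Local Notation GR := (measurableTypeR R).

(** The density agrees almost everywhere with the Radon-Nikodym derivative, for which the change of
    measure is known. *)
Lemma integral_normal_prob m s f : measurable_fun setT f -> (forall x, 0 <= f x)%E ->
  (\int[normal_prob m s]_x f x = \int[leb]_x (f x * (normal_pdf m s x)%:E))%E.
Proof.
move=> mf f0.
rewrite -(@Radon_Nikodym_SigmaFinite.change_of_variables _ _ _
  (normal_prob m s) leb (normal_prob_dominates m s) f setT)//.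
have mI := @Radon_Nikodym_SigmaFinite.f_integrable _ _ _ _ _ (normal_prob_dominates m s).
apply: ae_eq_integral => //.
- by apply: emeasurable_funM => //; exact: measurable_int mI.
- apply: emeasurable_funM => //; apply/measurable_EFinP.
  exact: measurable_normal_pdf.
- apply: ae_eqe_mul2l; apply: integral_ae_eq => //.
    by apply/measurable_EFinP; exact: measurable_normal_pdf.
  move=> E _ mE; rewrite -Radon_Nikodym_SigmaFinite.f_integral//.
  exact: normal_prob_dominates.
Qed.

Lemma normal_pdf_affine m s c x : c != 0 -> s != 0 ->
  normal_pdf 0 s x = `|c| * normal_pdf m (c * s) (m + c * x).
Proof.
move=> c0 s0; rewrite !normal_pdfE ?mulf_neq0// /normal_peak /normal_fun.
have -> : (c * s) ^+ 2 * pi *+ 2 = c ^+ 2 * (s ^+ 2 * pi *+ 2) by ring.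
rewrite sqrtrM ?sqr_ge0// sqrtr_sqr invfM !mulrA.
rewrite divff ?normr_eq0// mul1r; congr (_ * expR _).
rewrite !mulNr; congr (- _); field.
by rewrite c0 s0.
Qed.

Lemma normal_prob_affine m s c A : c != 0 -> s != 0 -> measurable A ->
  normal_prob 0 s (aff m c @^-1` A) = normal_prob m (c * s) A.
Proof.
move=> c0 s0 mA.
have mA' : measurable (aff m c @^-1` A).
  by rewrite -[X in measurable X]setTI; apply: measurable_affine.
rewrite /normal_prob.
transitivity (\int[leb]_x ((fun x => (normal_pdf m (c * s) x)%:E) \_ A) x)%E; last first.
  by rewrite -integral_mkcond.
rewrite integral_mkcond [RHS](@integral_affine _ m c _ c0); last 2 first.
- apply/(measurable_restrictT _ _).1 => //.
  by apply/measurable_EFinP/measurable_funTS; exact: measurable_normal_pdf.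
- by move=> x; rewrite patchE; case: ifP => //; rewrite lee_fin normal_pdf_ge0.
rewrite -ge0_integralZl//; last 2 first.
- apply: (@measurableT_comp _ _ _ _ _ _ _ _ (aff m c)); last first.
    exact: measurable_affine.
  apply/(measurable_restrictT _ _).1 => //.
  by apply/measurable_EFinP/measurable_funTS; exact: measurable_normal_pdf.
- by move=> x _; rewrite patchE; case: ifP => //; rewrite lee_fin normal_pdf_ge0.
apply: eq_integral => x _; rewrite !patchE.
rewrite (_ : (x \in _) = (m + c * x \in A)); last by apply/idP/idP; rewrite !inE.
case: ifP => _; last by rewrite mule0.
by rewrite (@normal_pdf_affine m s c x).
Qed.

Lemma normal_pdf_sqr m s t x : s ^+ 2 = t ^+ 2 -> normal_pdf m s x = normal_pdf m t x.
Proof.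
move=> st; have st0 : (s == 0) = (t == 0) by rewrite -(sqrf_eq0 s) st sqrf_eq0.
rewrite /normal_pdf st0; case: ifP => // _.
by rewrite /normal_peak /normal_fun st.
Qed.

(** The left side is the density at [(u, z)] of the pair [(U, a U + b V)], with [U] and [V]
    independent of deviation [s]. Because [a ^+ 2 + b ^+ 2 = 1], its exponent [- (u ^+ 2 + z ^+ 2 -
    2 a u z) / (2 b ^+ 2 s ^+ 2)] is symmetric in [u] and [z]. *)
Lemma normal_pdf_swap s a b u z : s != 0 -> b != 0 -> a ^+ 2 + b ^+ 2 = 1 ->
  normal_pdf 0 s u * normal_pdf (a * u) (b * s) z =
  normal_pdf 0 s z * normal_pdf (a * z) (b * s) u.
Proof.
move=> s0 b0 ab; rewrite !normal_pdfE ?mulf_neq0// /normal_fun.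
rewrite [LHS]mulrACA [RHS]mulrACA -!expRD; congr (_ * expR _).
rewrite -[in RHS](mul1r (z - 0)) -[in LHS](mul1r (u - 0)).
have ab' : a ^+ 2 = 1 - b ^+ 2 by rewrite -ab addrK.
have -> : forall p q, - (1 * (p - 0)) ^+ 2 / (s ^+ 2 *+ 2) + - (q - a * p) ^+ 2 / ((b * s) ^+ 2 *+ 2)
  = - ((b ^+ 2 + a ^+ 2) * p ^+ 2 + q ^+ 2 - 2 * a * p * q) / ((b * s) ^+ 2 *+ 2).
  by move=> p q; field; rewrite b0 s0.
have -> : forall p q, - (1 * (p - 0)) ^+ 2 / (s ^+ 2 *+ 2) + - (q - a * p) ^+ 2 / ((b * s) ^+ 2 *+ 2)
  = - ((b ^+ 2 + a ^+ 2) * p ^+ 2 + q ^+ 2 - 2 * a * p * q) / ((b * s) ^+ 2 *+ 2).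
  by move=> p q; field; rewrite b0 s0.
by rewrite (addrC (b ^+ 2)) ab !mul1r; congr (- _ / _); ring.
Qed.

Lemma measurable_affine_preimage m c (C : set R) : measurable C -> measurable (aff m c @^-1` C).
Proof. by move=> mC; rewrite -[X in measurable X]setTI; apply: measurable_affine. Qed.

(** Given the first coordinate [u], the rotated variable is normal with mean [a u]. Once the joint
    density is swapped and the integrals exchanged, the integral over [u] is that of a density,
    hence 1. For [b = 0] the conditional law degenerates, and the image of a single coordinate is
    used instead. *)
Lemma normal_rotation s a b (C : set GR) : s != 0 -> 0 < a -> 0 <= b ->
  a ^+ 2 + b ^+ 2 = 1 -> measurable C ->
  (normal_prob 0 s \x normal_prob 0 s)%E [set z : GR * GR | C (a * z.1 + b * z.2)] =
  normal_prob 0 s C.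
Proof.
move=> s0 a0; rewrite le_eqVlt => /predU1P[<-|b0] ab mC.
  have -> : [set z : GR * GR | C (a * z.1 + 0 * z.2)] = (aff 0 a @^-1` C) `*` setT.
    by apply/seteqP; split=> -[u v]/=; rewrite /aff mul0r addr0 add0r// => -[].
  rewrite product_measure1E//; last exact: measurable_affine_preimage.
  rewrite [X in (_ * X)%E](@probability_setT _ _ _ (normal_prob 0 s)) mule1.
  apply: (etrans (normal_prob_affine 0 (lt0r_neq0 a0) s0 mC)).
  apply: eq_integral => x _; congr EFin; apply: normal_pdf_sqr.
  by rewrite exprMn; move: ab; rewrite expr0n/= addr0 => ->; rewrite mul1r.
have bs0 : b * s != 0 by rewrite mulf_neq0// gt_eqF.
have mpdf2 : measurable_fun setT (fun z : GR * GR => normal_pdf (a * z.1) (b * s) z.2).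
  have -> : (fun z : GR * GR => normal_pdf (a * z.1) (b * s) z.2) =
      normal_pdf 0 (b * s) \o (fun z : GR * GR => z.2 - a * z.1).
    by apply/funext => z/=; rewrite !normal_pdfE// /normal_fun subr0.
  apply: measurableT_comp; first exact: measurable_normal_pdf.
  apply: (@measurable_funB _ _ R); first exact: measurable_snd.
  by apply: (@measurable_funM _ _ R) => //; exact: measurable_fst.
pose f (z : GR * GR) : \bar R := (normal_pdf 0 s z.1 * (normal_pdf (a * z.1) (b * s) z.2
  * \1_C z.2))%:E.
have mf : measurable_fun setT f.
  apply/measurable_EFinP; apply: (@measurable_funM _ _ R).
    by apply: (@measurableT_comp _ _ _ _ _ _ (normal_pdf 0 s)) => //; exact: measurable_normal_pdf.
  apply: (@measurable_funM _ _ R) => //.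
  by apply: (@measurableT_comp _ _ _ _ _ _ (\1_C : GR -> R)) => //; exact: measurable_indic.
have f0 z : (0 <= f z)%E.
  by rewrite lee_fin !mulr_ge0 ?normal_pdf_ge0// indicE.
transitivity (\int[leb]_u \int[leb]_z f (u, z))%E.
  rewrite /product_measure1 /= integral_normal_prob//; last first.
    apply: (@measurable_fun_xsection _ _ GR GR R (normal_prob 0 s)) => //.
    rewrite -[X in measurable X]setTI.
    have : measurable_fun setT (fun z : GR * GR => a * z.1 + b * z.2).
      by apply: (@measurable_funD _ _ R); apply: (@measurable_funM _ _ R) => //.
    exact.
  apply: eq_integral => u _.
  rewrite (_ : xsection _ _ = aff (a * u) b @^-1` C); last first.
    by apply/seteqP; split=> z; rewrite /xsection/= ?inE.
  transitivity ((normal_pdf 0 s u)%:E * normal_prob (a * u) (b * s) C)%E.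
    by rewrite muleC; congr (_ * _)%E; apply: normal_prob_affine => //; rewrite gt_eqF.
  rewrite /normal_prob integral_mkcond.
  rewrite -ge0_integralZl//.
  - apply: eq_integral => z _; rewrite /f patchE indicE.
    by case: ifP => _; rewrite ?mulr1// !mulr0 mule0.
  - apply/(measurable_restrictT _ _).1 => //.
    by apply/measurable_funTS/measurable_EFinP; exact: measurable_normal_pdf.
  - by move=> z _; rewrite patchE; case: ifP => // _; rewrite lee_fin normal_pdf_ge0.
  - by rewrite lee_fin normal_pdf_ge0.
rewrite (@fubini_tonelli _ _ _ _ _ leb leb)//.
rewrite /normal_prob [RHS]integral_mkcond; apply: eq_integral => z _.
under eq_integral => u _.
  rewrite /f/= mulrA (@normal_pdf_swap s a b)// ?gt_eqF// -mulrA EFinM mulrC [X in (_ * X%:E)%E]mulrC.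
  over.
rewrite patchE indicE; case: ifP => zC.
  rewrite ge0_integralZl//; last first.
  - by rewrite lee_fin normal_pdf_ge0.
  - by move=> u _; rewrite mulr1 lee_fin normal_pdf_ge0.
  - by apply/measurable_EFinP/measurable_funM => //; exact: measurable_normal_pdf.
  under eq_integral do rewrite mulr1.
  by rewrite integral_normal_pdf mule1.
by under eq_integral do rewrite mulr0 mule0; rewrite integral0.
Qed.

Lemma normal_fun_pdf s x : 0 < s ->
  normal_fun 0 s x = s * Num.sqrt (pi *+ 2) * normal_pdf 0 s x.
Proof.
move=> s0; rewrite normal_pdfE ?gt_eqF// /normal_peak.
have -> : s ^+ 2 * pi *+ 2 = s ^+ 2 * (pi *+ 2) by ring.
rewrite sqrtrM ?sqr_ge0// sqrtr_sqr gtr0_norm// mulrA divff ?mul1r//.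
by rewrite mulf_neq0// gt_eqF// sqrtr_gt0 mulrn_wgt0// pi_gt0.
Qed.

(** [D] is [1 / (2 s ^+ 2) - 1 / (2 t ^+ 2)], so the unnormalized densities differ by the factor
    [expR (D * x ^+ 2)]. Both bounds are instances of [1 + y <= expR y], at [D * x ^+ 2] and at its
    opposite; once integrated they bracket the second moment without integration by parts. *)
Lemma normal_pdf_compare s t x : 0 < s -> s < t ->
  let D := (t ^+ 2 - s ^+ 2) / (s ^+ 2 * t ^+ 2 *+ 2) in
  s * normal_pdf 0 s x + s * D * (x ^+ 2 * normal_pdf 0 s x) <= t * normal_pdf 0 t x /\
  t * normal_pdf 0 t x <= s * normal_pdf 0 s x + t * D * (x ^+ 2 * normal_pdf 0 t x).
Proof.
move=> s0 st D; have t0 : 0 < t by exact: lt_trans st.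
have K0 : 0 < Num.sqrt (pi *+ 2) :> R by rewrite sqrtr_gt0 mulrn_wgt0// pi_gt0.
have Ht : normal_fun 0 t x = normal_fun 0 s x * expR (D * x ^+ 2).
  rewrite /normal_fun -expRD; congr expR; rewrite /D; field.
  by rewrite !gt_eqF.
have Hs : normal_fun 0 s x = normal_fun 0 t x * expR (- (D * x ^+ 2)).
  by rewrite Ht -mulrA -expRD subrr expR0 mulr1.
split.
  rewrite -(ler_pM2l K0).
  have -> : Num.sqrt (pi *+ 2) * (t * normal_pdf 0 t x) = normal_fun 0 t x.
    by rewrite normal_fun_pdf//; ring.
  apply: (@le_trans _ _ (normal_fun 0 s x * (1 + D * x ^+ 2))).
    by rewrite normal_fun_pdf// le_eqVlt; apply/orP; left; apply/eqP; ring.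
  by rewrite Ht ler_wpM2l ?normal_fun_ge0// expR_ge1Dx.
rewrite -(ler_pM2l K0).
rewrite mulrDr -lerBlDr.
have -> : Num.sqrt (pi *+ 2) * (s * normal_pdf 0 s x) = normal_fun 0 s x.
  by rewrite normal_fun_pdf//; ring.
apply: (@le_trans _ _ (normal_fun 0 t x * (1 + - (D * x ^+ 2)))).
  by rewrite normal_fun_pdf// le_eqVlt; apply/orP; left; apply/eqP; ring.
by rewrite Hs ler_wpM2l ?normal_fun_ge0// expR_ge1Dx.
Qed.

Lemma ge0_integral_normal_pdf m s c : s != 0 -> 0 <= c ->
  (\int[leb]_x (c * normal_pdf m s x)%:E)%E = c%:E.
Proof.
move=> s0 c0; under eq_integral do rewrite EFinM.
rewrite ge0_integralZl//; first by rewrite integral_normal_pdf mule1.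
- by apply/measurable_EFinP; exact: measurable_normal_pdf.
- by move=> x _; rewrite lee_fin normal_pdf_ge0.
Qed.

(** Integrating the comparison of two densities gives [M s' <= t ^+ 2] and [s' ^+ 2 <= M t] whenever
    [s' < t]; letting the two deviations merge leaves only [s ^+ 2]. *)
Lemma normal_second_moment s : 0 < s ->
  (\int[normal_prob 0 s]_x (x ^+ 2)%:E)%E = (s ^+ 2)%:E.
Proof.
have mpdf m s' : measurable_fun setT (normal_pdf m s' : GR -> R).
  exact: measurable_normal_pdf.
have msq : measurable_fun setT (fun x : GR => x ^+ 2 : R) by exact: exprn_measurable.
pose M s := (\int[leb]_x (x ^+ 2 * normal_pdf 0 s x)%:E)%E.
have ME s' : (\int[normal_prob 0 s']_x (x ^+ 2)%:E)%E = M s'.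
  rewrite integral_normal_prob//; last by move=> x; rewrite lee_fin sqr_ge0.
  exact/measurable_EFinP.
have M0 s' : (0 <= M s')%E.
  by apply: integral_ge0 => x _; rewrite lee_fin mulr_ge0 ?sqr_ge0 ?normal_pdf_ge0.
have mM c s' : measurable_fun setT (fun x : GR => (c * (x ^+ 2 * normal_pdf 0 s' x))%:E).
  by apply/measurable_EFinP/measurable_funM => //; exact: measurable_funM.
have IM c s' : 0 <= c -> (\int[leb]_x (c * (x ^+ 2 * normal_pdf 0 s' x))%:E)%E = (c%:E * M s')%E.
  move=> c0; under eq_integral do rewrite EFinM.
  rewrite ge0_integralZl//; first by apply/measurable_EFinP/measurable_funM.
  by move=> x _; rewrite lee_fin mulr_ge0 ?sqr_ge0 ?normal_pdf_ge0.
have key s' t : 0 < s' -> s' < t -> (M s' <= (t ^+ 2)%:E)%E /\ ((s' ^+ 2)%:E <= M t)%E.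
  move=> s0 st; have t0 := lt_trans s0 st.
  have [sn0 tn0] : s' != 0 /\ t != 0 by rewrite !gt_eqF.
  have [sw0 tw0] : 0 <= s' /\ 0 <= t by rewrite !ltW.
  pose D := (t ^+ 2 - s' ^+ 2) / (s' ^+ 2 * t ^+ 2 *+ 2).
  have D0 : 0 < D.
    rewrite divr_gt0// ?subr_gt0 ?ltr_sqr ?nnegrE ?ltW//.
    by rewrite mulrn_wgt0// mulr_gt0// exprn_gt0.
  have [sD0 tD0] : 0 <= s' * D /\ 0 <= t * D by split; rewrite mulr_ge0// ltW.
  have I1 : (s'%:E + (s' * D)%:E * M s' <= t%:E)%E.
    rewrite -(ge0_integral_normal_pdf 0 tn0 tw0) -(ge0_integral_normal_pdf 0 sn0 sw0).
    rewrite -IM; last by rewrite mulr_ge0// ltW.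
    rewrite -ge0_integralD//.
    - apply: ge0_le_integral => //.
      + by move=> x _; rewrite -EFinD lee_fin addr_ge0// mulr_ge0 ?normal_pdf_ge0// mulr_ge0 ?sqr_ge0// normal_pdf_ge0.
      + apply: emeasurable_funD; last exact: mM.
        by apply/measurable_EFinP; exact: measurable_funM.
      + by apply/measurable_EFinP; exact: measurable_funM.
      + by move=> x _; rewrite -EFinD lee_fin; case: (normal_pdf_compare x s0 st).
    - by move=> x _; rewrite lee_fin mulr_ge0 ?normal_pdf_ge0.
    - by apply/measurable_EFinP; exact: measurable_funM.
    - by move=> x _; rewrite lee_fin mulr_ge0// mulr_ge0 ?sqr_ge0// normal_pdf_ge0.
  have I2 : (t%:E <= s'%:E + (t * D)%:E * M t)%E.
    rewrite -(ge0_integral_normal_pdf 0 tn0 tw0) -(ge0_integral_normal_pdf 0 sn0 sw0).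
    rewrite -IM; last by rewrite mulr_ge0// ltW.
    rewrite -ge0_integralD//.
    - apply: ge0_le_integral => //.
      + by move=> x _; rewrite lee_fin mulr_ge0 ?normal_pdf_ge0.
      + by apply/measurable_EFinP; exact: measurable_funM.
      + apply: emeasurable_funD; last exact: mM.
        by apply/measurable_EFinP; exact: measurable_funM.
      + by move=> x _; rewrite -EFinD lee_fin; case: (normal_pdf_compare x s0 st).
    - by move=> x _; rewrite lee_fin mulr_ge0 ?normal_pdf_ge0.
    - by apply/measurable_EFinP; exact: measurable_funM.
    - by move=> x _; rewrite lee_fin mulr_ge0// mulr_ge0 ?sqr_ge0// normal_pdf_ge0.
  have DE : D * (s' ^+ 2 * t ^+ 2 *+ 2) = (t - s') * (t + s').
    by rewrite /D; field; rewrite !gt_eqF.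
  have ts0 : 0 < t - s' by rewrite subr_gt0.
  split.
    move: I1; case: (M s') (M0 s') => [m|_|//]; last first.
      have -> : ((s' * D)%:E * +oo = +oo :> \bar R)%E by rewrite gt0_muley// lte_fin mulr_gt0.
      by rewrite addey.
    rewrite -EFinM -EFinD !lee_fin => m0 I1.
    have I1' : s' * D * m <= t - s' by rewrite lerBrDl.
    have h : s' * D * m * (s' * t ^+ 2 *+ 2) <= (t - s') * (s' * t ^+ 2 *+ 2).
      by rewrite ler_wpM2r// mulrn_wge0// mulr_ge0 ?sqr_ge0 ?ltW.
    have h2 : (t - s') * ((t + s') * m) <= (t - s') * (s' * t ^+ 2 *+ 2).
      apply: le_trans h; rewrite le_eqVlt; apply/orP; left; apply/eqP.
      by rewrite mulrA -DE; ring.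
    rewrite ler_pM2l// in h2.
    rewrite -(@ler_pM2l _ (t + s')) ?addr_gt0//; apply: (le_trans h2).
    by move: (t ^+ 2) (sqr_ge0 t) => q q0; have := mulr_ge0 (ltW ts0) q0; lra.
  move: I2; case: (M t) (M0 t) => [m|_ _|//]; last by rewrite leey.
  rewrite -EFinM -EFinD !lee_fin => m0 I2.
  have I2' : t - s' <= t * D * m by rewrite lerBlDl.
  have h : (t - s') * (s' ^+ 2 * t *+ 2) <= t * D * m * (s' ^+ 2 * t *+ 2).
    by rewrite ler_wpM2r// mulrn_wge0// mulr_ge0 ?sqr_ge0 ?ltW.
  have h2 : (t - s') * (s' ^+ 2 * t *+ 2) <= (t - s') * ((t + s') * m).
    apply: (le_trans h); rewrite le_eqVlt; apply/orP; left; apply/eqP.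
    by rewrite [RHS]mulrA -DE; ring.
  rewrite ler_pM2l// in h2.
  rewrite -(@ler_pM2l _ (t + s')) ?addr_gt0//; apply: le_trans h2.
  by have := sqr_ge0 s'; nra.
move=> s0; rewrite ME; apply/eqP; rewrite eq_le; apply/andP; split.
  have [|sM] := leP (M s) (s ^+ 2)%:E; first by [].
  have : (M s <= ((s + 1) ^+ 2)%:E)%E by case: (key s (s + 1)) => //; rewrite ltrDl.
  move: sM; case EM: (M s) => [m|//|//]; rewrite lte_fin => sm _.
  (* A strict inequality is refuted at the deviation whose square lies halfway between [s ^+ 2] and
     the moment. *)
  pose t := Num.sqrt ((s ^+ 2 + m) / 2).
  have tE : t ^+ 2 = (s ^+ 2 + m) / 2 by rewrite sqr_sqrtr//; have := sqr_ge0 s; lra.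
  have st : s < t by rewrite -ltr_sqr ?nnegrE ?sqrtr_ge0 ?ltW// tE; lra.
  by have [+ _] := key _ _ s0 st; rewrite EM tE lee_fin; lra.
have [|Ms] := leP (s ^+ 2)%:E (M s); first by [].
move: Ms (M0 s); case EM: (M s) => [m|//|//]; rewrite lte_fin lee_fin => ms m0.
pose t := Num.sqrt ((s ^+ 2 + m) / 2).
have tE : t ^+ 2 = (s ^+ 2 + m) / 2 by rewrite sqr_sqrtr//; have := sqr_ge0 s; lra.
have s20 : 0 < s ^+ 2 by rewrite exprn_gt0.
have t0 : 0 < t by rewrite sqrtr_gt0; lra.
have ts : t < s by rewrite -ltr_sqr ?nnegrE ?sqrtr_ge0 ?ltW// tE; lra.
by have [_] := key _ _ t0 ts; rewrite EM tE lee_fin; lra.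
Qed.

(** With [y = x ^+ 2 / (4 s ^+ 2)] one has [x ^+ 4 = 16 s ^+ 4 y ^+ 2 <= 64 s ^+ 4 expR y], and
    [expR y] times the density is [sqrt 2] times the density of deviation [sqrt 2 s]. The constant
    is [64 sqrt 2], rounded up to 128; only the order in [s] matters later. *)
Lemma normal_fourth_moment s : 0 < s ->
  (\int[normal_prob 0 s]_x (x ^+ 4)%:E <= (128 * s ^+ 4)%:E)%E.
Proof.
move=> s0; have r0 : 0 < Num.sqrt 2 :> R by rewrite sqrtr_gt0.
have t0 : Num.sqrt 2 * s != 0 by rewrite mulf_neq0// gt_eqF.
have r2 : Num.sqrt 2 ^+ 2 = 2 :> R by rewrite sqr_sqrtr.
have rle : Num.sqrt 2 <= 2 :> R by rewrite -ler_sqr ?nnegrE ?sqrtr_ge0// r2; lra.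
have mpow : measurable_fun setT (fun x : GR => x ^+ 4 : R) by exact: exprn_measurable.
rewrite integral_normal_prob; last 2 first.
- exact/measurable_EFinP.
- by move=> x; rewrite lee_fin exprn_even_ge0.
have c0 : 0 <= 128 * s ^+ 4 by rewrite mulr_ge0 // exprn_ge0// ltW.
rewrite -(ge0_integral_normal_pdf 0 t0 c0).
apply: ge0_le_integral => //.
- by move=> x _; rewrite -EFinM lee_fin mulr_ge0 ?normal_pdf_ge0// exprn_even_ge0.
- apply/measurable_EFinP/measurable_funM => //; exact: measurable_normal_pdf.
- by apply/measurable_EFinP/measurable_funM => //; exact: measurable_normal_pdf.
move=> x _; rewrite -EFinM lee_fin.
pose y := x ^+ 2 / (s ^+ 2 *+ 4).
have y0 : 0 <= y by rewrite divr_ge0 ?sqr_ge0// mulrn_wge0// sqr_ge0.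
have s20 : 0 < s ^+ 2 by rewrite exprn_gt0.
have ey : x ^+ 4 <= 64 * s ^+ 4 * expR y.
  have : 1 + y / 2 <= expR (y / 2) := expR_ge1Dx _.
  have -> : expR y = expR (y / 2) ^+ 2 by rewrite expr2 -expRD -splitr.
  have -> : x ^+ 4 = 16 * s ^+ 4 * y ^+ 2.
    by rewrite /y; field; rewrite gt_eqF.
  move=> h; have : (y / 2) ^+ 2 <= expR (y / 2) ^+ 2.
    have y20 : 0 <= y / 2 by rewrite divr_ge0.
    rewrite ler_sqr ?nnegrE ?expR_ge0//.
    by apply: le_trans h; rewrite lerDr.
  have : 0 <= s ^+ 4 by rewrite exprn_even_ge0.
  by move: (s ^+ 4) (expR (y / 2) ^+ 2) => a b; nra.
apply: (@le_trans _ _ (64 * s ^+ 4 * expR y * normal_pdf 0 s x)).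
  by rewrite ler_wpM2r// normal_pdf_ge0.
have e1 : expR y * normal_pdf 0 s x = Num.sqrt 2 * normal_pdf 0 (Num.sqrt 2 * s) x.
  rewrite !normal_pdfE ?gt_eqF ?mulr_gt0// mulrCA -expRD /normal_peak.
  have -> : (Num.sqrt 2 * s) ^+ 2 * pi *+ 2 = 2 * (s ^+ 2 * pi *+ 2).
    by rewrite exprMn r2; ring.
  rewrite sqrtrM// invfM !mulrA divff ?gt_eqF// mul1r; congr (_ * expR _).
  by rewrite exprMn r2 /y; field; rewrite gt_eqF.
rewrite -mulrA e1 mulrA ler_wpM2r ?normal_pdf_ge0//.
have : 0 <= s ^+ 4 by rewrite exprn_even_ge0.
by move: (s ^+ 4) => a; nra.
Qed.

Lemma normal_symmetric s (A : set R) : s != 0 -> measurable A ->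
  normal_prob 0 s (aff 0 (-1) @^-1` A) = normal_prob 0 s A.
Proof.
move=> s0 mA; have n1 : -1 != 0 :> R by rewrite oppr_eq0 oner_eq0.
apply: (etrans (normal_prob_affine 0 n1 s0 mA)).
by apply: eq_integral => x _; congr EFin; apply: normal_pdf_sqr; rewrite mulN1r sqrrN.
Qed.

End normal.

(** * Laws of processes and independence *)

Section pi_lambda.
Context {R : realType}.

Lemma measure_ae_eq d (T : measurableType d) (mu : {measure set T -> \bar R}) (A B : set T) :
  measurable A -> measurable B -> {ae mu, forall w, A w <-> B w} -> mu A = mu B.
Proof.
move=> mA mB AB; rewrite -(setIT A) -(setIT B) -!integral_indic//.
apply: ae_eq_integral => //; try exact/measurable_EFinP/measurable_indic.
apply: filterS AB => w AB _; rewrite !indicE; congr (_%:R%:E).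
by congr nat_of_bool; apply/idP/idP; rewrite !inE => /AB.
Qed.

(** The target [X], path space for instance, carries no sigma-algebra of its own. Measurability of
    both preimages is therefore part of the property shown to define a Dynkin system. *)
Lemma pi_lambda_pushforward d1 d2 (T1 : measurableType d1) (T2 : measurableType d2)
    (X : Type) (mu1 : {measure set T1 -> \bar R}) (mu2 : {measure set T2 -> \bar R})
    (f1 : T1 -> X) (f2 : T2 -> X) (G : set (set X)) :
  setI_closed G -> G setT -> (mu1 setT < +oo)%E ->
  (forall A, G A -> [/\ measurable (f1 @^-1` A), measurable (f2 @^-1` A)
    & mu1 (f1 @^-1` A) = mu2 (f2 @^-1` A)]) ->
  forall A, <<s G >> A -> [/\ measurable (f1 @^-1` A), measurable (f2 @^-1` A)
    & mu1 (f1 @^-1` A) = mu2 (f2 @^-1` A)].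
Proof.
move=> GI GT fin1 h.
have eqT : mu1 setT = mu2 setT by have [] := h _ GT; rewrite !preimage_setT.
have fin2 : (mu2 setT < +oo)%E by rewrite -eqT.
apply: (@lambda_system_subset _ G GI setT) => //; apply/dynkin_lambda_system.
split=> [|A [m1 m2 e]|F tF hF].
- exact: h.
- rewrite -!preimage_setC -(setTD (f1 @^-1` A)) -(setTD (f2 @^-1` A)); split; [exact: measurableD|exact: measurableD|].
  by rewrite !measureD// !setTI; congr (_ - _)%E; [exact: eqT|exact: e].
- rewrite !preimage_bigcup; split; try (apply: bigcup_measurable => k _; by have [] := hF k).
  have tr Y (f : Y -> X) : trivIset setT (fun k => f @^-1` F k).
    apply/trivIsetP => i j _ _ ij; rewrite -preimage_setI.
    by move/trivIsetP : tF => /(_ i j Logic.I Logic.I ij) ->; rewrite preimage_set0.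
  rewrite !measure_bigcup//.
  + by apply: eq_eseriesr => k _; have [] := hF k.
  + by move=> k _; have [] := hF k.
  + by move=> k _; have [] := hF k.
Qed.

Lemma sub_g_sigma_algebra (X : Type) (G H : set (set X)) :
  G `<=` H -> <<s G >> `<=` <<s H >>.
Proof. by move=> GH; exact: sub_smallest2r. Qed.

Section cylinders.
Context {d1 d2 : measure_display} {T1 : measurableType d1} {T2 : measurableType d2}.
Variables (mu1 : {measure set T1 -> \bar R}) (mu2 : {measure set T2 -> \bar R}).
Hypothesis fin1 : (mu1 setT < +oo)%E.

Lemma rectangle_pushforward (I : finType) (X1 : I -> T1 -> R) (X2 : I -> T2 -> R) :
  (forall p, measurable_fun setT (X1 p)) -> (forall p, measurable_fun setT (X2 p)) ->
  (forall C : I -> set R, (forall p, measurable (C p)) ->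
     mu1 (\bigcap_(p in [set: I]) X1 p @^-1` C p) = mu2 (\bigcap_(p in [set: I]) X2 p @^-1` C p)) ->
  forall E : set (I -> R),
    <<s [set E | exists p (B : set R), measurable B /\ E = (fun y => y p) @^-1` B] >> E ->
  [/\ measurable ((fun w p => X1 p w) @^-1` E), measurable ((fun w p => X2 p w) @^-1` E)
    & mu1 ((fun w p => X1 p w) @^-1` E) = mu2 ((fun w p => X2 p w) @^-1` E)].
Proof.
move=> mX1 mX2 h E sE.
pose G : set (set (I -> R)) := [set E | exists2 C : I -> set R,
  (forall p, measurable (C p)) & E = \bigcap_(p in [set: I]) (fun y => y p) @^-1` C p].
apply: (@pi_lambda_pushforward _ _ _ _ _ mu1 mu2 _ _ G) => //.
- move=> _ _ [C mC ->] [C' mC' ->]; exists (fun p => C p `&` C' p).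
    by move=> p; exact: measurableI.
  by rewrite -bigcapI; apply: eq_bigcapr => p _; rewrite preimage_setI.
- by exists (fun=> setT) => //; apply/seteqP; split.
- move=> _ [C mC ->]; rewrite !preimage_bigcap; split; last exact: h.
  + by apply: fin_bigcap_measurable => // p _; rewrite -[X in measurable X]setTI; exact: mX1.
  + by apply: fin_bigcap_measurable => // p _; rewrite -[X in measurable X]setTI; exact: mX2.
- apply: sub_g_sigma_algebra sE => _ [p [B [mB ->]]].
  exists (fun q => if q == p then B else setT); first by move=> q; case: ifP.
  apply/seteqP; split=> [y /= By q _|y /(_ p Logic.I)]; last by rewrite eqxx.
  by case: eqP => [->|_].
Qed.

End cylinders.

(** The planar sets are generalized from rectangles to measurable sets one index at a time: with the
    other coordinates fixed, both sides are finite measures in the set at index [q] and agree on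
    rectangles. *)
Lemma pair_rectangle d (T : measurableType d) (P : probability T R) (I : finType)
    (nu : I -> probability (measurableTypeR R) R) (U V : I -> T -> R) :
  (forall p, measurable_fun setT (U p)) -> (forall p, measurable_fun setT (V p)) ->
  (forall A B : I -> set R, (forall p, measurable (A p)) -> (forall p, measurable (B p)) ->
     P (\bigcap_(p in [set: I]) (U p @^-1` A p `&` V p @^-1` B p)) =
     (\prod_(p : I) (nu p (A p) * nu p (B p)))%E) ->
  forall D : I -> set (measurableTypeR R * measurableTypeR R), (forall p, measurable (D p)) ->
  P (\bigcap_(p in [set: I]) (fun w => (U p w, V p w)) @^-1` D p) =
  (\prod_(p : I) (nu p \x nu p) (D p))%E.
Proof.
move=> mU mV h.
set GR := measurableTypeR R.
have mUV p : measurable_fun setT (fun w => (U p w, V p w) : GR * GR).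
  by apply: measurable_fun_pair; [exact: mU|exact: mV].
pose rect : set (set (GR * GR)) := [set A `*` B | A in measurable & B in measurable].
(* [L] lists the indices at which the set may be arbitrary; elsewhere it is a rectangle. *)
suff claim : forall L : seq I, forall D : I -> set (GR * GR), (forall p, measurable (D p)) ->
    (forall p, p \notin L -> rect (D p)) ->
    P (\bigcap_(p in [set: I]) (fun w => (U p w, V p w)) @^-1` D p) =
    (\prod_(p : I) (nu p \x nu p) (D p))%E.
  by move=> D mD; apply: (claim (enum I)) => // p; rewrite mem_enum.
elim=> [|q L IH] D mD rD.
  have /choice[A /choice[B AB]] : forall p, exists A B, [/\ measurable (A : set GR),
      measurable (B : set GR) & D p = A `*` B].
    by move=> p; have [A mA [B mB e]] := rD p isT; exists A, B.
  have -> : \bigcap_(p in [set: I]) (fun w => (U p w, V p w)) @^-1` D p =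
      \bigcap_(p in [set: I]) (U p @^-1` A p `&` V p @^-1` B p).
    by apply: eq_bigcapr => p _; have [_ _ ->] := AB p.
  rewrite h; last 2 first.
  - by move=> p; have [] := AB p.
  - by move=> p; have [] := AB p.
  apply: eq_bigr => p _; have [mA mB ->] := AB p.
  by rewrite product_measure1E.
pose D' E p := if p == q then E else D p.
have D'D : D' (D q) = D by apply/funext => p; rewrite /D'; case: eqP => // ->.
pose F := \bigcap_(p in [set~ q]) (fun w => (U p w, V p w)) @^-1` D p.
have mF : measurable F.
  apply: fin_bigcap_measurable => // p _.
  by rewrite -[X in measurable X]setTI; exact: mUV.
have capE E : \bigcap_(p in [set: I]) (fun w => (U p w, V p w)) @^-1` D' E p =
    (fun w => (U q w, V q w)) @^-1` E `&` F.
  apply/seteqP; split=> [w hw|w [hE hF] p _].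
    split; first by have := hw q Logic.I; rewrite /D' eqxx.
    by move=> p /= /eqP pq; have := hw p Logic.I; rewrite /D' (negbTE pq).
  by rewrite /D'; case: eqP => [->//|pq]; apply: hF.
pose c := (\prod_(p : I | p != q) (nu p \x nu p) (D p))%E.
have c0 : (0 <= c)%E by apply: prode_ge0 => p _.
have cfin : c \is a fin_num.
  rewrite /c; elim/big_ind: _ => // [x y hx hy|p _]; first by rewrite fin_numM.
  rewrite ge0_fin_numE//; apply: (@le_lt_trans _ _ ((nu p \x nu p) setT)%E).
    by apply: le_measure; rewrite ?inE.
  have pT : nu p setT = 1%E by exact: probability_setT.
  apply: (@le_lt_trans _ _ (nu p setT * nu p setT)%E).
    by rewrite -product_measure1E// setXTT.
  by rewrite pT mule1 ltry.
have prodE E : (\prod_(p : I) (nu p \x nu p) (D' E p) = (nu q \x nu q) E * c)%E.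
  rewrite (bigD1 q)//= /D' eqxx; congr (_ * _)%E.
  by apply: eq_bigr => p /negbTE ->.
have key : forall E, <<s rect >> E ->
    [/\ measurable ((fun w => (U q w, V q w) : GR * GR) @^-1` E), measurable (id @^-1` E) &
    mrestr P mF ((fun w => (U q w, V q w)) @^-1` E) =
    mscale (NngNum (fine_ge0 c0)) (nu q \x nu q)%E (id @^-1` E)].
  apply: pi_lambda_pushforward => //.
  - move=> _ _ [A mA [B mB <-]] [A' mA' [B' mB' <-]]; exists (A `&` A'); first exact: measurableI.
    by exists (B `&` B'); [exact: measurableI|rewrite setXI].
  - by exists setT => //; exists setT => //; rewrite setXTT.
  - apply: (@le_lt_trans _ _ (P (setT `&` F))) => //.
    by rewrite setTI (le_lt_trans (probability_le1 _ _))// ltry.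
  - move=> E rE.
    have mE : measurable E by case: rE => A mA [B mB <-]; exact: measurableX.
    split=> //; first by rewrite -[X in measurable X]setTI; exact: mUV.
    transitivity (P ((fun w => (U q w, V q w)) @^-1` E `&` F)) => //.
    transitivity ((fine c)%:E * (nu q \x nu q) E)%E => //; rewrite fineK//.
    rewrite -capE muleC -prodE; apply: IH => p.
      by rewrite /D'; case: ifP.
    rewrite /D'; case: eqP => // pq pL; apply: rD; rewrite inE negb_or pL andbT.
    exact/eqP.
have sDq : <<s rect >> (D q) by have := mD q; rewrite measurable_prod_measurableType.
have [_ _ e] := key (D q) sDq.
rewrite -{1}D'D capE; apply: (etrans e).
transitivity ((fine c)%:E * (nu q \x nu q) (D q))%E => //; rewrite fineK//.
by rewrite muleC -prodE D'D.
Qed.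

End pi_lambda.

(** * The law of a process from the law of its increments *)

Section process_law.
Context {R : realType} {d : nat}.

Lemma chain_le (tau : nat -> R) n : (forall k, (k < n)%N -> tau k < tau k.+1) ->
  forall j k, (j <= k)%N -> (k <= n)%N -> tau j <= tau k.
Proof.
move=> h j k jk; elim: k jk => [|k IH]; first by rewrite leqn0 => /eqP ->.
rewrite leq_eqVlt => /predU1P[->//|jk] kn.
by apply: (le_trans (IH jk (ltnW kn))); rewrite ltW// h.
Qed.

Definition increments {U : Type} (X : process R d U) (tau : nat -> R) n
  (p : 'I_n * 'I_d) (w : U) : R := X (tau p.1.+1) p.2 w - X (tau p.1) p.2 w.

Definition evaluation : process R d (R -> 'I_d -> R) := fun s i x => x s i.

(** The times of a cylinder are completed by 0 and [s] and sorted, so that every value of a process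
    started at 0 is a sum of increments along one chain. *)
Lemma chain_of_times (L : seq R) (s : R) : 0 <= s -> (forall r, r \in L -> 0 <= r <= s) ->
  exists n (tau : nat -> R) (idx : R -> nat), [/\ tau 0%N = 0, tau n = s,
    forall k, (k < n)%N -> tau k < tau k.+1 &
    forall r, r \in L -> (idx r <= n)%N /\ tau (idx r) = r].
Proof.
move=> s0 hL; pose S := sort <=%R (undup (0 :: s :: L)).
have Slt : sorted <%R S by rewrite sort_lt_sorted undup_uniq.
have memS r : (r \in S) = (r \in 0 :: s :: L) by rewrite mem_sort mem_undup.
have Srange r : r \in S -> 0 <= r <= s.
  by rewrite memS !inE => /or3P[/eqP->|/eqP->|/hL//]; rewrite ?lexx ?s0.
have n0 : 0 \in S by rewrite memS inE eqxx.
have S0 : (0 < size S)%N by rewrite lt0n size_eq0; apply: contraTneq n0 => ->.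
have idxlt r : r \in S -> (index r S < size S)%N by rewrite index_mem.
have mono : {in [pred n | (n < size S)%N] &, {mono nth 0 S : i j / (i < j)%N >-> i < j}}.
  exact: lt_sorted_ltn_nth.
have ns : s \in S by rewrite memS !inE eqxx orbT.
have pS : ((size S).-1 < size S)%N by rewrite prednK.
exists (size S).-1, (nth 0 S), (index ^~ S); split.
- apply/eqP; rewrite eq_le; apply/andP; split; last by case/andP: (Srange _ (mem_nth 0 S0)).
  have [//|] := leP (nth 0 S 0) 0.
  by rewrite -{1}(nth_index 0 n0) mono ?inE ?index_mem.
- apply/eqP; rewrite eq_le; apply/andP; split; first by case/andP: (Srange _ (mem_nth 0 pS)).
  have [//|] := leP s (nth 0 S (size S).-1).
  by rewrite -{1}(nth_index 0 ns) mono ?inE ?index_mem// ltnNge -ltnS prednK// idxlt.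
- move=> k kn; have kS : (k.+1 < size S)%N by rewrite -ltn_predRL.
  by rewrite mono ?inE ?ltnSn// ltnW.
- move=> r rL; have rS : r \in S by rewrite memS !inE rL !orbT.
  by rewrite nth_index//; split=> //; rewrite -ltnS prednK// idxlt.
Qed.

Lemma increments_telescope {U : Type} (X : process R d U) tau n (m : nat) i w : (m <= n)%N ->
  \sum_(l : 'I_n | (l < m)%N) increments X tau (l, i) w = X (tau m) i w - X (tau 0%N) i w.
Proof.
move=> mn; rewrite -(telescope_sumr (fun k => X (tau k) i w) (leq0n m)).
rewrite big_mkord [RHS](big_ord_widen n (fun k => X (tau k.+1) i w - X (tau k) i w))//.
Qed.

(** Cylinders, coded by a list of evaluation points and a family of Borel sets, form a pi-system. As
    both processes start at 0 almost surely, a cylinder differs by a null set from an event in the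
    increments along a chain through its times. *)
Lemma process_pushforward d1 d2 (T1 : measurableType d1) (T2 : measurableType d2)
    (mu1 : {measure set T1 -> \bar R}) (mu2 : {measure set T2 -> \bar R})
    (X1 : process R d T1) (X2 : process R d T2) (s : R) :
  0 <= s -> (mu1 setT < +oo)%E ->
  (forall r i, 0 <= r <= s -> measurable_fun setT (X1 r i)) ->
  (forall r i, 0 <= r <= s -> measurable_fun setT (X2 r i)) ->
  (forall i, {ae mu1, forall w, X1 0 i w = 0}) ->
  (forall i, {ae mu2, forall w, X2 0 i w = 0}) ->
  (forall n (tau : nat -> R), tau 0%N = 0 -> tau n = s ->
     (forall k, (k < n)%N -> tau k < tau k.+1) ->
     forall C : 'I_n * 'I_d -> set R, (forall p, measurable (C p)) ->
       mu1 (\bigcap_(p in [set: 'I_n * 'I_d]) increments X1 tau p @^-1` C p) =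
       mu2 (\bigcap_(p in [set: 'I_n * 'I_d]) increments X2 tau p @^-1` C p)) ->
  forall E, generated_sigma s evaluation E ->
  [/\ measurable (path_of X1 @^-1` E), measurable (path_of X2 @^-1` E)
    & mu1 (path_of X1 @^-1` E) = mu2 (path_of X2 @^-1` E)].
Proof.
move=> s0 fin1 mX1 mX2 X10 X20 h.
pose rect (q : seq (R * 'I_d) * (R * 'I_d -> set R)) : set (R -> 'I_d -> R) :=
  [set x | forall r, r \in q.1 -> q.2 r (x r.1 r.2)].
pose G : set (set (R -> 'I_d -> R)) := [set E | exists2 q, E = rect q &
  (forall r, r \in q.1 -> 0 <= r.1 <= s) /\ (forall r, measurable (q.2 r))].
have mrect d' (T' : measurableType d') (X : process R d T') q :
    (forall r i, 0 <= r <= s -> measurable_fun setT (X r i)) ->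
    (forall r, r \in q.1 -> 0 <= r.1 <= s) -> (forall r, measurable (q.2 r)) ->
    measurable (path_of X @^-1` rect q).
  move=> mX; case: q => L C /=; elim: L => [|r L IH] hL mC.
    by rewrite (_ : _ @^-1` _ = setT)//; apply/seteqP; split.
  rewrite (_ : _ @^-1` _ = (X r.1 r.2 @^-1` C r) `&` (path_of X @^-1` rect (L, C))).
    apply: measurableI; last by apply: IH => // q qL; apply: hL; rewrite inE qL orbT.
    rewrite -[X in measurable X]setTI; apply: mX => //.
    by apply: hL; rewrite inE eqxx.
  apply/seteqP; split=> [w hw|w [h1 h2] q /=].
    split; first by have := hw r; rewrite /= inE eqxx; apply.
    by move=> q qL; have := hw q; rewrite /= inE qL orbT; apply.
  by rewrite inE => /predU1P[->//|]; exact: h2.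
have ae0 d' (T' : measurableType d') (mu : {measure set T' -> \bar R}) (X : process R d T') :
    (forall i, {ae mu, forall w, X 0 i w = 0}) -> {ae mu, forall w, forall i, X 0 i w = 0}.
  by move=> X0; apply: filter_forall.
have eqrect d' (T' : measurableType d') (mu : {measure set T' -> \bar R}) (X : process R d T')
    n tau (idx : R -> nat) q :
    (forall r i, 0 <= r <= s -> measurable_fun setT (X r i)) ->
    (forall i, {ae mu, forall w, X 0 i w = 0}) -> tau 0%N = 0 ->
    (forall r, r \in q.1 -> 0 <= r.1 <= s) -> (forall r, measurable (q.2 r)) ->
    (forall r, r \in q.1 -> (idx r.1 <= n)%N /\ tau (idx r.1) = r.1) ->
    let E := [set y : 'I_n * 'I_d -> R | forall r, r \in q.1 ->
               q.2 r (\sum_(l : 'I_n | (l < idx r.1)%N) y (l, r.2))] in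
    measurable ((fun w p => increments X tau p w) @^-1` E) ->
    mu (path_of X @^-1` rect q) = mu ((fun w p => increments X tau p w) @^-1` E).
  move=> mX X0 tau0 hq mq hidx E mE; apply: measure_ae_eq => //; first exact: mrect.
  apply: filterS (ae0 _ _ _ _ X0) => w w0.
  have e r : r \in q.1 -> \sum_(l : 'I_n | (l < idx r.1)%N) increments X tau (l, r.2) w =
      path_of X w r.1 r.2.
    by move=> rq; have [h1 h2] := hidx r rq; rewrite increments_telescope// tau0 h2 w0 subr0.
  by split=> hw r rq; have := hw r rq; rewrite e.
move=> E0 sE0; apply: (@pi_lambda_pushforward _ _ _ _ _ _ mu1 mu2 (path_of X1) (path_of X2) G) => //.
- move=> _ _ [[L1 C1] -> [h1 m1]] [[L2 C2] -> [h2 m2]].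
  exists (L1 ++ L2, fun r => (if r \in L1 then C1 r else setT) `&` (if r \in L2 then C2 r else setT)).
    apply/seteqP; split=> [x [x1 x2] r /= _|x hx].
      by split; case: ifPn => // rL; [exact: x1|exact: x2].
    by split=> r /= rL; have := hx r; rewrite /= mem_cat rL ?orbT => /(_ isT)[].
  split=> [r|r] /=; first by rewrite mem_cat => /orP[]; [exact: h1|exact: h2].
  by apply: measurableI; case: ifP.
- exists ([::], fun=> setT); last by split=> [r|r] //=; rewrite in_nil.
  by apply/seteqP; split=> // x _ r; rewrite in_nil.
- move=> _ [q -> [hq mq]].
  split; [exact: mrect|exact: mrect|].
  have [|n [tau [idx [tau0 taus tau_lt hidx]]]] := @chain_of_times [seq r.1 | r <- q.1] s s0.
    by move=> r /mapP[r' r'q ->]; exact: hq.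
  have hidx' r : r \in q.1 -> (idx r.1 <= n)%N /\ tau (idx r.1) = r.1.
    by move=> rq; apply: hidx; exact: map_f.
  have tau_in k : (k <= n)%N -> 0 <= tau k <= s.
    by move=> kn; rewrite -{1}tau0 -taus !(chain_le tau_lt).
  pose gens := [set E : set ('I_n * 'I_d -> R) |
    exists p (B : set R), measurable B /\ E = (fun y => y p) @^-1` B].
  pose E := [set y : 'I_n * 'I_d -> R | forall r, r \in q.1 ->
               q.2 r (\sum_(l : 'I_n | (l < idx r.1)%N) y (l, r.2))].
  have sE : <<s gens >> E.
    rewrite /E; elim: (q.1) => [|r L IH].
      rewrite (_ : mkset _ = setT); last by apply/seteqP; split.
      exact: (@measurableT _ (g_sigma_algebraType gens)).
    rewrite (_ : mkset _ = (fun y : 'I_n * 'I_d -> R =>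
      \sum_(l : 'I_n | (l < idx r.1)%N) y (l, r.2)) @^-1` q.2 r `&` [set y : 'I_n * 'I_d -> R | forall r, r \in L ->
               q.2 r (\sum_(l : 'I_n | (l < idx r.1)%N) y (l, r.2))]); last first.
      apply/seteqP; split=> [w hw|w [h1 h2] r'].
        split; first by apply: hw; rewrite inE eqxx.
        by move=> r' r'L; apply: hw; rewrite inE r'L orbT.
      by rewrite inE => /predU1P[->//|]; exact: h2.
    apply: (@measurableI _ (g_sigma_algebraType gens)) => //.
    have : measurable_fun setT (fun y : g_sigma_algebraType gens =>
        \sum_(l : 'I_n | (l < idx r.1)%N) y (l, r.2) : R).
      rewrite (_ : (fun y => _) = (fun y : g_sigma_algebraType gens =>
        \sum_(l < n) (if (l < idx r.1)%N then y (l, r.2) else 0 : R))); last first.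
        by apply/funext => y; rewrite big_mkcond.
      apply: measurable_sum => l; case: (l < idx r.1)%N => //.
      move=> _ B mB; rewrite setTI; apply: sub_sigma_algebra.
      by exists (l, r.2), B.
    by move=> /(_ measurableT _ (mq r)); rewrite setTI.
  have minc d' (T' : measurableType d') (X : process R d T') (p : 'I_n * 'I_d) :
      (forall r i, 0 <= r <= s -> measurable_fun setT (X r i)) ->
      measurable_fun setT (increments X tau p : T' -> R).
    by move=> mX; apply: measurable_funB; apply: mX; apply: tau_in => //; exact: ltnW.
  have [m1 m2 e] := @rectangle_pushforward R _ _ T1 T2 mu1 mu2 fin1 _
    (fun p => increments X1 tau p) (fun p => increments X2 tau p)
    (fun p => minc _ _ _ p mX1) (fun p => minc _ _ _ p mX2) (h n tau tau0 taus tau_lt) E sE.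
  by rewrite (eqrect _ _ _ _ n tau idx)// (eqrect _ _ _ _ n tau idx).
- apply: sub_g_sigma_algebra sE0 => _ [r [i [B [rs mB ->]]]].
  exists ([:: (r, i)], fun=> B).
    apply/seteqP; split=> [x xB r' /=|x /(_ (r, i))]; first by rewrite inE => /eqP ->.
    by rewrite /= inE eqxx; apply.
  by split=> // r' /=; rewrite inE => /eqP ->.
Qed.

End process_law.

(** * Independence of a future increment from the past and from extra information *)

Section independence.
Context {R : realType} {d : nat} {disp : measure_display} {Omega : measurableType disp}.
Variables (P : probability Omega R) (T : R).
Implicit Types (X : process R d Omega).

Lemma generated_sigma_measurable s X : (forall r i, 0 <= r <= s -> measurable_fun setT (X r i)) ->
  generated_sigma s X `<=` measurable.
Proof.
move=> mX; apply: smallest_sub; first exact: sigma_algebra_measurable.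
move=> _ [r [i [B [rs mB ->]]]].
by rewrite -[X in measurable X]setTI; exact: mX.
Qed.

Lemma sigma_algebra_generated {U : Type} s (X : process R d U) :
  sigma_algebra setT (generated_sigma s X).
Proof. exact: smallest_sigma_algebra. Qed.

Lemma generated_sigma_mono {U : Type} s t (X : process R d U) : s <= t ->
  generated_sigma s X `<=` generated_sigma t X.
Proof.
move=> st; apply: sub_g_sigma_algebra => _ [r [i [B [/andP[r0 rs] mB ->]]]].
by exists r, i, B; split => //; rewrite r0 (le_trans rs).
Qed.

Lemma generated_sigma_preimage s X :
  generated_sigma s X = [set path_of X @^-1` E | E in generated_sigma s evaluation].
Proof.
pose gens := [set E : set (R -> 'I_d -> R) | exists r i (B : set R),
         [/\ 0 <= r <= s, measurable B & E = evaluation r i @^-1` B]].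
have := g_sigma_preimageE setT (path_of X) gens.
rewrite (_ : preimage_set_system _ _ _ = [set E | exists r i (B : set R),
         [/\ 0 <= r <= s, measurable B & E = X r i @^-1` B]]); last first.
  apply/seteqP; split=> [_ [_ [r [i [B [rs mB ->]]]] <-]|_ [r [i [B [rs mB ->]]]]].
    by exists r, i, B; split; rewrite ?setTI.
  exists (evaluation r i @^-1` B); last by rewrite setTI.
  by exists r, i, B.
rewrite /generated_sigma => ->.
apply/seteqP; split=> [_ [E sE <-]|_ [E sE <-]]; first by exists E => //; rewrite setTI.
by exists E => //; rewrite setTI.
Qed.

Lemma increments_rectangle X (s : nat -> R) n (C : 'I_n * 'I_d -> set R) :
  brownian_motion P T X -> 0 <= s 0%N -> s n <= T ->
  (forall k, (k < n)%N -> s k < s k.+1) -> (forall p, measurable (C p)) ->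
  P (\bigcap_(p in [set: 'I_n * 'I_d]) increments X s p @^-1` C p) =
  (\prod_(p : 'I_n * 'I_d) normal_prob 0 (Num.sqrt (s p.1.+1 - s p.1)) (C p))%E.
Proof.
move=> [_ _ _ indep gauss] s0 sn slt mC.
have le_s := chain_le slt.
rewrite (indep n s)//; apply: eq_bigr => p _; apply: gauss => //.
- by apply: (le_trans s0); apply: le_s => //; exact: ltnW.
- exact: slt.
- by apply: le_trans sn; apply: le_s.
Qed.

Lemma increment_rectangle X s u (C : 'I_d -> set R) : brownian_motion P T X ->
  0 <= s -> s < u -> u <= T -> (forall i, measurable (C i)) ->
  P (\bigcap_(i in [set: 'I_d]) (fun w => X u i w - X s i w) @^-1` C i) =
  (\prod_(i < d) normal_prob 0 (Num.sqrt (u - s)) (C i))%E.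
Proof.
move=> bm s0 su uT mC.
pose sig (k : nat) := if k is 0%N then s else u.
have := @increments_rectangle X sig 1 (fun p => C p.2) bm s0 uT _ (fun p => mC p.2).
rewrite -(pair_bigA _ (fun (k : 'I_1) (i : 'I_d) => normal_prob 0 (Num.sqrt (sig k.+1 - sig k)) (C i))) /= big_ord1 => <-; last by case.
congr (P _); apply/seteqP; split=> [w h p _|w h i _].
  by case: p => -[[|//] ?] i; exact: (h i).
by have := h (ord0, i) Logic.I.
Qed.

Definition sigma_join (G H : set (set Omega)) := <<s [set A `&` B | A in G & B in H] >>.

Lemma sigma_joinl (G H : set (set Omega)) : H setT -> G `<=` sigma_join G H.
Proof.
by move=> HT A GA; apply: sub_sigma_algebra; exists A => //; exists setT => //; rewrite setIT.
Qed.

Lemma sigma_joinr (G H : set (set Omega)) : G setT -> H `<=` sigma_join G H.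
Proof.
by move=> GT A GA; apply: sub_sigma_algebra; exists setT => //; exists A => //; rewrite setTI.
Qed.

(** Both sides are finite measures in [E], and the intersections of an event of [G] with one of [H]
    form a generating pi-system. *)
Lemma independent_join (G H : set (set Omega)) (D : set Omega) :
  setI_closed G -> setI_closed H -> G setT -> H setT ->
  G `<=` measurable -> H `<=` measurable -> measurable D ->
  (forall A B, G A -> H B -> P (A `&` B `&` D) = P (A `&` B) * P D)%E ->
  forall E, sigma_join G H E -> measurable E /\ P (E `&` D) = (P E * P D)%E.
Proof.
move=> GI HI GT HT mG mH mD h E sE.
have finD : P D \is a fin_num by exact: fin_num_measure.
have := @pi_lambda_pushforward R _ _ Omega Omega Omega (mrestr P mD)
   (mscale (NngNum (fine_ge0 (measure_ge0 P D))) P) id id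
   [set A `&` B | A in G & B in H] _ _ _ _ E sE.
case.
- move=> _ _ [A GA [B HB <-]] [A' GA' [B' HB' <-]].
  exists (A `&` A'); first exact: GI.
  by exists (B `&` B'); [exact: HI|rewrite setIACA].
- by exists setT => //; exists setT => //; rewrite setIT.
- apply: (@le_lt_trans _ _ (P (setT `&` D))) => //.
  by rewrite setTI (le_lt_trans (probability_le1 _ _))// ltry.
- move=> _ [A GA [B HB <-]]; have mAB : measurable (A `&` B).
    by apply: measurableI; [exact: mG|exact: mH].
  by split => //; apply: (etrans (h _ _ GA HB)); rewrite -{1}(fineK finD) muleC.
- move=> mE _ e; split => //; apply: (etrans e).
  by rewrite -[in RHS](fineK finD) muleC.
Qed.

(** [G] is extra information independent of the whole of [X]: trivial for a motion in its own
    filtration, the full path of the other motion in the enlarged one. With [A] and [D] fixed, both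
    sides are finite measures in [B], hence determined by the increments up to [s]. *)
Lemma future_increments_independent X (G : set (set Omega)) s u (C : 'I_d -> set R) :
  brownian_motion P T X -> G `<=` measurable -> independent_sigma P G (generated_sigma T X) ->
  0 <= s -> s < u -> u <= T -> (forall i, measurable (C i)) ->
  let D := \bigcap_(i in [set: 'I_d]) (fun w => X u i w - X s i w) @^-1` C i in
  forall A B, G A -> generated_sigma s X B -> P (A `&` B `&` D) = (P (A `&` B) * P D)%E.
Proof.
move=> bm mG indep s0 su uT mC D A B GA sB.
have [mX X0 _ _ _] := bm.
have sT : s <= T by exact: le_trans (ltW su) uT.
have mX' r i : 0 <= r <= s -> measurable_fun setT (X r i).
  by case/andP=> r0 rs; apply: mX; rewrite r0 (le_trans rs).
have sX r i B' : 0 <= r <= T -> measurable B' -> generated_sigma T X (X r i @^-1` B').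
  by move=> rT mB; apply: sub_sigma_algebra; exists r, i, B'.
have mXT r i : 0 <= r <= T -> measurable_fun setT (X r i : g_sigma_algebraType (generated_sigma T X) -> R).
  move=> rT _ B' mB'; rewrite setTI; apply: sub_sigma_algebra; exact: sX.
have sid : <<s generated_sigma T X >> = generated_sigma T X.
  exact/sigma_algebra_id/sigma_algebra_generated.
have uT' : 0 <= u <= T by rewrite uT andbT (le_trans s0)// ltW.
have sT' : 0 <= s <= T by rewrite s0.
have sI A1 A2 : generated_sigma T X A1 -> generated_sigma T X A2 -> generated_sigma T X (A1 `&` A2).
  by rewrite -sid; exact: (@measurableI _ (g_sigma_algebraType (generated_sigma T X))).
have sD : generated_sigma T X D.
  rewrite -sid /D.
  apply: (@fin_bigcap_measurable _ (g_sigma_algebraType (generated_sigma T X))) => // i _.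
  rewrite -[X in measurable X]setTI; apply: measurable_funB => //; exact: mXT.
have mgenT : generated_sigma T X `<=` measurable by exact: generated_sigma_measurable.
have mD : measurable D by exact: mgenT.
have mA : measurable A by exact: mG.
have mAD : measurable (A `&` D) by exact: measurableI.
have finD : P D \is a fin_num by exact: fin_num_measure.
pose mu2 := mscale (NngNum (fine_ge0 (measure_ge0 P D))) (mrestr P mA).
have mu2E F : mu2 F = (P (F `&` A) * P D)%E.
  by rewrite -[in RHS](fineK finD) muleC.
have ae_restr (F : set Omega) (mF : measurable F) (Q : Omega -> Prop) :
    {ae P, forall w, Q w} -> {ae mrestr P mF, forall w, Q w}.
  move=> [N [mN PN sub]]; exists N; split => //.
  apply/eqP; rewrite eq_le measure_ge0 andbT -PN /mrestr.
  by apply: le_measure; rewrite ?inE//; exact: measurableI.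
have ae_scale (m : {measure set Omega -> \bar R}) r (Q : Omega -> Prop) :
    {ae m, forall w, Q w} -> {ae mscale r m, forall w, Q w}.
  by move=> [N [mN mN0 sub]]; exists N; split => //; rewrite /mscale mN0 mule0.
move: (sB); rewrite generated_sigma_preimage => -[E sE EB].
have fin : (mrestr P mAD setT < +oo)%E.
  apply: (@le_lt_trans _ _ (P (setT `&` (A `&` D)))) => //.
  by rewrite setTI (le_lt_trans (probability_le1 _ _))// ltry.
have ae1 i : {ae mrestr P mAD, forall w, X 0 i w = 0} by apply: ae_restr.
have ae2 i : {ae mu2, forall w, X 0 i w = 0} by apply: ae_scale; apply: ae_restr.
have PD : P D = (\prod_(i < d) normal_prob 0 (Num.sqrt (u - s)) (C i))%E.
  exact: increment_rectangle.
have hrect n (tau : nat -> R) : tau 0%N = 0 -> tau n = s ->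
     (forall k, (k < n)%N -> tau k < tau k.+1) ->
     forall K : 'I_n * 'I_d -> set R, (forall p, measurable (K p)) ->
       mrestr P mAD (\bigcap_(p in [set: 'I_n * 'I_d]) increments X tau p @^-1` K p) =
       mu2 (\bigcap_(p in [set: 'I_n * 'I_d]) increments X tau p @^-1` K p).
  move=> tau0 taus tault K mK; rewrite mu2E; set rect := \bigcap_(p in _) _.
  have tau_in k : (k <= n)%N -> 0 <= tau k <= T.
    move=> kn; rewrite -{1}tau0 (chain_le tault)//=; apply: le_trans sT.
    by rewrite -taus (chain_le tault).
  have srect : generated_sigma T X rect.
    rewrite -sid /rect.
    apply: (@fin_bigcap_measurable _ (g_sigma_algebraType (generated_sigma T X))) => // p _.
    rewrite -[Y in measurable Y]setTI; apply: measurable_funB => //; apply: mXT; apply: tau_in => //.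
    exact: ltnW.
  have PrectD : P (rect `&` D) = (P rect * P D)%E.
    (* The chain up to [s] is prolonged by [u], with the sets [C] on the extra step; the mutual
       independence of the increments then splits off [P D]. *)
    pose tau' k := if (k <= n)%N then tau k else u.
    pose K' (p : 'I_n.+1 * 'I_d) :=
      if insub (val p.1) is Some k then K (k : 'I_n, p.2) else C p.2.
    have K'w k i : K' (widen_ord (leqnSn n) k, i) = K (k, i).
      by rewrite /K' /= (_ : insub (val k) = Some k)//; exact: valK.
    have K'm i : K' (ord_max, i) = C i.
      by rewrite /K' insubF//= ltnn.
    have tau'n k : (k <= n)%N -> tau' k = tau k by rewrite /tau' => ->.
    have tau'm : tau' n.+1 = u by rewrite /tau' ltnn.
    rewrite (_ : rect `&` D = \bigcap_(p in [set: 'I_n.+1 * 'I_d]) increments X tau' p @^-1` K' p).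
      rewrite (@increments_rectangle X tau') ?tau'm ?tau'n ?tau0//.
      - rewrite -(pair_bigA _ (fun (k : 'I_n.+1) (i : 'I_d) => normal_prob 0 (Num.sqrt (tau' k.+1 - tau' k)) (K' (k, i)))).
        rewrite big_ord_recr /= tau'm tau'n// taus.
        congr (_ * _)%E; last by rewrite PD; apply: eq_bigr => i _; rewrite K'm.
        rewrite /rect (@increments_rectangle X tau) ?tau0 ?taus//.
        rewrite (eq_bigr (fun p : 'I_n * 'I_d => normal_prob 0 (Num.sqrt (tau p.1.+1 - tau p.1)) (K (p.1, p.2)))); last by case.
        rewrite -(pair_bigA _ (fun (k : 'I_n) (i : 'I_d) => normal_prob 0 (Num.sqrt (tau k.+1 - tau k)) (K (k, i)))) /=.
        apply: eq_bigr => k _; apply: eq_bigr => i _; rewrite K'w !tau'n//.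
        exact: ltnW.
      - move=> k; rewrite ltnS leq_eqVlt => /predU1P[->|kn]; first by rewrite tau'm tau'n// taus.
        by rewrite !tau'n// ?tault// ltnW.
      - by move=> p; rewrite /K'; case: insub => [k|].
    apply/seteqP; split=> [w [hr hD] [k i] _|w h].
      case: (unliftP ord_max k) => [j ->|->].
        rewrite (_ : lift ord_max j = widen_ord (leqnSn n) j); last first.
          by apply: val_inj; exact: lift_max.
        have := hr (j, i) Logic.I; rewrite /preimage /= K'w /increments /= !tau'n//.
        exact: ltnW.
      by have := hD i Logic.I; rewrite /preimage /= K'm /increments /= tau'm tau'n// taus.
    split=> [[j i] _|i _].
      have := h (widen_ord (leqnSn n) j, i) Logic.I.
      rewrite /preimage /= K'w /increments /= !tau'n//.
      exact: ltnW.
    by have := h (ord_max, i) Logic.I; rewrite /preimage /= K'm /increments /= tau'm tau'n// taus.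
  transitivity (P (A `&` (rect `&` D))).
    by transitivity (P (rect `&` (A `&` D))) => //; rewrite setICA.
  rewrite indep//; last exact: sI.
  by rewrite PrectD [in RHS]setIC indep// muleA.
have [_ _ e] := @process_pushforward R d _ _ Omega Omega (mrestr P mAD)
  mu2 X X s s0 fin mX' mX' ae1 ae2 hrect E sE.
move: e; rewrite EB => e; transitivity (P (B `&` (A `&` D))); first by rewrite setIA [B `&` A]setIC.
by apply: (etrans e); rewrite [A `&` B]setIC; exact: mu2E.
Qed.

End independence.

Definition mkmfun d1 d2 (T1 : sigmaRingType d1) (T2 : sigmaRingType d2) (f : T1 -> T2)
    (mf : measurable_fun setT f) : {mfun T1 >-> T2} :=
  HB.pack f (isMeasurableFun.Build _ _ _ _ f mf).

(** * Moments of the increments of a Brownian motion in a filtration *)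

Section expectation_product.
Context {R : realType} {disp : measure_display} {Omega : measurableType disp}.
Variable P : probability Omega R.
Implicit Types (X Y Z : Omega -> R) (G H : set (set Omega)).

Lemma mean_pushforward (X Y : Omega -> R) :
  measurable_fun setT X -> measurable_fun setT Y -> L1 P X ->
  (forall B : set R, measurable B -> P (X @^-1` B) = P (Y @^-1` B)) ->
  L1 P Y /\ mean P Y = mean P X.
Proof.
move=> mX mY hX XY.
have e : forall f : R -> \bar R, measurable_fun setT f ->
    (\int[pushm P mX]_x f x = \int[pushm P mY]_x f x)%E.
  by move=> f mf; apply: eq_measure_integral => A mA _; exact: XY.
have absE (Z : Omega -> R) (mZ : measurable_fun setT Z) :
    (\int[P]_w `|(Z w)%:E| = \int[pushm P mZ]_x `|x%:E|)%E.
  rewrite ge0_integral_pushforward//.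
  by apply: measurableT_comp => //; exact/measurable_EFinP.
have hY : L1 P Y.
  apply/integrableP; split; first exact/measurable_EFinP.
  rewrite /= absE -e; first by rewrite -absE; case/integrableP : hX.
  by apply: measurableT_comp => //; exact/measurable_EFinP.
split => //; congr fine.
have pE (Z : Omega -> R) (mZ : measurable_fun setT Z) : L1 P Z ->
    (\int[P]_w (Z w)%:E = \int[pushm P mZ]_x x%:E)%E.
  move=> hZ; rewrite integral_pushforward//; exact/measurable_EFinP.
by rewrite !pE// e//; exact/measurable_EFinP.
Qed.

Definition independent_rv X Y : Prop := forall A B : set R, measurable A -> measurable B ->
  P (X @^-1` A `&` Y @^-1` B) = (P (X @^-1` A) * P (Y @^-1` B))%E.

(** Independence makes the joint law the product of the marginal ones; Tonelli gives integrability
    of the product and Fubini its mean. *)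
Lemma mean_independentM X Y : measurable_fun setT X -> measurable_fun setT Y ->
  independent_rv X Y -> L1 P X -> L1 P Y ->
  L1 P (fun w => X w * Y w) /\ mean P (fun w => X w * Y w) = mean P X * mean P Y.
Proof.
move=> mX mY ind hX hY.
have mXY : measurable_fun setT (fun w => (X w, Y w)) by exact: measurable_fun_pair.
pose m1 : probability R R := distribution P (mkmfun mX).
pose m2 : probability R R := distribution P (mkmfun mY).
have prodE : forall A, measurable A -> (m1 \x m2)%E A = pushm P mXY A.
  apply: product_measure_unique => A B mA mB.
  by rewrite /m1 /m2 -[RHS]ind//; congr (P _); apply/seteqP; split.
have intE (f : R * R -> \bar R) : (\int[m1 \x m2]_z f z = \int[pushm P mXY]_z f z)%E.
  by apply: eq_measure_integral => A mA _; exact: prodE.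
have mmul : measurable_fun setT (fun z : R * R => z.1 * z.2) by exact: measurable_funM.
have hm1 : m1.-integrable setT (fun x => x%:E).
  apply: integrable_pushforward => //; exact/measurable_EFinP.
have hm2 : m2.-integrable setT (fun x => x%:E).
  apply: integrable_pushforward => //; exact/measurable_EFinP.
have e1 : (\int[m1]_x x%:E = (mean P X)%:E)%E.
  rewrite -(L1_integral hX) /m1 integral_pushforward//; exact/measurable_EFinP.
have e2 : (\int[m2]_x x%:E = (mean P Y)%:E)%E.
  rewrite -(L1_integral hY) /m2 integral_pushforward//; exact/measurable_EFinP.
have hprod : (m1 \x m2)%E.-integrable setT (fun z : R * R => (z.1 * z.2)%:E).
  apply/integrable12ltyP; first exact/measurable_EFinP.
  rewrite (eq_integral (fun x : R => (\int[m2]_y `|(y : R)%:E|) * `|x%:E|)%E); last first.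
    move=> x _; rewrite /= muleC -ge0_integralZl//.
      by apply: eq_integral => y _; rewrite normrM EFinM.
    by apply: measurableT_comp => //; exact/measurable_EFinP.
  rewrite ge0_integralZl//; last 2 first.
  - by apply: measurableT_comp => //; exact/measurable_EFinP.
  - exact: integral_ge0.
  have [[_ l1] [_ l2]] := (integrableP _ _ _ hm1, integrableP _ _ _ hm2).
  by rewrite lte_mul_pinfty// ?integral_ge0// ge0_fin_numE// integral_ge0.
have hL1 : L1 P (fun w => X w * Y w).
  apply/integrableP; split; first by apply/measurable_EFinP; exact: measurable_funM.
  have [_] := integrableP _ _ _ hprod; rewrite intE ge0_integral_pushforward//.
  by apply: measurableT_comp => //; exact/measurable_EFinP.
split => //; apply: EFin_inj; rewrite -(L1_integral hL1).
transitivity (\int[m1 \x m2]_z (z.1 * z.2)%:E)%E.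
  rewrite intE integral_pushforward//; exact/measurable_EFinP.
rewrite -integral12_prod_meas1//.
rewrite (eq_integral (fun x : R => (mean P Y)%:E * x%:E)%E); last first.
  move=> x _; rewrite /fubini_F/=.
  under eq_integral do rewrite EFinM.
  by rewrite integralZl// e2 muleC.
by rewrite integralZl// e1 EFinM muleC.
Qed.

End expectation_product.

(** * Measurability up to null sets *)

Section sub_sigma_algebra.
Context {R : realType} {disp : measure_display} {Omega : measurableType disp}.
Variable P : probability Omega R.
Implicit Types (X Y Z : Omega -> R) (G H : set (set Omega)).

Definition sub_sigma G : Prop := sigma_algebra setT G /\ G `<=` measurable.

Lemma measurable_wrtP (U : pointedType) (G : set (set U)) (X : U -> R) : sigma_algebra setT G ->
  measurable_wrt G X <-> measurable_fun setT (X : g_sigma_algebraType G -> R).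
Proof.
move=> sG; have GE : <<s G >> = G by exact: sigma_algebra_id.
split=> [h _ B mB|h B mB]; first by rewrite setTI /measurable/= GE; exact: h.
by have := h measurableT B mB; rewrite setTI /measurable/= GE.
Qed.

Lemma measurable_wrt_measurable G X : sub_sigma G -> measurable_wrt G X -> measurable_fun setT X.
Proof. by move=> [_ mG] h _ B mB; rewrite setTI; apply: mG; exact: h. Qed.

(* G-measurable up to a null set: the signature is only determined almost surely. *)
Definition aem G X : Prop :=
  measurable_fun setT X /\ exists2 X', measurable_wrt G X' & X = X' %[ae P].

Section closure.
Variables (G : set (set Omega)) (sG : sub_sigma G).

Lemma aem_wrt X : measurable_wrt G X -> aem G X.
Proof.
move=> h; split; first exact: measurable_wrt_measurable h.
by exists X => //; exact: ae_eq_refl.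
Qed.

Lemma aem_comp2 (f : R -> R -> R) X Y : measurable_fun setT (fun z => f z.1 z.2) ->
  aem G X -> aem G Y -> aem G (fun w => f (X w) (Y w)).
Proof.
move=> mf [mX [X' mX' eX]] [mY [Y' mY' eY]]; split.
  exact: (measurableT_comp mf (measurable_fun_pair mX mY)).
exists (fun w => f (X' w) (Y' w)).
  apply/(measurable_wrtP _ sG.1).
  apply: (@measurableT_comp _ _ _ (g_sigma_algebraType G) _ _ (fun z => f z.1 z.2) setT
    (fun w => (X' w, Y' w)) mf).
  by apply: measurable_fun_pair; exact/(measurable_wrtP _ sG.1).
by apply: filterS2 eX eY => w h1 h2 _; rewrite h1// h2.
Qed.

Lemma aem_cst c : aem G (fun=> c).
Proof. by apply: aem_wrt; apply/(measurable_wrtP _ sG.1). Qed.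

Lemma aemD X Y : aem G X -> aem G Y -> aem G (fun w => X w + Y w).
Proof. by apply: (@aem_comp2 (fun x y => x + y)); exact: measurable_funD. Qed.

Lemma aemM X Y : aem G X -> aem G Y -> aem G (fun w => X w * Y w).
Proof. by apply: (@aem_comp2 (fun x y => x * y)); exact: measurable_funM. Qed.

Lemma aemB X Y : aem G X -> aem G Y -> aem G (fun w => X w - Y w).
Proof. by apply: (@aem_comp2 (fun x y => x - y)); exact: measurable_funB. Qed.

Lemma aemZ c X : aem G X -> aem G (fun w => c * X w).
Proof. by move=> h; apply: aemM => //; exact: aem_cst. Qed.

Lemma aem_sum (I : Type) (s : seq I) (F : I -> Omega -> R) : (forall i, aem G (F i)) ->
  aem G (fun w => \sum_(i <- s) F i w).
Proof.
move=> h; elim: s => [|i s IH].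
  by under eq_fun do rewrite big_nil; exact: aem_cst.
by under eq_fun do rewrite big_cons; exact: aemD.
Qed.

Lemma aem_ae X Y : measurable_fun setT Y -> X = Y %[ae P] -> aem G X -> aem G Y.
Proof.
move=> mY XY [mX [X' mX' eX]]; split => //; exists X' => //.
by apply: filterS2 eX XY => w h1 h2 _; rewrite -h2// h1.
Qed.

(* Along a subsequence with summable L1 distances to the limit the convergence is almost sure. *)
Lemma aem_lim (X_ : nat -> Omega -> R) X : (forall n, aem G (X_ n)) -> (forall n, L2 P (X_ n)) ->
  L2 P X -> nrm P (fun w => X_ n w - X w) @[n --> \oo] --> 0 -> aem G X.
Proof.
move=> aX hX_ hX cX; have mX := L2_measurable hX.
have hD n : L2 P (fun w => X_ n w - X w) by exact: L2B.
have /choice[phi hphi] : forall k, exists n,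
    nrm P (fun w => X_ n w - X w) <= 1 / (2 ^ (k + 1))%:R.
  move=> k; move/cvgrPdist_le : cX => /(_ (1 / (2 ^ (k + 1))%:R)) [].
    by rewrite divr_gt0// ltr0n expn_gt0.
  move=> N _ /(_ N (leqnn N)); rewrite sub0r normrN ger0_norm ?nrm_ge0// => hN.
  by exists N.
pose Y k w := `|X_ (phi k) w - X w|.
have mY k : measurable_fun setT (fun w => (Y k w)%:E).
  apply/measurable_EFinP; apply: measurableT_comp => //; exact: L2_measurable.
have intY k : (\int[P]_w (Y k w)%:E <= (1 / (2 ^ (k + 1))%:R)%:E)%E.
  rewrite L1_integral; last by apply: L1_abs; exact: L2_L1.
  by rewrite lee_fin (le_trans _ (hphi k))//; exact: mean_abs_nrm.
have Y0 k w : (0 <= (Y k w)%:E)%E by rewrite lee_fin normr_ge0.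
have fin : (\int[P]_w (\sum_(0 <= k <oo) (Y k w)%:E) < +oo)%E.
  rewrite integral_nneseries//.
  apply: (@le_lt_trans _ _ 1%E); last exact: ltry.
  have := @cvg_geometric_eseries_half R 1 0; rewrite expr0 divr1 => /(cvg_lim (@ereal_hausdorff R)) <-.
  by apply: lee_nneseries => [k _ _|k _]; [apply: integral_ge0|exact: intY].
have ae_fin : {ae P, forall w, (\sum_(0 <= k <oo) (Y k w)%:E < +oo)%E}.
  have : P.-integrable setT (fun w => \sum_(0 <= k <oo) (Y k w)%:E)%E.
    apply/integrableP; split; first exact: ge0_emeasurable_sum.
    by under eq_integral do rewrite gee0_abs ?nneseries_ge0//.
  move/integrable_ae => /(_ measurableT); apply: filterS => w /(_ Logic.I) h.
  by rewrite -ge0_fin_numE// nneseries_ge0.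
have cv : {ae P, forall w, X_ (phi k) w @[k --> \oo] --> X w}.
  apply: filterS ae_fin => w fw.
  suff cs : cvgn (series (fun k => Y k w)).
    have := cvg_series_cvg_0 cs; rewrite /Y => /norm_cvg0P h.
    by apply/subr_cvg0.
  apply: nondecreasing_is_cvgn.
    apply/nondecreasing_seqP => n; rewrite /series/= big_nat_recr//= lerDl.
    exact: normr_ge0.
  exists (fine (\sum_(0 <= k <oo) (Y k w)%:E)) => _ [n _ <-].
  rewrite -lee_fin fineK; last by rewrite ge0_fin_numE// nneseries_ge0.
  rewrite /series /= -sumEFin; exact: nneseries_lim_ge.
have /choice[X' hX'] : forall k, exists X', measurable_wrt G X' /\ X_ (phi k) = X' %[ae P].
  by move=> k; have [_ [X' h1 h2]] := aX (phi k); exists X'.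
(* The limit superior of the [G]-measurable versions is defined everywhere, is [G]-measurable, and
   equals [X] almost everywhere. *)
split => //; exists (fun w => fine (limn_esup (fun k => (X' k w)%:E))).
  apply/(measurable_wrtP _ sG.1); apply: measurableT_comp => //.
  apply: measurable_fun_limn_esup => k; apply/measurable_EFinP.
  by apply/(measurable_wrtP _ sG.1); have [] := hX' k.
have eqX : {ae P, forall w k, X_ (phi k) w = X' k w}.
  by apply: ae_foralln => k; have [_] := hX' k; apply: filterS => w; apply.
apply: filterS2 cv eqX => w cw ew _.
have -> : (fun k => (X' k w)%:E) = (fun k => (X_ (phi k) w)%:E).
  by apply/funext => k; rewrite ew.
have h : (X_ (phi k) w)%:E @[k --> \oo] --> (X w)%:E by apply: cvg_EFin => //; near=> k.
by rewrite (cvg_limn_einf_sup h).2.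
Unshelve. all: end_near. Qed.

End closure.

Lemma aem_sub G H X : G `<=` H -> aem G X -> aem H X.
Proof.
move=> GH [mX [X' mX' e]]; split => //; exists X' => // B mB; apply: GH; exact: mX'.
Qed.

End sub_sigma_algebra.

(** * Brownian motion relative to a filtration *)

Section filtered_brownian_motion.
Context {R : realType} {d : nat} {disp : measure_display} {Omega : measurableType disp}.
Variables (P : probability Omega R) (T : R).
Implicit Types (X : process R d Omega) (H : R -> set (set Omega)) (Z : Omega -> R).

(** [fbm_increments] states at once that the increment is independent of the past and that its
    coordinates are independent Gaussians. The same interface serves [W] in its own filtration and
    [Wperp] in the enlarged one. *)
Record filtered_bm H X : Prop := {
  fbm_sigma : forall s, 0 <= s <= T -> sub_sigma (H s) ;
  fbm_mono : forall s u, 0 <= s -> s <= u -> u <= T -> H s `<=` H u ;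
  fbm_adapted : forall s i, 0 <= s <= T -> measurable_wrt (H s) (X s i) ;
  fbm_increments : forall s u (C : 'I_d -> set R), 0 <= s -> s < u -> u <= T ->
    (forall i, measurable (C i)) -> forall A, H s A ->
    P (A `&` \bigcap_(i in [set: 'I_d]) (fun w => X u i w - X s i w) @^-1` C i) =
    (P A * \prod_(i < d) normal_prob 0 (Num.sqrt (u - s)) (C i))%E }.

Section increment_moments.
Variables (H : R -> set (set Omega)) (X : process R d Omega).
Hypothesis fbm : filtered_bm H X.
Variables (s u : R).
Hypotheses (s0 : 0 <= s) (su : s < u) (uT : u <= T).

Local Notation dX i := (fun w => X u i w - X s i w).

Let s_itv : 0 <= s <= T. Proof. by rewrite s0 (le_trans (ltW su)). Qed.
Let u_itv : 0 <= u <= T. Proof. by rewrite uT (le_trans s0)// ltW. Qed.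

Lemma sub_sigma_setT (G : set (set Omega)) : sub_sigma G -> G setT.
Proof. by move=> [[G0 GC _] _]; rewrite -(setC0) -setTD; exact: GC. Qed.

Lemma measurable_increment i : measurable_fun setT (dX i).
Proof.
apply: measurable_funB; apply: measurable_wrt_measurable (fbm_adapted fbm _ _) => //.
- exact: (fbm_sigma fbm).
- exact: (fbm_sigma fbm).
Qed.

Lemma aem_increment i : aem P (H u) (dX i).
Proof.
apply: aemB; first exact: (fbm_sigma fbm).
  by apply: aem_wrt; [exact: (fbm_sigma fbm)|exact: (fbm_adapted fbm)].
apply: (@aem_sub _ _ _ _ (H s)); first by apply: (fbm_mono fbm) => //; exact: ltW.
by apply: aem_wrt; [exact: (fbm_sigma fbm)|exact: (fbm_adapted fbm)].
Qed.

Lemma prode_if_eq (i : 'I_d) (F : 'I_d -> \bar R) x : (forall j, j != i -> F j = 1%E) -> F i = x ->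
  (\prod_(j < d) F j)%E = x.
Proof. by move=> h <-; rewrite (bigD1 i)//= big1 ?mule1// => j /h. Qed.

Lemma normal_setT (sg : R) : normal_prob 0 sg setT = 1%E.
Proof. exact: (@probability_setT _ _ _ (normal_prob 0 sg)). Qed.

Lemma increment_law i (B : set R) : measurable B ->
  P (dX i @^-1` B) = normal_prob 0 (Num.sqrt (u - s)) B.
Proof.
move=> mB.
have := @fbm_increments _ _ fbm s u (fun j => if j == i then B else setT) s0 su uT _ setT
  (sub_sigma_setT (fbm_sigma fbm s_itv)).
rewrite setTI probability_setT mul1e (@prode_if_eq i _ (normal_prob 0 (Num.sqrt (u - s)) B)).
- move=> <-; last by move=> j; case: ifP.
  congr (P _); apply/seteqP; split=> [w wB j _|w /(_ i Logic.I)]; last by rewrite eqxx.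
  by case: eqP => [->|].
- by move=> j /negbTE ->; exact: normal_setT.
- by rewrite eqxx.
Qed.

Lemma increment_pair_law (i j : 'I_d) (B C : set R) : i != j -> measurable B -> measurable C ->
  P (dX i @^-1` B `&` dX j @^-1` C) = (P (dX i @^-1` B) * P (dX j @^-1` C))%E.
Proof.
move=> ij mB mC; rewrite !increment_law//.
have := @fbm_increments _ _ fbm s u
  (fun k => if k == i then B else if k == j then C else setT) s0 su uT _ setT
  (sub_sigma_setT (fbm_sigma fbm s_itv)).
rewrite setTI probability_setT mul1e (bigD1 i)//= (bigD1 j)/=; last by rewrite eq_sym.
rewrite !eqxx eq_sym (negbTE ij) big1 ?mule1; last first.
  by move=> k /andP[/negbTE -> /negbTE ->]; exact: normal_setT.
move=> <-; last by move=> k; case: ifP => // _; case: ifP.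
congr (P _); apply/seteqP; split=> [w [wB wC] k _|w h].
  by case: eqP => [->//|_]; case: eqP => [->|].
by split; [have := h i Logic.I; rewrite eqxx|have := h j Logic.I; rewrite eqxx eq_sym (negbTE ij)].
Qed.

(** The function [g] covers an increment, a product of two increments, and their squares. [Z] is
    replaced by an [H s]-measurable version, and the pair of increments is treated by a pi-lambda
    argument on rectangles. *)
Lemma aem_independent Z i j (g : R * R -> R) : aem P (H s) Z -> measurable_fun setT g ->
  independent_rv P Z (fun w => g (dX i w, dX j w)).
Proof.
move=> [mZ [Z' mZ' eZ]] mg A B mA mB.
have sH := fbm_sigma fbm s_itv.
have mpair : measurable_fun setT (fun w => (dX i w, dX j w)).
  by apply: measurable_fun_pair; exact: measurable_increment.
have pre (Y : Omega -> R) (C : set R) : measurable_fun setT Y -> measurable C -> measurable (Y @^-1` C).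
  by move=> mY mC; rewrite -[X in measurable X]setTI; exact: mY.
have HA : H s (Z' @^-1` A) by exact: mZ'.
have mZA : measurable (Z' @^-1` A) by apply: sH.2.
have mgY : measurable_fun setT (fun w => g (dX i w, dX j w)) by exact: measurableT_comp.
rewrite (@measure_ae_eq _ _ _ P (Z @^-1` A) (Z' @^-1` A))//; last 2 first.
- exact: pre.
- by apply: filterS eZ => w e; rewrite /preimage/= e.
rewrite (@measure_ae_eq _ _ _ P (Z @^-1` A `&` _) (Z' @^-1` A `&` (fun w => g (dX i w, dX j w)) @^-1` B)); last 3 first.
- by apply: measurableI; exact: pre.
- by apply: measurableI => //; exact: pre.
- by apply: filterS eZ => w e; rewrite /preimage/= e.
have finA : P (Z' @^-1` A) \is a fin_num by exact: fin_num_measure.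
have key : forall E : set (R * R), measurable E ->
    P ((fun w => (dX i w, dX j w)) @^-1` E `&` Z' @^-1` A) =
    (P (Z' @^-1` A) * P ((fun w => (dX i w, dX j w)) @^-1` E))%E.
  move=> E mE.
  have mE' := mE; rewrite measurable_prod_measurableType in mE'.
  have := @pi_lambda_pushforward R _ _ Omega Omega (R * R)%type (mrestr P mZA)
    (mscale (NngNum (fine_ge0 (measure_ge0 P (Z' @^-1` A)))) P)
    (fun w => (dX i w, dX j w)) (fun w => (dX i w, dX j w))
    [set A `*` B | A in measurable & B in measurable] _ _ _ _ E mE'.
  case.
  - move=> _ _ [C mC [D mD <-]] [C' mC' [D' mD' <-]]; exists (C `&` C'); first exact: measurableI.
    by exists (D `&` D'); [exact: measurableI|rewrite setXI].
  - by exists setT => //; exists setT => //; rewrite setXTT.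
  - apply: (@le_lt_trans _ _ (P (setT `&` Z' @^-1` A))) => //.
    by rewrite setTI (le_lt_trans (probability_le1 _ _))// ltry.
  - move=> _ [C mC [D mD <-]].
    have mCD : measurable ((fun w => (dX i w, dX j w)) @^-1` (C `*` D)).
      by rewrite -[X in measurable X]setTI; apply: mpair => //; exact: measurableX.
    split => //.
    (* The intersection imposes both constraints and also covers [i = j]. *)
    pose K k := (if k == i then C else setT) `&` (if k == j then D else setT).
    have mK k : measurable (K k) by apply: measurableI; case: ifP.
    have KE : (fun w => (dX i w, dX j w)) @^-1` (C `*` D) =
        \bigcap_(k in [set: 'I_d]) (fun w => X u k w - X s k w) @^-1` K k.
      apply/seteqP; split=> [w [wC wD] k _|w h].
        by split; case: eqP => // ->.
      split; first by have := h i Logic.I; rewrite /K /= eqxx => -[].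
      by have := h j Logic.I; rewrite /K /= eqxx => -[].
    have h1 := fbm_increments fbm s0 su uT mK HA.
    have h2 := fbm_increments fbm s0 su uT mK (sub_sigma_setT sH).
    move: h2; rewrite setTI probability_setT mul1e => h2.
    transitivity (P (Z' @^-1` A `&` (fun w => (dX i w, dX j w)) @^-1` (C `*` D))).
      by rewrite setIC.
    transitivity ((fine (P (Z' @^-1` A)))%:E * P ((fun w => (dX i w, dX j w)) @^-1` (C `*` D)))%E => //.
    by rewrite fineK// KE h1 h2.
  - move=> _ _ e; apply: (etrans e).
    transitivity ((fine (P (Z' @^-1` A)))%:E * P ((fun w => (dX i w, dX j w)) @^-1` E))%E => //.
    by rewrite fineK.
rewrite setIC; apply: (key (g @^-1` B)).
by rewrite -[X in measurable X]setTI; exact: mg.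
Qed.

Lemma integral_increment i (f : R -> \bar R) : measurable_fun setT f -> (forall x, 0 <= f x)%E ->
  (\int[P]_w f (dX i w) = \int[normal_prob 0 (Num.sqrt (u - s))]_x f x)%E.
Proof.
move=> mf f0.
have mY : measurable_fun setT (dX i : Omega -> measurableTypeR R) by exact: measurable_increment.
transitivity (\int[pushm P mY]_x f x)%E.
  by rewrite ge0_integral_pushforward.
by apply: eq_measure_integral => A mA _; exact: increment_law.
Qed.

Let h0 : 0 < u - s. Proof. by rewrite subr_gt0. Qed.
Let sq0 : 0 < Num.sqrt (u - s). Proof. by rewrite sqrtr_gt0. Qed.

Lemma L2_increment i : L2 P (dX i) /\ mean P (fun w => dX i w ^+ 2) = u - s.
Proof.
have mi := measurable_increment i.
have e : (\int[P]_w (dX i w ^+ 2)%:E = (u - s)%:E)%E.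
  rewrite (@integral_increment i (fun x => (x ^+ 2)%:E)).
  - by rewrite normal_second_moment// sqr_sqrtr// ltW.
  - by apply/measurable_EFinP; exact: exprn_measurable.
  - by move=> x; rewrite lee_fin sqr_ge0.
split; last by rewrite /mean /Rintegral e.
split => //; apply/integrableP; split.
  by apply/measurable_EFinP; exact: measurable_funX.
under eq_integral do rewrite /= ger0_norm ?sqr_ge0//.
by rewrite e ltry.
Qed.

Lemma L2_increment_sqr i : L2 P (fun w => dX i w ^+ 2) /\
  mean P (fun w => (dX i w ^+ 2) ^+ 2) <= 128 * (u - s) ^+ 2.
Proof.
have mi := measurable_increment i.
have e : (\int[P]_w (dX i w ^+ 4)%:E <= (128 * (u - s) ^+ 2)%:E)%E.
  rewrite (@integral_increment i (fun x => (x ^+ 4)%:E)).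
  - apply: (le_trans (normal_fourth_moment sq0)).
    by rewrite (_ : 4 = 2 * 2)%N// exprM sqr_sqrtr// ltW.
  - by apply/measurable_EFinP; exact: exprn_measurable.
  - by move=> x; rewrite lee_fin exprn_even_ge0.
have e4 w : (dX i w ^+ 2) ^+ 2 = dX i w ^+ 4 by rewrite -exprM.
have h : L1 P (fun w => (dX i w ^+ 2) ^+ 2).
  apply/integrableP; split.
    by apply/measurable_EFinP; apply: measurable_funX; exact: measurable_funX.
  under eq_integral do rewrite /= ger0_norm ?sqr_ge0// e4.
  by rewrite (le_lt_trans e)// ltry.
split; first by split => //; exact: measurable_funX.
by rewrite -lee_fin -(L1_integral h); under eq_integral do rewrite e4.
Qed.

(** The law is symmetric, so the mean equals its opposite. *)
Lemma mean_increment i : mean P (dX i) = 0.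
Proof.
have mi := measurable_increment i.
have hi := L2_L1 (L2_increment i).1.
have mN : measurable_fun setT (fun w => - dX i w) by exact: measurable_funN.
have law B : measurable B -> P (dX i @^-1` B) = P ((fun w => - dX i w) @^-1` B).
  move=> mB; rewrite increment_law//.
  transitivity (P (dX i @^-1` (aff 0 (-1) @^-1` B))).
    rewrite increment_law; last exact: measurable_affine_preimage.
    by rewrite normal_symmetric// gt_eqF.
  by congr (P _); apply/seteqP; split=> w; rewrite /preimage /aff /= add0r mulN1r.
have [_ e] := mean_pushforward mi mN hi law.
have := meanZ (-1) hi; under eq_mean do rewrite mulN1r.
by rewrite e mulN1r; lra.
Qed.

Lemma mean_increments i j : mean P (fun w => dX i w * dX j w) = (i == j)%:R * (u - s).
Proof.
have [<-|ij] := eqVneq i j.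
  by rewrite mul1r -(L2_increment i).2; apply: eq_mean => w; rewrite expr2.
have := @mean_independentM _ _ _ P (dX i) (dX j) (measurable_increment i) (measurable_increment j).
case.
- by move=> A B mA mB; exact: increment_pair_law.
- exact: L2_L1 (L2_increment i).1.
- exact: L2_L1 (L2_increment j).1.
- by move=> _ ->; rewrite !mean_increment !mul0r.
Qed.

Lemma aem_mulM Z i j g : aem P (H s) Z -> measurable_fun setT g -> L1 P Z ->
  L1 P (fun w => g (dX i w, dX j w)) ->
  L1 P (fun w => Z w * g (dX i w, dX j w)) /\
  mean P (fun w => Z w * g (dX i w, dX j w)) = mean P Z * mean P (fun w => g (dX i w, dX j w)).
Proof.
move=> aZ mg hZ hg; apply: mean_independentM => //; first exact: aZ.1.
  apply: measurableT_comp => //.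
  by apply: measurable_fun_pair; exact: measurable_increment.
exact: aem_independent.
Qed.

(** The product of two increments minus its mean: one step of the martingale part of the quadratic
    covariation. *)
Definition dqv i j w := dX i w * dX j w - (i == j)%:R * (u - s).

(** [(x y - h) ^+ 2 <= x ^+ 4 + y ^+ 4 + 2 h ^+ 2], and each fourth moment costs 128, so the
    constant is [128 + 128 + 2]. *)
Lemma L2_dqv i j : L2 P (dqv i j) /\ mean P (fun w => dqv i j w ^+ 2) <= 258 * (u - s) ^+ 2.
Proof.
have [hi bi] := L2_increment_sqr i; have [hj bj] := L2_increment_sqr j.
have mi := measurable_increment i; have mj := measurable_increment j.
have hij : L2 P (fun w => dX i w * dX j w).
  split; first exact: measurable_funM.
  apply: (L1_le (Y := fun w => dX i w ^+ 2 * dX j w ^+ 2)); last exact: L2M.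
    by apply: measurable_funX; exact: measurable_funM.
  by move=> w; rewrite exprMn ger0_norm// mulr_ge0// sqr_ge0.
have hq : L2 P (dqv i j) by apply: L2B => //; exact: L2_cst.
split => //; apply: (@le_trans _ _ (mean P (fun w => (dX i w ^+ 2) ^+ 2 + (dX j w ^+ 2) ^+ 2 + 2 * (u - s) ^+ 2))).
  apply: le_mean; first exact: L1_sqr.
    by apply: L1D; [apply: L1D; exact: L1_sqr|exact: L1_cst].
  move=> w; rewrite /dqv; move: (dX i w) (dX j w) => x y.
  have : (x * y) ^+ 2 *+ 2 <= (x ^+ 2) ^+ 2 + (y ^+ 2) ^+ 2.
    by rewrite exprMn -subr_ge0; have := sqr_ge0 (x ^+ 2 - y ^+ 2); rewrite sqrrB; lra.
  have e01 : (i == j)%:R = 0 :> R \/ (i == j)%:R = 1 :> R by case: eqP; [right|left].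
  move: (x * y) => z hz; have := sqr_ge0 (z + (i == j)%:R * (u - s)); have := sqr_ge0 (u - s).
  by case: e01 => ->; rewrite ?mul0r ?mul1r; nra.
rewrite meanD ?meanD ?mean_cst; try exact: L1_sqr; try exact: L1_cst.
  by have := sqr_ge0 (u - s); nra.
by apply: L1D; exact: L1_sqr.
Qed.

End increment_moments.

Section adapted_products.
Variables (H : R -> set (set Omega)) (X : process R d Omega).
Hypothesis fbm : filtered_bm H X.
Variables (s u : R) (Z : Omega -> R).
Hypotheses (s0 : 0 <= s) (su : s < u) (uT : u <= T) (aZ : aem P (H s) Z).

Lemma mean_adapted_increment i : L1 P Z -> mean P (fun w => Z w * (X u i w - X s i w)) = 0.
Proof.
move=> hZ; have [hi _] := L2_increment fbm s0 su uT i.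
have [_ ->] := @aem_mulM _ _ fbm s u s0 su uT Z i i fst aZ (@measurable_fst _ _ _ _) hZ (L2_L1 hi).
by rewrite (mean_increment fbm s0 su uT i) mulr0.
Qed.

Lemma mean_adapted_increments i j : L1 P Z ->
  mean P (fun w => Z w * ((X u i w - X s i w) * (X u j w - X s j w))) =
  (i == j)%:R * (u - s) * mean P Z.
Proof.
move=> hZ; have [hi _] := L2_increment fbm s0 su uT i; have [hj _] := L2_increment fbm s0 su uT j.
have mg : measurable_fun setT (fun z : R * R => z.1 * z.2) by exact: measurable_funM.
have [_ ->] := @aem_mulM _ _ fbm s u s0 su uT Z i j _ aZ mg hZ (L2M hi hj).
by rewrite (mean_increments fbm s0 su uT) mulrC.
Qed.

(** One step of the Ito isometry: [Z ^+ 2] is independent of the squared increment. *)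
Lemma L2_adapted_increment i : L2 P Z -> L2 P (fun w => Z w * (X u i w - X s i w)) /\
  nrm P (fun w => Z w * (X u i w - X s i w)) ^+ 2 = (u - s) * nrm P Z ^+ 2.
Proof.
move=> hZ; have [hi vi] := L2_increment fbm s0 su uT i.
have sG : sub_sigma (H s) by apply: (fbm_sigma fbm); rewrite s0 (le_trans (ltW su)).
have aZ2 : aem P (H s) (fun w => Z w ^+ 2).
  by under eq_fun do rewrite expr2; exact: aemM.
have mg : measurable_fun setT (fun z : R * R => z.1 ^+ 2) by exact: measurable_funX.
have [hm em] := @aem_mulM _ _ fbm s u s0 su uT _ i i _ aZ2 mg (L1_sqr hZ) (L1_sqr hi).
split; last first.
  rewrite !nrm_sqr -vi mulrC -em; by apply: eq_mean => w; rewrite exprMn.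
split; first by apply: measurable_funM; [exact: L2_measurable hZ|exact: L2_measurable hi].
by under eq_fun do rewrite exprMn.
Qed.

Lemma L2_adapted_dqv i j : L2 P Z -> L2 P (fun w => Z w * dqv X s u i j w) /\
  nrm P (fun w => Z w * dqv X s u i j w) ^+ 2 <= 258 * (u - s) ^+ 2 * nrm P Z ^+ 2.
Proof.
move=> hZ; have [hq vq] := L2_dqv fbm s0 su uT i j.
have sG : sub_sigma (H s) by apply: (fbm_sigma fbm); rewrite s0 (le_trans (ltW su)).
have aZ2 : aem P (H s) (fun w => Z w ^+ 2).
  by under eq_fun do rewrite expr2; exact: aemM.
have mg : measurable_fun setT (fun z : R * R => (z.1 * z.2 - (i == j)%:R * (u - s)) ^+ 2).
  by apply: measurable_funX; apply: measurable_funB => //; exact: measurable_funM.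
have [hm em] := @aem_mulM _ _ fbm s u s0 su uT _ i j _ aZ2 mg (L1_sqr hZ) (L1_sqr hq).
split; last first.
  rewrite !nrm_sqr; under eq_mean do rewrite exprMn.
  rewrite em mulrC ler_wpM2r//; apply: mean_ge0 => w; exact: sqr_ge0.
split; first by apply: measurable_funM; [exact: L2_measurable hZ|exact: L2_measurable hq].
by under eq_fun do rewrite exprMn.
Qed.

End adapted_products.
End filtered_brownian_motion.

(** * The rotated Brownian motion *)

Section doob_dynkin.
Context {R : realType} {d : nat} {disp : measure_display} {Omega : measurableType disp}.
Variables (P : probability Omega R) (T : R).

Lemma sub_sigma_generated s (X : process R d Omega) :
  (forall r i, 0 <= r <= s -> measurable_fun setT (X r i)) -> sub_sigma (generated_sigma s X).
Proof.
by move=> mX; split; [exact: sigma_algebra_generated|exact: generated_sigma_measurable].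
Qed.

Lemma adapted_generated {U : Type} s (X : process R d U) r i : 0 <= r <= s ->
  measurable_wrt (generated_sigma s X) (X r i).
Proof. by move=> rs B mB; apply: sub_sigma_algebra; exists r, i, B. Qed.

(* The functional is recovered from the cuts [F < q], q rational. *)
Lemma doob_dynkin s (X : process R d Omega) (F : Omega -> R) :
  measurable_wrt (generated_sigma s X) F ->
  exists2 Phi, measurable_wrt (generated_sigma s (@evaluation R d)) Phi & F = Phi \o path_of X.
Proof.
move=> mF.
have /choice[A hA] : forall q : rat, exists A, generated_sigma s (@evaluation R d) A /\
    path_of X @^-1` A = [set w | F w < ratr q].
  move=> q; have : generated_sigma s X (F @^-1` `]-oo, ratr q[) by exact: mF.
  rewrite generated_sigma_preimage; by case=> A sA eA; exists A.
pose C := g_sigma_algebraType (generated_sigma s (@evaluation R d)).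
have sC : sigma_algebra setT (generated_sigma s (@evaluation R d)) by exact: sigma_algebra_generated.
(* [g n] is the rational [q] coded by [n] on the cut [A q], and [+oo] elsewhere or when [n] codes no
   rational; its infimum over [n] at the path of [w] is [F w]. *)
pose g (n : nat) (x : C) : \bar R :=
  if unpickle n is Some q then ((ratr q)%:E + (\1_(~` A q) x)%:E * +oo)%E else +oo%E.
have mg n : measurable_fun setT (g n).
  rewrite /g; case: (unpickle n) => [q|] //.
  apply: emeasurable_funD => //; apply: emeasurable_funM => //.
  apply/measurable_EFinP; apply: measurable_indic; apply: measurableC.
  by apply: sub_sigma_algebra; have [] := hA q.
exists (fun x => fine (einfs (g ^~ x) 0)).
  apply/(measurable_wrtP _ sC); apply: measurableT_comp => //.
  exact: measurable_fun_einfs.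
apply/funext => w /=; rewrite (_ : einfs _ _ = (F w)%:E)//.
have gE q : F w < ratr q -> g (pickle q) (path_of X w) = (ratr q)%:E.
  move=> Fq; rewrite /g pickleK indicE memNset ?mul0e ?adde0//.
  have [_ e] := hA q; have : (path_of X @^-1` A q) w by rewrite e.
  by move=> h; apply.
apply/eqP; rewrite eq_le; apply/andP; split.
  apply/lee_addgt0Pr => e e0.
  have [q] := @rat_in_itvoo R (F w) (F w + e) (ltr_pwDr e0 (lexx _)).
  rewrite in_itv/= => /andP[q1 q2].
  apply: (@le_trans _ _ (ratr q)%:E); last by rewrite -EFinD lee_fin ltW.
  by apply: ereal_inf_lbound; exists (pickle q) => //; exact: gE.
apply: le_ereal_inf_tmp => _ [n _ <-]; rewrite /g; case: (unpickle n) => [q|]; last by rewrite leey.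
have [Aq|nAq] := pselect (A q (path_of X w)).
  rewrite indicE memNset ?mul0e ?adde0//.
  have [_ e] := hA q; have : (path_of X @^-1` A q) w by [].
  by rewrite e/= lee_fin => /ltW.
by rewrite indicE mem_set// mul1e addey// leey.
Qed.

End doob_dynkin.

(** * The two filtrations, the law of the rotated motion, and the lift of functionals *)

Section filtrations.
Context {R : realType} {d : nat} {disp : measure_display} {Omega : measurableType disp}.
Variables (P : probability Omega R) (T : R) (W Wperp : process R d Omega).
Hypotheses (W_bm : brownian_motion P T W) (Wperp_bm : brownian_motion P T Wperp).
Hypothesis indep : independent_sigma P (generated_sigma T W) (generated_sigma T Wperp).

Let sub_itv (s r : R) : s <= T -> 0 <= r <= s -> 0 <= r <= T.
Proof. by move=> sT /andP[-> rs]; rewrite (le_trans rs). Qed.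

Let msub (X : process R d Omega) s : brownian_motion P T X -> s <= T ->
  forall r i, 0 <= r <= s -> measurable_fun setT (X r i).
Proof. by move=> [mX _ _ _ _] sT r i rs; apply: mX; exact: sub_itv rs. Qed.

Lemma filtered_bm_generated : filtered_bm P T (fun s => generated_sigma s W) W.
Proof.
split.
- by move=> s /andP[_ sT]; apply: sub_sigma_generated; exact: msub.
- by move=> s u _ su _; exact: generated_sigma_mono.
- by move=> s i /andP[s0 sT]; apply: adapted_generated; rewrite s0 lexx.
- move=> s u C s0 su uT mC A sA; rewrite -(increment_rectangle W_bm s0 su uT mC).
  (* Here the extra information is trivial. *)
  have := @future_increments_independent R d _ Omega P T W [set setT] s u C W_bm _ _ s0 su uT mC
    setT A erefl sA.
  rewrite setTI; apply; first by move=> _ ->.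
  by move=> _ B -> _; rewrite setTI probability_setT mul1e.
Qed.

(* The whole path of W is known from the start, and Wperp is still a Brownian motion. *)
Definition enlarged s := sigma_join (generated_sigma T W) (generated_sigma s Wperp).

Lemma generated_setT s (X : process R d Omega) : generated_sigma s X setT.
Proof.
have [G0 GC _] := sigma_algebra_generated s X.
by rewrite -setC0 -setTD; exact: GC.
Qed.

Lemma generated_setI s (X : process R d Omega) : setI_closed (generated_sigma s X).
Proof.
have GE : <<s generated_sigma s X >> = generated_sigma s X.
  exact/sigma_algebra_id/sigma_algebra_generated.
by move=> A B; rewrite -GE; exact: (@measurableI _ (g_sigma_algebraType (generated_sigma s X))).
Qed.

Lemma sub_sigma_enlarged s : s <= T -> sub_sigma (enlarged s).
Proof.
move=> sT; split; first exact: smallest_sigma_algebra.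
apply: smallest_sub; first exact: sigma_algebra_measurable.
move=> _ [A sA [B sB <-]]; apply: measurableI.
  by apply: generated_sigma_measurable sA; exact: msub.
by apply: generated_sigma_measurable sB; exact: msub.
Qed.

(** Independence of a future increment holds for intersections of an event of the path of [W] with
    one of the past of [Wperp]; [independent_join] carries it to the generated sigma-algebra. *)
Lemma filtered_bm_enlarged : filtered_bm P T enlarged Wperp.
Proof.
split.
- by move=> s /andP[_ sT]; exact: sub_sigma_enlarged.
- move=> s u _ su _; apply: sub_g_sigma_algebra => _ [A sA [B sB <-]].
  by exists A => //; exists B => //; exact: generated_sigma_mono sB.
- move=> s i /andP[s0 sT] B mB; apply: sigma_joinr; first exact: generated_setT.
  by apply: adapted_generated => //; rewrite s0 lexx.
- move=> s u C s0 su uT mC A sA; rewrite -(increment_rectangle Wperp_bm s0 su uT mC).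
  have sT : s <= T by exact: le_trans (ltW su) uT.
  have mW : generated_sigma T W `<=` measurable by apply: generated_sigma_measurable; exact: msub.
  have mWp : generated_sigma s Wperp `<=` measurable by apply: generated_sigma_measurable; exact: msub.
  have uI : 0 <= u <= T by rewrite uT (le_trans s0)// ltW.
  have sI : 0 <= s <= T by rewrite s0.
  have [mp _ _ _ _] := Wperp_bm.
  refine (@independent_join R _ Omega P (generated_sigma T W) (generated_sigma s Wperp) _ _ _ _ _ _ _ _ _ A _).2.
  all: try exact: generated_setI.
  all: try exact: generated_setT.
  all: try exact: mW.
  all: try exact: mWp.
  - apply: fin_bigcap_measurable => // i _; rewrite -[X in measurable X]setTI.
    by apply: measurable_funB => //; exact: mp.
  - by move=> A' B' sA' sB'; apply: (future_increments_independent Wperp_bm mW indep).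
  - exact: sA.
Qed.

Variables (kappa : 'I_d -> R) (theta : R).
Hypotheses (kappa0 : forall i, 0 <= kappa i) (theta0 : 0 <= theta).

Local Notation B := (ou_process W Wperp kappa theta).
Definition ou_e i : R := expR (- (kappa i * theta)).
Definition ou_b i : R := Num.sqrt (1 - expR (- (2 * kappa i * theta))).

Lemma ou_e_gt0 i : 0 < ou_e i. Proof. exact: expR_gt0. Qed.
Lemma ou_b_ge0 i : 0 <= ou_b i. Proof. exact: sqrtr_ge0. Qed.

Lemma ou_b_sqr i : ou_b i ^+ 2 = 1 - expR (- (2 * kappa i * theta)).
Proof.
by rewrite sqr_sqrtr// subr_ge0 -expR0 ler_expR oppr_le0 !mulr_ge0.
Qed.

Lemma ou_sqr i : ou_e i ^+ 2 + ou_b i ^+ 2 = 1.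
Proof.
have -> : ou_e i ^+ 2 = expR (- (2 * kappa i * theta)).
  by rewrite expr2 -expRD; congr expR; ring.
by rewrite ou_b_sqr addrC subrK.
Qed.

Lemma measurable_ou s i : 0 <= s <= T -> measurable_fun setT (B s i).
Proof.
have [mW _ _ _ _] := W_bm; have [mWp _ _ _ _] := Wperp_bm => sT.
by apply: measurable_funD; apply: measurable_funM => //; [exact: mW|exact: mWp].
Qed.

(** For each step and coordinate the increments of [W] and [Wperp] are two independent normal
    variables of equal variance, and [D p] is the event that their rotation falls in [C p]. These
    pairs are mutually independent, so rotation invariance applies factor by factor. *)
Lemma ou_rectangle n (tau : nat -> R) (C : 'I_n * 'I_d -> set R) :
  tau 0%N = 0 -> tau n = T -> (forall k, (k < n)%N -> tau k < tau k.+1) ->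
  (forall p, measurable (C p)) ->
  P (\bigcap_(p in [set: 'I_n * 'I_d]) increments B tau p @^-1` C p) =
  (\prod_(p : 'I_n * 'I_d) normal_prob 0 (Num.sqrt (tau p.1.+1 - tau p.1)) (C p))%E.
Proof.
move=> tau0 tauT taul mC.
have tau_in k : (k <= n)%N -> 0 <= tau k <= T.
  by move=> kn; rewrite -{1}tau0 -tauT !(chain_le taul).
have minc (X : process R d Omega) (p : 'I_n * 'I_d) : brownian_motion P T X ->
    measurable_fun setT (increments X tau p : Omega -> R).
  by move=> [mX _ _ _ _]; apply: measurable_funB; apply: mX; apply: tau_in => //; exact: ltnW.
pose nu (p : 'I_n * 'I_d) : probability (measurableTypeR R) R :=
  normal_prob 0 (Num.sqrt (tau p.1.+1 - tau p.1)).
pose D (p : 'I_n * 'I_d) : set (measurableTypeR R * measurableTypeR R) :=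
  [set z | C p (ou_e p.2 * z.1 + ou_b p.2 * z.2)].
have mD p : measurable (D p).
  rewrite -[X in measurable X]setTI.
  have : measurable_fun setT (fun z : measurableTypeR R * measurableTypeR R =>
    ou_e p.2 * z.1 + ou_b p.2 * z.2 : R).
    by apply: (@measurable_funD _ _ R); apply: (@measurable_funM _ _ R).
  by apply => //; exact: mC.
have sinc (X : process R d Omega) (A : 'I_n * 'I_d -> set R) : (forall p, measurable (A p)) ->
    generated_sigma T X (\bigcap_(p in [set: 'I_n * 'I_d]) increments X tau p @^-1` A p).
  move=> mA; have GE : <<s generated_sigma T X >> = generated_sigma T X.
    exact/sigma_algebra_id/sigma_algebra_generated.
  rewrite -GE; apply: (@fin_bigcap_measurable _ (g_sigma_algebraType (generated_sigma T X))) => // p _.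
  rewrite -[Y in measurable Y]setTI; apply: measurable_funB => //.
    by apply/(measurable_wrtP _ (sigma_algebra_generated _ _)); apply: adapted_generated; exact: tau_in.
  by apply/(measurable_wrtP _ (sigma_algebra_generated _ _)); apply: adapted_generated; apply: tau_in; exact: ltnW.
have := @pair_rectangle R _ Omega P _ nu (fun p => increments W tau p) (fun p => increments Wperp tau p)
  (fun p => minc W p W_bm) (fun p => minc Wperp p Wperp_bm) _ D mD.
rewrite (_ : \bigcap_(p in setT) _ = \bigcap_(p in [set: 'I_n * 'I_d]) increments B tau p @^-1` C p); last first.
  apply: eq_bigcapr => p _; apply/seteqP; split=> w; rewrite /preimage/= /increments /ou_process -/(ou_e _) -/(ou_b _).
    by rewrite /D/=; move=> h; apply: (eq_ind _ (C p) h); ring.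
  by rewrite /D/=; move=> h; apply: (eq_ind _ (C p) h); ring.
move=> ->.
  apply: eq_bigr => p _; apply: normal_rotation; rewrite ?ou_e_gt0 ?ou_b_ge0 ?ou_sqr//.
    by rewrite gt_eqF// sqrtr_gt0 subr_gt0 taul.
  exact: mC.
move=> A A' mA mA'; rewrite bigcapI indep; [|exact: sinc|exact: sinc].
have rectE (X : process R d Omega) (K : 'I_n * 'I_d -> set R) : brownian_motion P T X ->
    (forall p, measurable (K p)) ->
    P (\bigcap_(p in [set: 'I_n * 'I_d]) increments X tau p @^-1` K p) = (\prod_p nu p (K p))%E.
  by move=> bX mK; apply: (increments_rectangle bX); rewrite ?tau0 ?tauT.
by rewrite big_split; congr (_ * _)%E; exact: rectE.
Qed.

Hypothesis T0 : 0 <= T.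

(** Both processes start at 0 almost surely and their increments along any chain from 0 to [T] have
    the same law, so their laws on path space agree. *)
Lemma ou_law E : generated_sigma T (@evaluation R d) E ->
  [/\ measurable (path_of W @^-1` E), measurable (path_of B @^-1` E)
    & P (path_of W @^-1` E) = P (path_of B @^-1` E)].
Proof.
have [mW W0 _ _ _] := W_bm; have [_ Wp0 _ _ _] := Wperp_bm.
apply: process_pushforward => //.
- by rewrite (le_lt_trans (probability_le1 _ _))// ltry.
- by move=> r i; exact: measurable_ou.
- move=> i; apply: filterS2 (W0 i) (Wp0 i) => w h1 h2.
  by rewrite /ou_process h1 h2 !mulr0 addr0.
- move=> n tau tau0 taus tau_lt C mC; apply: (etrans _ (esym (ou_rectangle tau0 taus tau_lt mC))).
  by apply: (increments_rectangle W_bm); rewrite ?tau0 ?taus.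
Qed.

(* If F = Phi(W) then Fh = Phi(B); since B has the law of W, Fh depends only on F. *)
Definition is_lift (F Fh : Omega -> R) : Prop :=
  measurable_fun setT Fh /\ exists2 Phi, represents P T W Phi F & Fh = Phi \o path_of B %[ae P].

Let sE := sigma_algebra_generated T (@evaluation R d).

Lemma measurable_wrt_path (X : process R d Omega) (Phi : (R -> 'I_d -> R) -> R) :
  (forall E, generated_sigma T (@evaluation R d) E -> measurable (path_of X @^-1` E)) ->
  measurable_wrt (generated_sigma T (@evaluation R d)) Phi ->
  measurable_fun setT (Phi \o path_of X).
Proof. by move=> h mPhi _ C mC; rewrite setTI; exact: (h (Phi @^-1` C) (mPhi C mC)). Qed.

Lemma measurable_represented (Phi : (R -> 'I_d -> R) -> R) : measurable_wrt (generated_sigma T (@evaluation R d)) Phi ->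
  measurable_fun setT (Phi \o path_of W) /\ measurable_fun setT (Phi \o path_of B).
Proof.
by move=> mPhi; split; apply: measurable_wrt_path => // E /ou_law[].
Qed.

(** Doob-Dynkin supplies a representing functional, so the choice made in [functional_of] is not its
    default value. *)
Lemma lift_exists F : aem P (generated_sigma T W) F -> is_lift F (functional_of P T W F \o path_of B).
Proof.
move=> [mF [F' mF' eF]].
have h : represents P T W (functional_of P T W F) F.
  apply: (@xgetPex _ (cst 0) [set Phi | represents P T W Phi F]).
  have [Phi mPhi e] := doob_dynkin mF'; exists Phi; split => //.
  by rewrite -e.
split; first exact: (measurable_represented h.1).2.
by exists (functional_of P T W F) => //; exact: ae_eq_refl.
Qed.

(** The set where two representing functionals differ is null for the law of [W], hence for that of
    [B]. *)
Lemma lift_ae F F' Fh Fh' : is_lift F Fh -> is_lift F' Fh' -> F = F' %[ae P] -> Fh = Fh' %[ae P].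
Proof.
move=> [mFh [Phi [mPhi ePhi] e]] [mFh' [Phi' [mPhi' ePhi'] e']] FF'.
pose E : set (R -> 'I_d -> R) := [set x | Phi x - Phi' x != 0].
have sgE : generated_sigma T (@evaluation R d) E.
  have : measurable_wrt (generated_sigma T (@evaluation R d)) (fun x => Phi x - Phi' x).
    apply/(measurable_wrtP _ sE); apply: measurable_funB; exact/(measurable_wrtP _ sE).
  move=> /(_ (~` [set 0])); rewrite (_ : _ @^-1` _ = E); first by apply; exact: measurableC.
  by apply/seteqP; split=> x /= /eqP.
have [m1 m2 eP] := ou_law sgE.
have W0 : P (path_of W @^-1` E) = 0%E.
  apply/negligibleP => //; rewrite /E.
  have : {ae P, forall w, Phi (path_of W w) - Phi' (path_of W w) = 0}.
    apply: filterS3 ePhi ePhi' FF' => w /(_ Logic.I) h1 /(_ Logic.I) h2 /(_ Logic.I) h3.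
    by rewrite /= in h1 h2; rewrite -h1 -h2 h3 subrr.
  apply: negligibleS => w /= /eqP h; exact: h.
have B0 : {ae P, forall w, Phi (path_of B w) - Phi' (path_of B w) = 0}.
  exists (path_of B @^-1` E); split => //; first by rewrite -eP.
  by move=> w /= /eqP.
apply: filterS3 B0 e e' => w h1 h2 h3 _; rewrite h2// h3//.
by apply/eqP; rewrite -subr_eq0; apply/eqP.
Qed.

Lemma lift_comp2 (f : R -> R -> R) F G Fh Gh : measurable_fun setT (fun z => f z.1 z.2) ->
  is_lift F Fh -> is_lift G Gh -> is_lift (fun w => f (F w) (G w)) (fun w => f (Fh w) (Gh w)).
Proof.
move=> mf [mFh [Phi [mPhi ePhi] e]] [mGh [Psi [mPsi ePsi] e']]; split.
  exact: (measurableT_comp mf (measurable_fun_pair mFh mGh)).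
exists (fun x => f (Phi x) (Psi x)); last first.
  by apply: filterS2 e e' => w h1 h2 _; rewrite /= h1// h2.
split; last by apply: filterS2 ePhi ePsi => w h1 h2 _; rewrite /= h1// h2.
apply/(measurable_wrtP _ sE).
apply: (@measurableT_comp _ _ _ (g_sigma_algebraType _) _ _ (fun z => f z.1 z.2) setT
  (fun w => (Phi w, Psi w)) mf).
by apply: measurable_fun_pair; exact/(measurable_wrtP _ sE).
Qed.

Lemma lift_cst c : is_lift (fun=> c) (fun=> c).
Proof.
split => //; exists (fun=> c); last exact: ae_eq_refl.
by split; [exact/(measurable_wrtP _ sE)|exact: ae_eq_refl].
Qed.

Lemma lift_evaluation s i : 0 <= s <= T -> is_lift (W s i) (B s i).
Proof.
move=> sT; split; first exact: measurable_ou.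
exists (fun x => x s i); last exact: ae_eq_refl.
by split; [exact: (@adapted_generated _ _ _ T (@evaluation R d))|exact: ae_eq_refl].
Qed.

Lemma liftD F G Fh Gh : is_lift F Fh -> is_lift G Gh ->
  is_lift (fun w => F w + G w) (fun w => Fh w + Gh w).
Proof. by apply: (@lift_comp2 (fun x y => x + y)); exact: measurable_funD. Qed.

Lemma liftB F G Fh Gh : is_lift F Fh -> is_lift G Gh ->
  is_lift (fun w => F w - G w) (fun w => Fh w - Gh w).
Proof. by apply: (@lift_comp2 (fun x y => x - y)); exact: measurable_funB. Qed.

Lemma liftM F G Fh Gh : is_lift F Fh -> is_lift G Gh ->
  is_lift (fun w => F w * G w) (fun w => Fh w * Gh w).
Proof. by apply: (@lift_comp2 (fun x y => x * y)); exact: measurable_funM. Qed.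

Lemma lift_sum (I : Type) (s : seq I) (F Fh : I -> Omega -> R) :
  (forall i, is_lift (F i) (Fh i)) ->
  is_lift (fun w => \sum_(i <- s) F i w) (fun w => \sum_(i <- s) Fh i w).
Proof.
move=> h; elim: s => [|i s IH].
  under eq_fun do rewrite big_nil; under [X in is_lift _ X]eq_fun do rewrite big_nil.
  exact: lift_cst.
rewrite (_ : (fun w => _) = fun w => F i w + \sum_(i <- s) F i w); last first.
  by apply/funext => w; rewrite big_cons.
rewrite [X in is_lift _ X](_ : _ = fun w => Fh i w + \sum_(i <- s) Fh i w).
  exact: liftD.
by apply/funext => w; rewrite big_cons.
Qed.

Lemma lift_L1 F Fh : is_lift F Fh -> L1 P F -> L1 P Fh /\ mean P Fh = mean P F.
Proof.
move=> [mFh [Phi [mPhi ePhi] e]] hF; have mF := L1_measurable hF.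
have [mW mB] := measurable_represented mPhi.
have pre (Y : Omega -> R) C : measurable_fun setT Y -> measurable C -> measurable (Y @^-1` C).
  by move=> mY mC; rewrite -[X in measurable X]setTI; exact: mY.
apply: mean_pushforward => // C mC.
rewrite (@measure_ae_eq _ _ _ P (F @^-1` C) ((Phi \o path_of W) @^-1` C)); last 3 first.
- exact: pre.
- exact: pre.
- by apply: filterS ePhi => w h; rewrite /preimage /= h.
rewrite (@measure_ae_eq _ _ _ P (Fh @^-1` C) ((Phi \o path_of B) @^-1` C)); last 3 first.
- exact: pre.
- exact: pre.
- by apply: filterS e => w h; rewrite /preimage /= h.
by have [] := ou_law (mPhi C mC).
Qed.

Lemma lift_L2 F Fh : is_lift F Fh -> L2 P F -> L2 P Fh /\ nrm P Fh = nrm P F.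
Proof.
move=> h hF; have h2 := @lift_comp2 (fun x _ => x ^+ 2) _ _ _ _ _ h h.
have [|h1 e] := lift_L1 (h2 _) (L1_sqr hF); first by apply: measurable_funX.
by split; [split => //; exact: h.1|rewrite /nrm e].
Qed.

(** An adapted variable has a functional that looks at the path up to [s] only, and its value at [B]
    involves [Wperp] up to [s] only. By uniqueness of the lift, [Fh] agrees with it almost surely
    whatever functional defined [Fh]. *)
Lemma lift_adapted s F Fh : 0 <= s <= T -> aem P (generated_sigma s W) F -> is_lift F Fh ->
  aem P (enlarged s) Fh.
Proof.
move=> /andP[s0 sT] [mF [F' mF' eF]] hF.
have [Phi mPhi e] := doob_dynkin mF'.
have mPhiT : measurable_wrt (generated_sigma T (@evaluation R d)) Phi.
  by move=> C mC; apply: generated_sigma_mono sT _ _; exact: mPhi.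
have hB : generated_sigma s B `<=` enlarged s.
  apply: smallest_sub; first exact: (sub_sigma_enlarged sT).1.
  move=> _ [r [i [C [rs mC ->]]]].
  have rT := sub_itv sT rs.
  have : aem P (enlarged s) (B r i) -> True by [].
  have mr : measurable_wrt (enlarged s) (B r i); last by move=> _; exact: mr.
  have sGe := (sub_sigma_enlarged sT).1.
  apply/(measurable_wrtP _ sGe).
  apply: measurable_funD; apply: measurable_funM => //; apply/(measurable_wrtP _ sGe) => D mD.
    apply: sigma_joinl; first exact: generated_setT.
    exact: adapted_generated.
  apply: sigma_joinr; first exact: generated_setT.
  exact: adapted_generated.
have mPB : measurable_wrt (enlarged s) (Phi \o path_of B).
  move=> C mC; apply: hB; rewrite generated_sigma_preimage.
  by exists (Phi @^-1` C) => //; exact: mPhi.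
split; first exact: hF.1.
exists (Phi \o path_of B) => //.
apply: (lift_ae hF (F' := F)); last exact: ae_eq_refl.
split; first exact: (measurable_represented mPhiT).2.
exists Phi; last exact: ae_eq_refl.
by split => //; rewrite -e.
Qed.

End filtrations.

(** * Mean-square estimates for the signature *)

Section grids.
Context {R : realType}.

Definition grid (s u : R) n k : R := s + k%:R * ((u - s) / n.+1%:R).

Lemma grid0 s u n : grid s u n 0 = s.
Proof. by rewrite /grid mul0r addr0. Qed.

Lemma grid_last s u n : grid s u n n.+1 = u.
Proof. by rewrite /grid mulrC divfK ?pnatr_eq0// addrC subrK. Qed.

Lemma gridS s u n k : grid s u n k.+1 - grid s u n k = (u - s) / n.+1%:R.
Proof. by rewrite /grid -natr1; ring. Qed.

Lemma grid_step_gt0 (s u : R) n : s < u -> 0 < (u - s) / n.+1%:R.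
Proof. by move=> su; rewrite divr_gt0// ?subr_gt0// ltr0n. Qed.

Lemma grid_lt s u n k : s < u -> grid s u n k < grid s u n k.+1.
Proof. by move=> su; rewrite -subr_gt0 gridS grid_step_gt0. Qed.

Lemma grid_mono s u n j k : s < u -> (j <= k)%N -> grid s u n j <= grid s u n k.
Proof.
move=> su jk; rewrite /grid lerD2l ler_wpM2r ?ler_nat//.
by rewrite ltW// grid_step_gt0.
Qed.

Lemma grid_itv s u n k : s < u -> (k <= n.+1)%N -> s <= grid s u n k <= u.
Proof.
move=> su kn; have h1 := grid_mono n su (leq0n k); have h2 := grid_mono n su kn.
by rewrite -[X in X <= _](grid0 s u n) h1 -[X in _ <= X](grid_last s u n) h2.
Qed.

Lemma grid_sum (s u : R) n : \sum_(k < n.+1) ((u - s) / n.+1%:R) = u - s.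
Proof. by rewrite sumr_const card_ord -[LHS]mulr_natr divfK ?pnatr_eq0. Qed.

Lemma grid_mesh (s u e : R) : 0 < e -> exists N, forall n, (N <= n)%N -> (u - s) / n.+1%:R < e.
Proof.
move=> e0; exists (Num.truncn (`|u - s| / e)) => n Nn.
have h : `|u - s| / e < n.+1%:R.
  by apply: (lt_le_trans (truncnS_gt _)); rewrite ler_nat.
rewrite ltr_pdivrMr ?ltr0n// (le_lt_trans (ler_norm _))//.
by rewrite mulrC -ltr_pdivrMr.
Qed.

Lemma grid_path (e : rel R) s u n : (forall k, (k <= n)%N -> e (grid s u n k) (grid s u n k.+1)) ->
  path e s (mkseq (fun k => grid s u n k.+1) n.+1).
Proof.
move=> h; apply/(pathP 0) => k; rewrite size_mkseq ltnS => kn.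
rewrite nth_mkseq ?ltnS//; case: k kn => [|k] kn /=; first by have := h 0%N kn; rewrite grid0.
by rewrite nth_mkseq ?ltnS; [exact: h|exact: ltnW].
Qed.

Lemma last_grid s u n : last s (mkseq (fun k => grid s u n k.+1) n.+1) = u.
Proof. by rewrite /mkseq -addn1 iotaD map_cat last_cat /= add0n grid_last. Qed.

End grids.

Section trapezoids.
Context {R : realType} {U : Type}.
Implicit Types (X Y : R -> U -> R).

Definition trapezoid X Y s u n (w : U) : R := \sum_(k < n.+1)
  (X (grid s u n k) w + X (grid s u n k.+1) w) / 2 *
  (Y (grid s u n k.+1) w - Y (grid s u n k) w).

(** With start 0 this is [trapezoidal_sum]; a general start makes the sums additive under
    concatenation of partitions. *)
Definition trapezoids_from X Y x (L : seq R) (w : U) : R := \sum_(k < size L)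
  (X (nth 0 (x :: L) k) w + X (nth 0 (x :: L) k.+1) w) / 2
    * (Y (nth 0 (x :: L) k.+1) w - Y (nth 0 (x :: L) k) w).

Lemma trapezoids_from_cat X Y x L1 L2 w : trapezoids_from X Y x (L1 ++ L2) w =
  trapezoids_from X Y x L1 w + trapezoids_from X Y (last x L1) L2 w.
Proof.
rewrite /trapezoids_from; elim: L1 x => [|y L IH] x /=; first by rewrite big_ord0 add0r.
by rewrite !big_ord_recl -addrA; congr (_ + _); exact: IH.
Qed.

Lemma trapezoids_from_grid X Y s u n w :
  trapezoids_from X Y s (mkseq (fun k => grid s u n k.+1) n.+1) w = trapezoid X Y s u n w.
Proof.
have e k : (k <= n.+1)%N -> nth 0 (s :: mkseq (fun k => grid s u n k.+1) n.+1) k = grid s u n k.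
  by case: k => [|k] kn /=; [rewrite grid0|rewrite nth_mkseq].
rewrite /trapezoids_from /trapezoid size_mkseq; apply: eq_bigr => k _.
by rewrite !e// ltnW// ltnS.
Qed.

End trapezoids.

(** * Discrete Ito sums *)

Section martingale_sums.
Context {R : realType} {d : nat} {disp : measure_display} {Omega : measurableType disp}.
Variables (P : probability Omega R) (T : R) (H : R -> set (set Omega)) (X : process R d Omega).
Hypothesis fbm : filtered_bm P T H X.
Variables (s u : R).
Hypotheses (s0 : 0 <= s) (su : s < u) (uT : u <= T).

Lemma grid_in n k : (k <= n.+1)%N -> 0 <= grid s u n k <= T.
Proof.
move=> kn; have /andP[h1 h2] := grid_itv su kn.
by rewrite (le_trans s0 h1) (le_trans h2 uT).
Qed.

(** Each increment is independent of all that precedes it, so the terms are orthogonal and the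
    squared norm is at most [c ^+ 2] times the sum of the steps. *)
Lemma martingale_sum n i (Z : nat -> Omega -> R) c :
  (forall k, (k <= n)%N -> aem P (H (grid s u n k)) (Z k)) ->
  (forall k, (k <= n)%N -> L2 P (Z k)) ->
  0 <= c -> (forall k, (k <= n)%N -> nrm P (Z k) <= c) ->
  L2 P (fun om => \sum_(k < n.+1) Z k om * (X (grid s u n k.+1) i om - X (grid s u n k) i om)) /\
  nrm P (fun om => \sum_(k < n.+1) Z k om * (X (grid s u n k.+1) i om - X (grid s u n k) i om))
    <= c * Num.sqrt (u - s).
Proof.
move=> aZ hZ c0 cZ; pose g := grid s u n.
have g0 k : (k <= n)%N -> 0 <= g k by move=> kn; case/andP: (grid_in (leqW kn)).
have gT k : (k <= n)%N -> g k.+1 <= T by move=> kn; case/andP: (@grid_in n k.+1 kn).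
have glt k : g k < g k.+1 by exact: grid_lt.
(* Extension by 0 beyond [n]: [nrm_sq_orthogonal] asks for a sequence of square-integrable variables
   over all natural numbers. *)
pose M k om := if (k <= n)%N then Z k om * (X (g k.+1) i om - X (g k) i om) else 0.
have ME k : (k <= n)%N -> M k = fun om => Z k om * (X (g k.+1) i om - X (g k) i om).
  by move=> kn; rewrite /M kn.
have hM k : (k <= n)%N -> L2 P (M k) /\ nrm P (M k) ^+ 2 = (u - s) / n.+1%:R * nrm P (Z k) ^+ 2.
  move=> kn; rewrite (ME k kn) -(gridS s u n k).
  exact: (L2_adapted_increment fbm (g0 k kn) (glt k) (gT k kn) (aZ k kn) i (hZ k kn)).
have L2M' k : L2 P (M k).
  have [kn|kn] := leqP k n; first by have [] := hM k kn.
  by rewrite /M leqNgt kn; exact: L2_cst.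
have orth k l : (l < k < n.+1)%N -> mean P (fun w => M l w * M k w) = 0.
  move=> /andP[lk kn']; have kn : (k <= n)%N by []; have ln : (l <= n)%N by exact: leq_trans (ltnW lk) kn.
  rewrite (ME k kn).
  have sG : sub_sigma (H (g k)) by apply: (fbm_sigma fbm); exact: grid_in (leqW kn).
  have aM : aem P (H (g k)) (M l).
    rewrite (ME l ln); apply: (@aem_sub _ _ _ _ (H (g l.+1))).
      by apply: (fbm_mono fbm); [exact: g0 (leq_trans lk kn)|exact: grid_mono|case/andP: (grid_in (leqW kn))].
    have sGl : sub_sigma (H (g l.+1)) by apply: (fbm_sigma fbm); exact: grid_in.
    apply: aemM => //; last exact: (aem_increment fbm (g0 l ln) (glt l) (gT l ln)).
    apply: aem_sub (aZ l ln); apply: (fbm_mono fbm) => //; [exact: g0|exact: ltW|exact: gT].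
  under eq_mean do rewrite mulrA.
  apply: (mean_adapted_increment fbm (g0 k kn) (glt k) (gT k kn)); first exact: aemM (aZ k kn).
  exact: L2M (hZ k kn).
have E : (fun om => \sum_(k < n.+1) Z k om * (X (grid s u n k.+1) i om - X (grid s u n k) i om)) =
    fun om => \sum_(k < n.+1) M k om.
  by apply/funext => om; apply: eq_bigr => k _; rewrite /M -ltnS ltn_ord.
rewrite E; split; first exact: L2_sum.
have us0 : 0 <= u - s by rewrite subr_ge0 ltW.
rewrite -(@ler_pXn2r _ 2)// ?nnegrE ?nrm_ge0 ?mulr_ge0 ?sqrtr_ge0//.
rewrite (nrm_sq_orthogonal L2M' orth) exprMn sqr_sqrtr// mulrC.
rewrite -[X in _ <= X * _](grid_sum s u n) mulr_suml.
apply: ler_sum => k _; have kn : (k <= n)%N by rewrite -ltnS ltn_ord.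
rewrite (hM k kn).2 ler_wpM2l//; first by rewrite ltW// grid_step_gt0.
by rewrite ler_pXn2r ?nnegrE ?nrm_ge0 ?cZ.
Qed.

End martingale_sums.

(** * Adaptedness and L2 expansion of the signature *)

Section signature_estimates.
Context {R : realType} {d : nat} {disp : measure_display} {Omega : measurableType disp}.
Variables (P : probability Omega R) (T : R) (W : process R d Omega).
Hypotheses (W_bm : brownian_motion P T W).
Variables (S : R -> Omega -> tseries R d) (S_sig : brownian_signature P T W S).

Local Notation sig w := (fun s omega => S s omega w).
Local Notation A a := (fun s omega => time_extended W s a omega).
Local Notation Gs s := (generated_sigma s W).
Local Notation mean := (mean P).
Local Notation nrm := (nrm P).
Local Notation L2 := (L2 P).
Local Notation L1 := (L1 P).

Let fbm := filtered_bm_generated W_bm.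

Lemma signature_nil s : 0 <= s <= T -> S s ^~ [::] = fun=> 1.
Proof. by move=> sT; apply/funext => w; exact: S_sig.1. Qed.

Lemma signature_L2 w s : 0 <= s <= T -> L2 (sig w s).
Proof.
case/lastP: w => [|w a] sT; first by rewrite (signature_nil sT); exact: L2_cst.
by have [[/Lfun2P]] := S_sig.2 s sT w a.
Qed.

Lemma signature_aem w s : 0 <= s <= T -> aem P (Gs T) (sig w s).
Proof.
move=> sT.
have T0 : 0 <= T by case/andP: sT => s0; exact: le_trans.
have sG : sub_sigma (Gs T) by apply: (fbm_sigma fbm); rewrite T0 lexx.
case/lastP: w => [|w a]; first by rewrite (signature_nil sT); exact: aem_cst.
by have [[/Lfun2P/L2_measurable mS h] _] := S_sig.2 s sT w a.
Qed.

Lemma measurable_time_extended a s : 0 <= s <= T -> measurable_fun setT (A a s).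
Proof.
move=> sT; rewrite /time_extended; case: unliftP => [i _|_] //.
by have [mW _ _ _ _] := W_bm; exact: mW.
Qed.

Lemma measurable_trapezoids w a x L : 0 <= x <= T -> path <%O x L -> last x L <= T ->
  measurable_fun setT (trapezoids_from (sig w) (A a) x L).
Proof.
elim: L x => [|y L IH] x xT /=.
  move=> _ _; rewrite (_ : trapezoids_from _ _ _ _ = fun=> 0)//.
  by apply/funext => om; rewrite /trapezoids_from /= big_ord0.
move=> /andP[xy pL] lT.
have yT : 0 <= y <= T.
  rewrite (le_trans _ (ltW xy)) ?(le_trans _ lT)//; last by case/andP: xT.
  have : itv_partition y (last y L) L by split.
  exact: itv_partition_le.
have := IH y yT pL lT => m.
rewrite (_ : trapezoids_from _ _ _ _ = fun om => (sig w x om + sig w y om) / 2 * (A a y om - A a x om) +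
  trapezoids_from (sig w) (A a) y L om); last first.
  by apply/funext => om; rewrite /trapezoids_from /= big_ord_recl.
apply: measurable_funD => //; apply: measurable_funM; last first.
  by apply: measurable_funB; exact: measurable_time_extended.
apply: measurable_funM => //.
by apply: measurable_funD; apply: L2_measurable; exact: signature_L2.
Qed.

Let path_mesh (e : R) x L : path (fun a b => b - a < e) x L ->
  forall k, (k < size L)%N -> nth 0 (x :: L) k.+1 - nth 0 (x :: L) k < e.
Proof. by move=> /(pathP 0) h k kL; exact: h. Qed.

(* Partitions of [0, u] that extend a fine partition of [0, s] by a grid of [s, u]. *)
Lemma trapezoid_limit w a s u : 0 <= s -> s < u -> u <= T -> forall e, 0 < e ->
  exists N, forall n, (N <= n)%N ->
  L2 (fun om => trapezoid (sig w) (A a) s u n om - (sig (rcons w a) u om - sig (rcons w a) s om)) /\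
  nrm (fun om => trapezoid (sig w) (A a) s u n om - (sig (rcons w a) u om - sig (rcons w a) s om)) <= e.
Proof.
move=> s0 su uT e e0.
have sT : 0 <= s <= T by rewrite s0 (le_trans (ltW su)).
have uI : 0 <= u <= T by rewrite uT (le_trans s0)// ltW.
have T0 : 0 <= T by case/andP: sT => ? ?; exact: le_trans s0 _.
have e20 : 0 < e / 2 by rewrite divr_gt0.
have [_ /(_ _ e20)[du du0 hu]] := S_sig.2 u uI w a.
have [_ /(_ _ e20)[ds ds0 hs]] := S_sig.2 s sT w a.
have [N hN] := grid_mesh s u du0.
exists N => n Nn.
have m0 : 0 < Num.min du ds by rewrite lt_min du0.
(* The mesh has to serve both limits, the one at [s] and the one at [u], hence the minimum; for
   [s = 0] the partition is empty. *)
have [L [pL lL mL]] : exists L, [/\ path <%O 0 L, last 0 L = s & path (fun a b => b - a < Num.min du ds) 0 L].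
  move: s0; rewrite le_eqVlt => /predU1P[<-|s0]; first by exists [::].
  have [M hM] := grid_mesh 0 s m0.
  exists (mkseq (fun k => grid 0 s M k.+1) M.+1); split; first by apply: grid_path => k _; exact: grid_lt.
    exact: last_grid.
  by apply: grid_path => k _; rewrite gridS hM.
pose L' := mkseq (fun k => grid s u n k.+1) n.+1.
have pL' : path <%O s L' by apply: grid_path => k _; exact: grid_lt.
have lL' : last s L' = u by exact: last_grid.
have mL' : path (fun a b => b - a < du) s L' by apply: grid_path => k _; rewrite gridS hN.
have toL2 X : measurable_fun setT X -> ('N[P]_2%:E[EFin \o X] <= (e / 2)%:E)%E -> L2 X /\ nrm X <= e / 2.
  move=> mX hX; have LX : L2 X by apply: Lnorm_lty_L2 => //; rewrite (le_lt_trans hX)// ltry.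
  by split=> //; rewrite -lee_fin -Lnorm_nrm.
have mS r : 0 <= r <= T -> measurable_fun setT (sig (rcons w a) r).
  by move=> rT; exact/L2_measurable/signature_L2.
have [L2s ns] : L2 (fun om => trapezoids_from (sig w) (A a) 0 L om - sig (rcons w a) s om) /\
    nrm (fun om => trapezoids_from (sig w) (A a) 0 L om - sig (rcons w a) s om) <= e / 2.
  apply: toL2.
    apply: measurable_funB; last exact: mS.
    by apply: measurable_trapezoids; rewrite ?lexx ?lL//; case/andP: sT.
  apply: hs; first by split=> //; rewrite lL.
  move=> k kL; apply: lt_le_trans (path_mesh mL kL) _; by rewrite ge_min lexx orbT.
have [L2u nu] : L2 (fun om => trapezoids_from (sig w) (A a) 0 (L ++ L') om - sig (rcons w a) u om) /\
    nrm (fun om => trapezoids_from (sig w) (A a) 0 (L ++ L') om - sig (rcons w a) u om) <= e / 2.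
  have pLL : path <%O 0 (L ++ L') by rewrite cat_path pL lL.
  have lLL : last 0 (L ++ L') = u by rewrite last_cat lL.
  apply: toL2.
    apply: measurable_funB; last exact: mS.
    by apply: measurable_trapezoids; rewrite ?lexx ?lLL.
  apply: hu; first by split=> //; rewrite lLL.
  apply: path_mesh; rewrite cat_path lL mL' andbT.
  by apply: sub_path mL => x y /lt_le_trans; apply; rewrite ge_min lexx.
have E : (fun om => trapezoid (sig w) (A a) s u n om - (sig (rcons w a) u om - sig (rcons w a) s om)) =
  (fun om => (trapezoids_from (sig w) (A a) 0 (L ++ L') om - sig (rcons w a) u om) -
    (trapezoids_from (sig w) (A a) 0 L om - sig (rcons w a) s om)).
  apply/funext => om; rewrite trapezoids_from_cat lL trapezoids_from_grid; ring.
rewrite E; split; first exact: L2B.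
apply: (le_trans (nrmB L2u L2s)); rewrite (splitr e); exact: lerD.
Qed.

(** The only partition of [[0, 0]] is empty and its sum is 0, so the mean-square limit is 0, though
    only almost surely. *)
Lemma signature0 w a : 0 <= T -> sig (rcons w a) 0 = (fun=> 0) %[ae P].
Proof.
move=> T0; have T00 : 0 <= (0 : R) <= T by apply/andP; split.
have hS := signature_L2 (rcons w a) T00.
apply: nrm_eq0_ae => //; apply/eqP; rewrite eq_le nrm_ge0 andbT.
apply/ler_addgt0Pr => e e0; rewrite add0r.
have [_ /(_ _ e0)[dl _ hd]] := S_sig.2 0 T00 w a.
have := hd [::]; rewrite /itv_partition /= => /(_ _ _).
rewrite (_ : (EFin \o _) = EFin \o (fun om => - sig (rcons w a) 0 om)); last first.
  by apply/funext => om; rewrite /= /trapezoidal_sum big_ord0 sub0r.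
rewrite Lnorm_nrm; last exact: L2N.
by rewrite nrmN lee_fin; apply.
Qed.

Lemma trapezoid_limit0 w a t : 0 < t -> t <= T -> forall e, 0 < e ->
  exists N, forall n, (N <= n)%N ->
  L2 (fun om => trapezoid (sig w) (A a) 0 t n om - sig (rcons w a) t om) /\
  nrm (fun om => trapezoid (sig w) (A a) 0 t n om - sig (rcons w a) t om) <= e.
Proof.
move=> t0 tT e e0; have [N hN] := trapezoid_limit w a (lexx 0) t0 tT e0.
have T0 : 0 <= T by rewrite (le_trans (ltW t0)).
exists N => n /hN[h1 h2].
have mm := L2_measurable h1.
have m0 : measurable_fun setT (sig (rcons w a) 0).
  by apply/L2_measurable/signature_L2; apply/andP; split.
have E : (fun om => trapezoid (sig w) (A a) 0 t n om - (sig (rcons w a) t om - sig (rcons w a) 0 om)) =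
    (fun om => trapezoid (sig w) (A a) 0 t n om - sig (rcons w a) t om) %[ae P].
  by apply: filterS (signature0 w a T0) => om /(_ Logic.I) ->; rewrite subr0.
have m' : measurable_fun setT (fun om => trapezoid (sig w) (A a) 0 t n om - sig (rcons w a) t om).
  have := measurable_funB mm m0; congr measurable_fun; apply/funext => om /=; ring.
split; first exact: L2_ae E h1.
by rewrite -(nrm_ae mm m' E).
Qed.

Lemma aem_time_extended a r s : 0 <= r -> r <= s -> s <= T -> aem P (Gs s) (A a r).
Proof.
move=> r0 rs sT; have sG : sub_sigma (Gs s) by apply: (fbm_sigma fbm); rewrite sT (le_trans r0).
rewrite /time_extended; case: unliftP => [i _|_]; last exact: aem_cst.
by apply: aem_wrt => //; apply: adapted_generated; rewrite r0.
Qed.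

(** [brownian_signature] only grants measurability for the path up to [T]. The trapezoidal sums over
    [[0, s]] see nothing after [s], and measurability up to null sets survives the L2 limit. *)
Lemma signature_adapted w s : 0 <= s <= T -> aem P (Gs s) (sig w s).
Proof.
elim/last_ind: w s => [|w a IH] s sT; have sG : sub_sigma (Gs s) by apply: (fbm_sigma fbm).
  by rewrite (signature_nil sT); exact: aem_cst.
have hS := signature_L2 (rcons w a) sT.
case/andP: (sT); rewrite le_eqVlt => /predU1P[s0|s0] sT'.
  apply: (aem_ae (X := fun=> 0)); [exact: L2_measurable hS| |exact: aem_cst].
  move: sT' {hS sG sT}; rewrite -s0 => T0.
  by apply: filterS (signature0 w a T0) => om h /h ->.
have [N hN] := trapezoid_limit0 w a s0 sT' ltr01.
(* The index is shifted by [N], beyond which the sums are known to be square integrable. *)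
apply: (@aem_lim _ _ _ _ _ sG (fun n => trapezoid (sig w) (A a) 0 s (n + N))) => //.
- move=> n; apply: aem_sum => // k.
  have gk j : (j <= (n + N).+1)%N -> 0 <= grid 0 s (n + N) j <= s.
    by move=> jn; exact: grid_itv.
  have aS j : (j <= (n + N).+1)%N -> aem P (Gs s) (sig w (grid 0 s (n + N) j)).
    move=> jn; have /andP[h1 h2] := gk j jn.
    apply: (@aem_sub _ _ _ _ (Gs (grid 0 s (n + N) j))); first exact: generated_sigma_mono.
    by apply: IH; rewrite h1 (le_trans h2).
  have aA j : (j <= (n + N).+1)%N -> aem P (Gs s) (A a (grid 0 s (n + N) j)).
    by move=> jn; have /andP[h1 h2] := gk j jn; exact: aem_time_extended.
  have kn : (k <= (n + N).+1)%N by exact: ltnW.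
  apply: aemM => //; last by apply: aemB => //; exact: aA.
  by apply: aemM => //; [apply: aemD => //; exact: aS|exact: aem_cst].
- move=> n; have [h _] := hN (n + N)%N (leq_addl _ _).
  by have := L2D h hS; congr (L2 _); apply/funext => om; rewrite subrK.
- apply/cvgrPdist_le => e e0; have [N' hN'] := trapezoid_limit0 w a s0 sT' e0.
  exists N' => // n /= Nn; rewrite sub0r normrN ger0_norm ?nrm_ge0//.
  by have [] := hN' (n + N)%N (leq_trans Nn (leq_addr _ _)).
Qed.

Lemma mean_abs_sum (I : Type) (r : seq I) (F : I -> Omega -> R) : (forall i, L1 (F i)) ->
  mean (fun om => `|\sum_(i <- r) F i om|) <= \sum_(i <- r) mean (fun om => `|F i om|).
Proof.
move=> h; rewrite -mean_sum; last by move=> i; exact: L1_abs.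
apply: le_mean; first by apply: L1_abs; exact: L1_sum.
  by apply: L1_sum => i; exact: L1_abs.
by move=> om; exact: ler_norm_sum.
Qed.

Section one_step.
Variables (s u : R) (Z : Omega -> R).
Hypotheses (s0 : 0 <= s) (su : s < u) (uT : u <= T) (aZ : aem P (Gs s) Z) (hZ : L2 Z).

Let us0 : 0 <= u - s. Proof. by rewrite subr_ge0 ltW. Qed.

Let sqrt_le : Num.sqrt (u - s) <= Num.sqrt T.
Proof. by rewrite ler_wsqrtr// lerBlDr (le_trans uT)// lerDl. Qed.

Let nrm_eq X c : 0 <= c -> nrm X ^+ 2 = c ^+ 2 -> nrm X = c.
Proof. by move=> c0 /eqP; rewrite eqrXn2 ?nrm_ge0// => /eqP. Qed.

Lemma nrm_brownian_step i : L2 (fun om => Z om * (W u i om - W s i om)) /\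
  nrm (fun om => Z om * (W u i om - W s i om)) = Num.sqrt (u - s) * nrm Z.
Proof.
have [h1 h2] := L2_adapted_increment fbm s0 su uT aZ i hZ; split => //.
have h3 := sqr_sqrtr us0.
have h4 : 0 <= Num.sqrt (u - s) * nrm Z.
  by apply: mulr_ge0; [exact: sqrtr_ge0|exact: nrm_ge0].
have h5 : nrm (fun om => Z om * (W u i om - W s i om)) ^+ 2 = (Num.sqrt (u - s) * nrm Z) ^+ 2.
  by rewrite exprMn h3.
exact: nrm_eq h4 h5.
Qed.

(** A time step satisfies [u - s <= sqrt T * sqrt (u - s)]; the factor [1 + sqrt T] covers it
    together with the Brownian case. *)
Lemma nrm_step a : L2 (fun om => Z om * (A a u om - A a s om)) /\
  nrm (fun om => Z om * (A a u om - A a s om)) <= (1 + Num.sqrt T) * Num.sqrt (u - s) * nrm Z.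
Proof.
rewrite /time_extended; case: unliftP => [i _|_].
  have [h ->] := nrm_brownian_step i; split => //.
  by rewrite ler_wpM2r ?nrm_ge0// ler_peMl ?sqrtr_ge0// lerDl sqrtr_ge0.
under eq_fun do rewrite mulrC; split; first exact: L2Z.
rewrite nrmZ// ger0_norm// ler_wpM2r ?nrm_ge0//.
rewrite -{1}(sqr_sqrtr us0) expr2 ler_wpM2r ?sqrtr_ge0// (le_trans sqrt_le)// lerDr.
exact: ler01.
Qed.

(** For two Brownian increments the product is [dqv], contributing at most 17 since
    [258 <= 17 ^+ 2], plus its mean, contributing at most 1: together 18. A time increment
    contributes [sqrt T]. *)
Lemma nrm_second_step j i :
  L2 (fun om => Z om * (A j u om - A j s om) * (W u i om - W s i om)) /\
  nrm (fun om => Z om * (A j u om - A j s om) * (W u i om - W s i om)) <=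
    (18 + Num.sqrt T) * (u - s) * nrm Z.
Proof.
rewrite /time_extended; case: unliftP => [j' _|_]; last first.
  have [h1 h2] := nrm_brownian_step i.
  under eq_fun do rewrite mulrAC mulrC; split; first exact: L2Z.
  rewrite nrmZ// ger0_norm// h2 mulrA [_ * (u - s)]mulrC ler_wpM2r ?nrm_ge0// ler_wpM2l//.
  by rewrite (le_trans sqrt_le)// lerDr.
have [h1 h2] := L2_adapted_dqv fbm s0 su uT aZ j' i hZ.
have E : (fun om => Z om * (W u j' om - W s j' om) * (W u i om - W s i om)) =
    fun om => Z om * dqv W s u j' i om + ((j' == i)%:R * (u - s)) * Z om.
  by apply/funext => om; rewrite /dqv; ring.
have h3 : nrm (fun om => Z om * dqv W s u j' i om) <= 17 * (u - s) * nrm Z.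
  rewrite -(@ler_pXn2r _ 2)// ?nnegrE ?mulr_ge0 ?nrm_ge0//.
  apply: (le_trans h2); rewrite !exprMn ler_wpM2r ?sqr_ge0// ler_wpM2r ?sqr_ge0//; lra.
have h4 : L2 (fun om => ((j' == i)%:R * (u - s)) * Z om) by exact: L2Z.
rewrite E; split; first exact: L2D.
apply: (le_trans (nrmD h1 h4)); rewrite nrmZ//.
apply: (@le_trans _ _ (17 * (u - s) * nrm Z + (u - s) * nrm Z)).
  apply: lerD => //; rewrite ler_wpM2r ?nrm_ge0// normrM (ger0_norm us0) ler_piMl//.
  by rewrite normr_nat lern1 leq_b1.
rewrite -mulrDl ler_wpM2r ?nrm_ge0// -[X in _ + X]mul1r -mulrDl ler_wpM2r//.
by have := sqrtr_ge0 T; lra.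
Qed.

End one_step.

(** Boundedness and Hoelder continuity of exponent 1/2 in L2, with one constant. The induction runs
    in a cycle: [regular w] and [product_bound w] give [expands w a], which returns both properties
    for the word [w a]. *)
Definition regular w := exists2 C, 0 <= C &
  (forall s, 0 <= s -> s <= T -> nrm (sig w s) <= C) /\
  (forall s u, 0 <= s -> s <= u -> u <= T ->
     nrm (fun om => sig w u om - sig w s om) <= C * Num.sqrt (u - s)).

Definition expands w a := exists2 C, 0 <= C & forall s u, 0 <= s -> s < u -> u <= T ->
  nrm (fun om => sig (rcons w a) u om - sig (rcons w a) s om - sig w s om * (A a u om - A a s om))
    <= C * (u - s).

(* The principal part Y is controlled in L2; the remainder, a product of two L2 variables, only in L1. *)
Definition product_bound w := exists2 C, 0 <= C & forall i s u, 0 <= s -> s < u -> u <= T ->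
  exists Y V, [/\ forall om, (sig w u om - sig w s om) * (W u i om - W s i om) = Y om + V om,
    L2 Y, nrm Y <= C * (u - s), L1 V & mean (fun om => `|V om|) <= C * (u - s) * Num.sqrt (u - s)].

Let itv_s s u : 0 <= s -> s < u -> u <= T -> 0 <= s <= T.
Proof. by move=> s0 su uT; rewrite s0 (le_trans (ltW su)). Qed.

Let itv_u s u : 0 <= s -> s < u -> u <= T -> 0 <= u <= T.
Proof. by move=> s0 su uT; rewrite uT (le_trans s0)// ltW. Qed.

Lemma L2_remainder w a s u : 0 <= s -> s < u -> u <= T ->
  L2 (fun om => sig (rcons w a) u om - sig (rcons w a) s om - sig w s om * (A a u om - A a s om)).
Proof.
move=> s0 su uT; have sI := itv_s s0 su uT; have uI := itv_u s0 su uT.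
have [h _] := nrm_step s0 su uT (signature_adapted w sI) (signature_L2 w sI) a.
by apply: L2B => //; apply: L2B; exact: signature_L2.
Qed.

Lemma product_bound_nil : product_bound [::].
Proof.
exists 0 => // i s u s0 su uT; exists (fun=> 0), (fun=> 0); split.
- move=> om; rewrite !S_sig.1 ?(itv_s s0 su uT) ?(itv_u s0 su uT)//; ring.
- exact: L2_cst.
- by rewrite nrm_cst normr0 mul0r.
- exact: L1_cst.
- by rewrite mean_cst normr0 !mul0r.
Qed.

(** The increment of the signature is replaced by its expansion. The principal term times the
    Brownian increment is [Y], bounded by [nrm_second_step]; the remainder times that increment is
    [V], bounded by Cauchy-Schwarz. *)
Lemma product_bound_rcons w a : regular w -> expands w a -> product_bound (rcons w a).
Proof.
move=> [C C0 [hC _]] [D D0 hD].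
have K0 : 0 <= (18 + Num.sqrt T) * C by rewrite mulr_ge0// addr_ge0 ?sqrtr_ge0.
exists ((18 + Num.sqrt T) * C + D); first exact: addr_ge0.
move=> i s u s0 su uT; have sI := itv_s s0 su uT; have uI := itv_u s0 su uT.
have us0 : 0 <= u - s by rewrite subr_ge0 ltW.
have [h1 h2] := nrm_second_step s0 su uT (signature_adapted w sI) (signature_L2 w sI) a i.
have hR := L2_remainder w a s0 su uT.
have [hW vW] := L2_increment fbm s0 su uT i.
exists (fun om => sig w s om * (A a u om - A a s om) * (W u i om - W s i om)),
  (fun om => (sig (rcons w a) u om - sig (rcons w a) s om - sig w s om * (A a u om - A a s om)) *
     (W u i om - W s i om)); split => //.
- by move=> om; ring.
- apply: (le_trans h2); rewrite mulrAC ler_wpM2r//.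
  apply: (@le_trans _ _ ((18 + Num.sqrt T) * C)); last by rewrite lerDl.
  by rewrite ler_wpM2l ?addr_ge0 ?sqrtr_ge0//; apply: hC => //; case/andP: sI.
- exact: L2M.
- apply: (le_trans (mean_abs_le_nrm hR hW)).
  have -> : nrm (fun om => W u i om - W s i om) = Num.sqrt (u - s) by rewrite /nrm vW.
  rewrite ler_wpM2r ?sqrtr_ge0//; apply: (le_trans (hD s u s0 su uT)).
  by rewrite ler_wpM2r// lerDr.
Qed.

Lemma regular_nil : regular [::].
Proof.
exists 1 => //; split=> [s s0 sT|s u s0 su uT].
  by rewrite signature_nil ?s0// nrm_cst normr1.
rewrite (_ : (fun om => _) = fun=> 0) ?nrm_cst ?normr0 ?mulr_ge0 ?sqrtr_ge0//.
by apply/funext => om; rewrite !S_sig.1 ?subrr// ?s0 ?uT (le_trans _ su, le_trans su).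
Qed.

Lemma regular_rcons w a : 0 <= T -> regular w -> expands w a -> regular (rcons w a).
Proof.
move=> T0 [C C0 [hC _]] [D D0 hD].
pose K := (1 + Num.sqrt T) * C + D * Num.sqrt T.
have K0 : 0 <= K by rewrite addr_ge0 ?mulr_ge0 ?addr_ge0 ?sqrtr_ge0.
have inc s u : 0 <= s -> s <= u -> u <= T ->
    nrm (fun om => sig (rcons w a) u om - sig (rcons w a) s om) <= K * Num.sqrt (u - s).
  move=> s0; rewrite le_eqVlt => /predU1P[<-|su] uT.
    rewrite (_ : (fun om => _) = fun=> 0) ?nrm_cst ?normr0 ?mulr_ge0 ?sqrtr_ge0//.
    by apply/funext => om; rewrite subrr.
  have us0 : 0 <= u - s by rewrite subr_ge0 ltW.
  have sI := itv_s s0 su uT; have hR := L2_remainder w a s0 su uT.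
  have [h1 h2] := nrm_step s0 su uT (signature_adapted w sI) (signature_L2 w sI) a.
  have := nrmD hR h1; rewrite (_ : (fun om => _ + _) = fun om => sig (rcons w a) u om - sig (rcons w a) s om).
    move=> h; apply: (le_trans h); rewrite addrC /K mulrDl; apply: lerD.
      apply: (le_trans h2); rewrite mulrAC ler_wpM2r ?sqrtr_ge0// ler_wpM2l ?addr_ge0 ?sqrtr_ge0//.
      by apply: hC => //; case/andP: sI.
    apply: (le_trans (hD s u s0 su uT)); rewrite -mulrA ler_wpM2l//.
    rewrite -{1}(sqr_sqrtr us0) expr2 ler_wpM2r ?sqrtr_ge0// ler_wsqrtr//.
    by rewrite lerBlDr (le_trans uT)// lerDl.
  by apply/funext => om; rewrite subrK.
exists (K * (1 + Num.sqrt T)); first by rewrite mulr_ge0// addr_ge0// sqrtr_ge0.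
split=> [s s0 sT|s u s0 su uT].
  have := inc 0 s (lexx 0) s0 sT.
  have T00 : 0 <= (0 : R) <= T by apply/andP; split.
  have m0 := L2_measurable (signature_L2 (rcons w a) T00).
  have ms : measurable_fun setT (sig (rcons w a) s) by apply/L2_measurable/signature_L2; rewrite s0.
  rewrite (@nrm_ae _ _ _ P _ (sig (rcons w a) s))//; last 2 first.
  - exact: measurable_funB.
  - by apply: filterS (signature0 w a T0) => om h /h ->; rewrite subr0.
  move/le_trans; apply; rewrite ler_wpM2l// subr0.
  by apply: (@le_trans _ _ (Num.sqrt T)); [exact: ler_wsqrtr|rewrite lerDr].
apply: (le_trans (inc s u s0 su uT)); rewrite ler_wpM2r ?sqrtr_ge0//.
by rewrite ler_peMr// lerDl sqrtr_ge0.
Qed.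

(** For a Brownian letter the difference is an Ito sum of [sig w (g k) - sig w s], of norm
    [O(u - s)] by the isometry, plus half the sum of the products of increments. The latter splits
    by [product_bound], and its L1 part carries an additional root of the mesh. *)
Lemma trapezoid_split w a : regular w -> product_bound w -> exists2 K, 0 <= K &
  forall s u n, 0 <= s -> s < u -> u <= T -> exists U V,
  [/\ forall om, trapezoid (sig w) (A a) s u n om - sig w s om * (A a u om - A a s om) = U om + V om,
     L2 U, nrm U <= K * (u - s), L1 V &
     mean (fun om => `|V om|) <= K * (u - s) * Num.sqrt ((u - s) / n.+1%:R)].
Proof.
move=> [C C0 [hC hC']] [D D0 hD].
exists (C * (1 + Num.sqrt T) + D); first by rewrite addr_ge0 ?mulr_ge0 ?addr_ge0 ?sqrtr_ge0.
move=> s u n s0 su uT; pose g := grid s u n; pose h := (u - s) / n.+1%:R.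
have us0 : 0 <= u - s by rewrite subr_ge0 ltW.
have h0 : 0 <= h by rewrite ltW// grid_step_gt0.
have g_in k : (k <= n.+1)%N -> 0 <= g k <= T by exact: (grid_in s0 su uT).
have gS k : g k.+1 - g k = h by exact: gridS.
have glt k : g k < g k.+1 by exact: grid_lt.
have sI : 0 <= s <= T by rewrite s0 (le_trans (ltW su)).
have Cinc k : (k <= n.+1)%N -> nrm (fun om => sig w (g k) om - sig w s om) <= C * Num.sqrt (u - s).
  move=> kn; have /andP[h1 h2] := grid_itv su kn; have /andP[_ h3] := g_in k kn.
  apply: (le_trans (hC' s (g k) s0 h1 h3)); rewrite ler_wpM2l// ler_wsqrtr//.
  by rewrite lerD2r.
have Linc k : (k <= n.+1)%N -> L2 (fun om => sig w (g k) om - sig w s om).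
  by move=> kn; apply: L2B; apply: signature_L2 => //; exact: g_in.
have sqT : Num.sqrt (u - s) <= Num.sqrt T by rewrite ler_wsqrtr// lerBlDr (le_trans uT)// lerDl.
have telA om : A a u om - A a s om = \sum_(k < n.+1) (A a (g k.+1) om - A a (g k) om).
  rewrite -(big_mkord xpredT (fun k => A a (g k.+1) om - A a (g k) om)).
  by rewrite telescope_sumr// /g grid0 grid_last.
(* For the time letter every increment of the integrator is the mesh, and the triangle inequality
   suffices with [V = 0]. *)
have [i ai|a0] := unliftP ord0 a; last first.
  have Ah om k : A a (g k.+1) om - A a (g k) om = h by rewrite /time_extended a0 unlift_none gS.
  exists (fun om => trapezoid (sig w) (A a) s u n om - sig w s om * (A a u om - A a s om)), (fun=> 0).
  have E : (fun om => trapezoid (sig w) (A a) s u n om - sig w s om * (A a u om - A a s om)) =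
      fun om => \sum_(k < n.+1) (h / 2) *
        ((sig w (g k) om - sig w s om) + (sig w (g k.+1) om - sig w s om)).
    apply/funext => om; rewrite telA mulr_sumr /trapezoid -sumrB; apply: eq_bigr => k _.
    by rewrite -/(g k) -/(g k.+1) Ah; field.
  have hF (k : 'I_n.+1) : L2 (fun om => (h / 2) *
        ((sig w (g k) om - sig w s om) + (sig w (g k.+1) om - sig w s om))).
    by apply: L2Z; apply: L2D; apply: Linc => //; exact: ltnW.
  split => [om||||]; first by rewrite addr0.
  - by rewrite E; exact: L2_sum.
  - rewrite E; apply: (le_trans (nrm_sum _ hF)).
    apply: (@le_trans _ _ (\sum_(k < n.+1) h * (C * Num.sqrt (u - s)))).
      apply: ler_sum => k _; rewrite nrmZ; last first.
        by apply: L2D; apply: Linc => //; exact: ltnW.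
      rewrite ger0_norm ?divr_ge0// -[leRHS](_ : h / 2 * (2 * (C * Num.sqrt (u - s))) = _); last by field.
      rewrite ler_wpM2l ?divr_ge0//.
      apply: (le_trans (nrmD _ _)); try (by apply: Linc => //; exact: ltnW).
      rewrite mulr_natl mulr2n; apply: lerD; apply: Cinc => //; exact: ltnW.
    rewrite -mulr_suml grid_sum mulrC ler_wpM2r//.
    apply: (@le_trans _ _ (C * (1 + Num.sqrt T))); last by rewrite lerDl.
    by rewrite ler_wpM2l// (le_trans sqT)// lerDr.
  - exact: L1_cst.
  - rewrite (@eq_mean _ _ _ _ _ (fun=> 0)); last by move=> om; rewrite normr0.
    rewrite mean_cst; apply: mulr_ge0; last exact: sqrtr_ge0.
    apply: mulr_ge0 => //; apply: addr_ge0 => //; exact: mulr_ge0.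
have AW r om : A a r om = W r i om by rewrite /time_extended ai liftK.
have /choice[Y /choice[V YV]] : forall k : 'I_n.+1, exists Y V,
   [/\ forall om, (sig w (g k.+1) om - sig w (g k) om) * (W (g k.+1) i om - W (g k) i om) = Y om + V om,
    L2 Y, nrm Y <= D * h, L1 V & mean (fun om => `|V om|) <= D * h * Num.sqrt h].
  move=> k; rewrite -(gS k).
  have kn : (k <= n.+1)%N by exact: ltnW.
  by apply: hD => //; [case/andP: (g_in k kn)|case/andP: (g_in k.+1 (ltn_ord k))].
have [L2m nm] := @martingale_sum _ _ _ _ P T _ _ fbm s u s0 su uT n i
  (fun k om => sig w (g k) om - sig w s om) (C * Num.sqrt (u - s))
  (fun k kn => aemB (fbm_sigma fbm (g_in k (leqW kn)))
     (signature_adapted w (g_in k (leqW kn)))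
     (aem_sub (@generated_sigma_mono _ _ _ s (g k) W (proj1 (andP (grid_itv su (leqW kn)))))
        (signature_adapted w sI)))
  (fun k kn => Linc k (leqW kn)) (mulr_ge0 C0 (sqrtr_ge0 _)) (fun k kn => Cinc k (leqW kn)).
have hY k : L2 (Y k) by have [] := YV k.
have hV k : L1 (V k) by have [] := YV k.
have hYs : L2 (fun om => \sum_(k < n.+1) Y k om) by exact: L2_sum.
exists (fun om => \sum_(k < n.+1) (sig w (g k) om - sig w s om) * (W (g k.+1) i om - W (g k) i om) +
    2^-1 * \sum_(k < n.+1) Y k om), (fun om => 2^-1 * \sum_(k < n.+1) V k om); split.
- move=> om; rewrite telA mulr_sumr /trapezoid -addrA -mulrDr -big_split /=.
  rewrite mulr_sumr -big_split /= -sumrB; apply: eq_bigr => k _.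
  by have [<- _ _ _ _] := YV k; rewrite -/(g k) -/(g k.+1) !AW; field.
- by apply: L2D => //; exact: L2Z.
- apply: (le_trans (nrmD L2m (L2Z _ hYs))); rewrite mulrDl; apply: lerD.
    apply: (le_trans nm); rewrite -mulrA -expr2 sqr_sqrtr// ler_wpM2r//.
    by rewrite ler_peMr// lerDl sqrtr_ge0.
  rewrite nrmZ// ger0_norm ?invr_ge0//; apply: (@le_trans _ _ (nrm (fun om => \sum_(k < n.+1) Y k om))).
    by rewrite ler_piMl ?nrm_ge0// invf_le1// ler1n.
  apply: (le_trans (nrm_sum _ hY)); rewrite -[X in D * X](grid_sum s u n) mulr_sumr.
  by apply: ler_sum => k _; have [] := YV k.
- by apply: L1Z; exact: L1_sum.
- apply: (@le_trans _ _ (mean (fun om => `|\sum_(k < n.+1) V k om|))).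
    apply: le_mean; try (by apply: L1_abs; try apply: L1Z; exact: L1_sum).
    by move=> om; rewrite normrM ger0_norm ?invr_ge0// ler_piMl ?normr_ge0// invf_le1// ler1n.
  apply: (le_trans (mean_abs_sum _ hV)).
  apply: (@le_trans _ _ (\sum_(k < n.+1) h * (D * Num.sqrt h))).
    apply: ler_sum => k _; have [_ _ _ _ hk] := YV k.
    by apply: (le_trans hk); rewrite [leRHS]mulrCA [leRHS]mulrA.
  rewrite -mulr_suml grid_sum mulrCA mulrA ler_wpM2r ?sqrtr_ge0// ler_wpM2r//.
  by rewrite lerDr mulr_ge0// addr_ge0// sqrtr_ge0.
Qed.

Lemma sqrt_mesh (s u e : R) : 0 < e ->
  exists N, forall n, (N <= n)%N -> Num.sqrt ((u - s) / n.+1%:R) < e.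
Proof.
move=> e0; have [|N hN] := @grid_mesh R s u (e ^+ 2); first by rewrite exprn_gt0.
exists N => n /hN h; rewrite -(ger0_norm (ltW e0)) -sqrtr_sqr ltr_sqrt// exprn_gt0//.
Qed.

(** As the grid is refined, the trapezoidal sums converge in L2 and the parts [V] vanish in L1, so
    the parts [U] tend to the remainder in L1; their uniform L2 bound passes to the limit. *)
Lemma expands_step w a : regular w -> product_bound w -> expands w a.
Proof.
move=> hr hp; have [K K0 hK] := trapezoid_split a hr hp.
exists K => // s u s0 su uT.
have us0 : 0 <= u - s by rewrite subr_ge0 ltW.
have /choice[U /choice[V UV]] : forall n, exists U V,
  [/\ forall om, trapezoid (sig w) (A a) s u n om - sig w s om * (A a u om - A a s om) = U om + V om,
     L2 U, nrm U <= K * (u - s), L1 V &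
     mean (fun om => `|V om|) <= K * (u - s) * Num.sqrt ((u - s) / n.+1%:R)].
  by move=> n; exact: hK.
have hR := L2_remainder w a s0 su uT.
apply: (@nrm_le_L1_limit _ _ _ P _ U) => //; try (by move=> n; have [] := UV n).
apply/cvgrPdist_le => e e0.
have e20 : 0 < e / 2 by rewrite divr_gt0.
have [N hN] := trapezoid_limit w a s0 su uT e20.
(* The [+ 1] keeps the quotient meaningful when [K * (u - s)] is 0. *)
have [M hM] := @sqrt_mesh s u (e / 2 / (K * (u - s) + 1)) (divr_gt0 e20 (ltr_wpDl (mulr_ge0 K0 us0) ltr01)).
exists (maxn N M) => // n /=; rewrite geq_max => /andP[/hN[h1 h2] /hM hMn].
have [h3 h4 _ h5 h6] := UV n.
rewrite sub0r normrN ger0_norm; last by apply: mean_ge0.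
set D := fun om => trapezoid (sig w) (A a) s u n om - (sig (rcons w a) u om - sig (rcons w a) s om) in h1 h2.
apply: (@le_trans _ _ (mean (fun om => `|D om| + `|V n om|))).
  apply: le_mean.
  - by apply: L1_abs; apply: L1B; exact: L2_L1.
  - by apply: L1D; apply: L1_abs => //; exact: L2_L1.
  move=> om; rewrite (_ : U n om - _ = D om - V n om) ?ler_normB//.
  by rewrite /D; have := h3 om; move: (trapezoid _ _ _ _ _ _) => x; move: (V n om) (U n om) => v y; lra.
rewrite meanD; [|by apply: L1_abs; exact: L2_L1|exact: L1_abs].
rewrite (splitr e); apply: lerD; first by apply: (le_trans (mean_abs_nrm h1)).
apply: (le_trans h6); apply: (@le_trans _ _ ((K * (u - s) + 1) * Num.sqrt ((u - s) / n.+1%:R))).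
  by rewrite ler_wpM2r ?sqrtr_ge0// lerDl.
rewrite mulrC -ler_pdivlMr; first exact: ltW.
by rewrite ltr_wpDl// mulr_ge0.
Qed.

Lemma signature_regular w : 0 <= T -> regular w /\ product_bound w.
Proof.
move=> T0; elim/last_ind: w => [|w a [hr hp]]; first by split; [exact: regular_nil|exact: product_bound_nil].
have he := expands_step a hr hp.
by split; [exact: regular_rcons|exact: product_bound_rcons].
Qed.

Lemma signature_expands w a : 0 <= T -> expands w a.
Proof. by move=> /(signature_regular w)[hr hp]; exact: expands_step. Qed.

End signature_estimates.

(** * The Ornstein-Uhlenbeck semigroup on the signature *)

Section limits.
Context {R : realType} {disp : measure_display} {Omega : measurableType disp}.
Variable P : probability Omega R.
Local Notation mean := (mean P).
Local Notation nrm := (nrm P).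
Local Notation L2 := (L2 P).
Local Notation L1 := (L1 P).

Lemma cvg_mean_test (Z Y : Omega -> R) (K : R) (X : nat -> Omega -> R) : measurable_fun setT Z ->
  (forall om, `|Z om| <= K) -> L2 Y ->
  (forall e, 0 < e -> exists N, forall n, (N <= n)%N ->
     L2 (fun om => X n om - Y om) /\ nrm (fun om => X n om - Y om) <= e) ->
  mean (fun om => Z om * X n om) @[n --> \oo] --> mean (fun om => Z om * Y om).
Proof.
move=> mZ ZK hY h; have hZ : L2 Z by exact: L2_bounded ZK.
apply/cvgrPdist_le => e e0.
have c0 : 0 < nrm Z + 1 by rewrite ltr_wpDl// nrm_ge0.
have [N hN] := h (e / (nrm Z + 1)) (divr_gt0 e0 c0).
exists N => // n /hN[h1 h2]; rewrite distrC.
have -> : mean (fun om => Z om * X n om) - mean (fun om => Z om * Y om) =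
    mean (fun om => Z om * (X n om - Y om)).
  rewrite -meanB; [|apply: L2M => //|exact: L2M].
    by apply: eq_mean => om; rewrite mulrBr.
  by have := L2D h1 hY; congr (L2 _); apply/funext => om; rewrite subrK.
apply: (le_trans (mean_le_nrm hZ h1)); apply: (@le_trans _ _ ((nrm Z + 1) * nrm (fun om => X n om - Y om))).
  by rewrite ler_wpM2r ?nrm_ge0// lerDl.
by rewrite mulrC -ler_pdivlMr.
Qed.

Lemma cvg_sqrt_mesh (t c : R) (x y : nat -> R) (l : R) :
  (forall n, `|x n - y n| <= c * Num.sqrt ((t - 0) / n.+1%:R)) ->
  x n @[n --> \oo] --> l -> y n @[n --> \oo] --> l.
Proof.
move=> h xl; have -> : l = l - 0 by rewrite subr0.
have -> : y = fun n => x n - (x n - y n) by apply/funext => n; rewrite subKr.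
apply: cvgB => //; apply/cvgrPdist_le => e e0.
have c0 : 0 < `|c| + 1 by rewrite ltr_wpDl.
have [N hN] := @sqrt_mesh R 0 t (e / (`|c| + 1)) (divr_gt0 e0 c0).
exists N => // n /hN hn; rewrite sub0r normrN; apply: (le_trans (h n)).
apply: (@le_trans _ _ ((`|c| + 1) * Num.sqrt ((t - 0) / n.+1%:R))).
  by rewrite ler_wpM2r ?sqrtr_ge0// (le_trans (ler_norm _))// lerDl.
by rewrite mulrC -ler_pdivlMr// ltW.
Qed.

(** The increment is grouped with [Z] and not with [X]: their product is the test variable against
    which [X] is later transferred. *)
Lemma mean_trapezoid (Z : Omega -> R) (K : R) (X Y : R -> Omega -> R) (s u : R) n : measurable_fun setT Z ->
  (forall om, `|Z om| <= K) ->
  (forall k, (k <= n.+1)%N -> L2 (X (grid s u n k))) ->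
  (forall k, (k <= n)%N -> L2 (fun om => Y (grid s u n k.+1) om - Y (grid s u n k) om)) ->
  mean (fun om => Z om * trapezoid X Y s u n om) = \sum_(k < n.+1) 2^-1 *
    (mean (fun om => Z om * (Y (grid s u n k.+1) om - Y (grid s u n k) om) * X (grid s u n k) om) +
     mean (fun om => Z om * (Y (grid s u n k.+1) om - Y (grid s u n k) om) * X (grid s u n k.+1) om)).
Proof.
move=> mZ ZK hX hY.
have h1 (k j : nat) : (k <= n)%N -> (j <= n.+1)%N ->
    L1 (fun om => Z om * (Y (grid s u n k.+1) om - Y (grid s u n k) om) * X (grid s u n j) om).
  by move=> kn jn; apply: L2M; [apply: (L2_boundedM mZ ZK); exact: hY|exact: hX].
have h2 (k : 'I_n.+1) : L1 (fun om => 2^-1 *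
    (Z om * (Y (grid s u n k.+1) om - Y (grid s u n k) om) * X (grid s u n k) om +
     Z om * (Y (grid s u n k.+1) om - Y (grid s u n k) om) * X (grid s u n k.+1) om)).
  have kn : (k <= n)%N by rewrite -ltnS.
  by apply: L1Z; apply: L1D; apply: h1 => //; exact: leqW.
transitivity (mean (fun om => \sum_(k < n.+1) 2^-1 *
    (Z om * (Y (grid s u n k.+1) om - Y (grid s u n k) om) * X (grid s u n k) om +
     Z om * (Y (grid s u n k.+1) om - Y (grid s u n k) om) * X (grid s u n k.+1) om))).
  apply: eq_mean => om; rewrite /trapezoid mulr_sumr; apply: eq_bigr => k _; by field.
rewrite mean_sum//; apply: eq_bigr => k _.
have kn : (k <= n)%N by rewrite -ltnS.
rewrite meanZ ?meanD//; try (by apply: h1 => //; exact: leqW).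
by apply: L1D; apply: h1 => //; exact: leqW.
Qed.

End limits.

(** * The lifted signature against variables of the path of W *)

Section transfer.
Context {R : realType} {d : nat} {disp : measure_display} {Omega : measurableType disp}.
Variables (P : probability Omega R) (T : R) (W Wperp : process R d Omega).
Hypotheses (T_gt0 : 0 < T) (W_bm : brownian_motion P T W) (Wperp_bm : brownian_motion P T Wperp).
Hypothesis indep : independent_sigma P (generated_sigma T W) (generated_sigma T Wperp).
Variables (S : R -> Omega -> tseries R d) (S_sig : brownian_signature P T W S).
Variables (kappa : 'I_d -> R) (kappa0 : forall i, 0 <= kappa i) (theta : R) (theta0 : 0 <= theta).

Local Notation sig w := (fun s omega => S s omega w).
Local Notation A a := (fun s omega => time_extended W s a omega).
Local Notation B := (ou_process W Wperp kappa theta).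
Local Notation Bt a := (fun s omega => time_extended B s a omega).
Local Notation Gs s := (generated_sigma s W).
Local Notation Es s := (enlarged T W Wperp s).
Local Notation mean := (mean P).
Local Notation nrm := (nrm P).
Local Notation L2 := (L2 P).
Local Notation L1 := (L1 P).
Local Notation is_lift := (is_lift P T W Wperp kappa theta).
Local Notation e_ a := (expR (- (coef kappa a * theta))).
Local Notation b_ i := (ou_b kappa theta i).

Let T0 : 0 <= T := ltW T_gt0.
Let fbm := filtered_bm_generated W_bm.
Let fbmE := filtered_bm_enlarged W_bm Wperp_bm indep.

Let TT : 0 <= T <= T. Proof. by rewrite T0 lexx. Qed.
Let sG : sub_sigma (Gs T). Proof. exact: (fbm_sigma fbm TT). Qed.

(** The lift is written with the very functional chosen in [ou_semigroup], so the semigroup is the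
    conditional expectation of [hat]. *)
Definition hat w s : Omega -> R := functional_of P T W (sig w s) \o path_of B.

Lemma hat_lift w s : 0 <= s <= T -> is_lift (sig w s) (hat w s).
Proof. by move=> sT; apply: lift_exists => //; exact: (signature_aem W_bm S_sig). Qed.

Lemma hat_L2 w s : 0 <= s <= T -> L2 (hat w s).
Proof.
move=> sT; have [] := lift_L2 W_bm Wperp_bm indep kappa0 theta0 T0 (hat_lift w sT) => //.
exact: (signature_L2 S_sig).
Qed.

Lemma hat_adapted w s : 0 <= s <= T -> aem P (Es s) (hat w s).
Proof.
move=> sT; apply: lift_adapted (hat_lift w sT) => //.
exact: (signature_adapted W_bm S_sig).
Qed.

Lemma lift_time a s : 0 <= s <= T -> is_lift (A a s) (Bt a s).
Proof.
move=> sT; rewrite /time_extended; case: unliftP => [i _|_]; first exact: lift_evaluation.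
exact: lift_cst.
Qed.

Lemma lift_trapezoid w a t n : 0 < t -> t <= T ->
  is_lift (trapezoid (sig w) (A a) 0 t n) (trapezoid (hat w) (Bt a) 0 t n).
Proof.
move=> t0 tT; have g_in := grid_in (lexx 0) t0 tT.
apply: (@lift_sum _ _ _ _ _ _ _ _ _ _ 'I_n.+1 _
  (fun k om => (sig w (grid 0 t n k) om + sig w (grid 0 t n k.+1) om) / 2 *
    (A a (grid 0 t n k.+1) om - A a (grid 0 t n k) om))
  (fun k om => (hat w (grid 0 t n k) om + hat w (grid 0 t n k.+1) om) / 2 *
    (Bt a (grid 0 t n k.+1) om - Bt a (grid 0 t n k) om))) => k.
have kn : (k <= n.+1)%N by exact: ltnW.
apply: liftM; last by apply: liftB; apply: lift_time; exact: g_in.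
apply: (liftM (Gh := fun=> 2^-1)); last exact: lift_cst.
by apply: liftD; apply: hat_lift; exact: g_in.
Qed.

Definition time_step_L2 (X : process R d Omega) := forall a s u, 0 <= s -> s < u -> u <= T ->
  L2 (fun om => time_extended X u a om - time_extended X s a om).

Lemma time_step_L2_W : time_step_L2 W.
Proof.
move=> a s u s0 su uT; rewrite /time_extended; case: unliftP => [i _|_]; last exact: L2_cst.
by have [] := L2_increment fbm s0 su uT i.
Qed.

Lemma Wperp_step_L2 i s u : 0 <= s -> s < u -> u <= T -> L2 (fun om => Wperp u i om - Wperp s i om).
Proof. by move=> s0 su uT; have [] := L2_increment fbmE s0 su uT i. Qed.

Definition perp_step a s u : Omega -> R :=
  if unlift ord0 a is Some i then fun om => b_ i * (Wperp u i om - Wperp s i om) else fun=> 0.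

Lemma perp_step_L2 a s u : 0 <= s -> s < u -> u <= T -> L2 (perp_step a s u).
Proof.
move=> s0 su uT; rewrite /perp_step; case: unliftP => [i _|_]; last exact: L2_cst.
by apply: L2Z; exact: Wperp_step_L2.
Qed.

Lemma ou_step a s u om : Bt a u om - Bt a s om =
  e_ a * (A a u om - A a s om) + perp_step a s u om.
Proof.
rewrite /time_extended /perp_step /coef; case: unliftP => [i _|_].
  by rewrite /ou_process /ou_b; ring.
by rewrite mul0r oppr0 expR0 mul1r addr0.
Qed.

Lemma time_step_L2_ou : time_step_L2 B.
Proof.
move=> a s u s0 su uT; under eq_fun do rewrite ou_step.
by apply: L2D; [apply: L2Z; exact: time_step_L2_W|exact: perp_step_L2].
Qed.

Section test.
Variables (Z : Omega -> R) (K : R).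
Hypotheses (aZ : aem P (Gs T) Z) (ZK : forall om, `|Z om| <= K).
Variable t : R.
Hypotheses (t0 : 0 < t) (tT : t <= T).

Let mZ : measurable_fun setT Z := aZ.1.
Let hZ : L2 Z. Proof. exact: L2_bounded mZ ZK. Qed.
Let tI : 0 <= t <= T. Proof. by rewrite tT ltW. Qed.

Local Notation g n := (grid 0 t n).
Local Notation h n := ((t - 0) / n.+1%:R).

Let g_in n k : (k <= n.+1)%N -> 0 <= g n k <= T. Proof. exact: (grid_in (lexx 0) t0 tT). Qed.
Let g_ge0 n k : (k <= n.+1)%N -> 0 <= g n k. Proof. by move=> /g_in/andP[]. Qed.
Let g_leT n k : (k <= n.+1)%N -> g n k <= T. Proof. by move=> /g_in/andP[]. Qed.
Let g_lt n k : g n k < g n k.+1. Proof. exact: grid_lt. Qed.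
Let h_ge0 n : 0 <= h n. Proof. by rewrite ltW// grid_step_gt0. Qed.

Lemma cvg_mean_signature v a :
  mean (fun om => Z om * trapezoid (sig v) (A a) 0 t n om) @[n --> \oo] -->
  mean (fun om => Z om * sig (rcons v a) t om).
Proof.
apply: (cvg_mean_test mZ ZK); first exact: (signature_L2 S_sig).
exact: (trapezoid_limit0 W_bm S_sig v a t0 tT).
Qed.

Lemma cvg_mean_hat v a :
  mean (fun om => Z om * trapezoid (hat v) (Bt a) 0 t n om) @[n --> \oo] -->
  mean (fun om => Z om * hat (rcons v a) t om).
Proof.
apply: (cvg_mean_test mZ ZK); first exact: hat_L2.
move=> e e0; have [N hN] := trapezoid_limit0 W_bm S_sig v a t0 tT e0.
exists N => n /hN[h1 h2].
have l := liftB (lift_trapezoid v a n t0 tT) (hat_lift (rcons v a) tI).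
have [h3 h4] := lift_L2 W_bm Wperp_bm indep kappa0 theta0 T0 l h1.
by split=> //; rewrite h4.
Qed.

(** For the time letter the trapezoidal and the left-point sums differ, by Hoelder continuity of
    exponent 1/2 in L2, by at most [t * (nrm Z * C)] times the root of the mesh. *)
Lemma riemann_sum v : \sum_(k < n.+1) h n * mean (fun om => Z om * sig v (g n k) om) @[n --> \oo] -->
  mean (fun om => Z om * sig (rcons v (letter0 d)) t om).
Proof.
have [[C C0 [_ hC]] _] := signature_regular W_bm S_sig v T0.
have hc := @cvg_mean_signature v (letter0 d).
apply: (@cvg_sqrt_mesh R t (t * (nrm Z * C)) _ _ _ _ hc) => n.
 rewrite (mean_trapezoid mZ ZK); last 2 first.
- by move=> k kn; apply: (signature_L2 S_sig) => //; exact: g_in.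
- by move=> k kn; apply: time_step_L2_W => //; [exact/g_ge0/leqW|exact: g_leT].
have A0 k om : A (letter0 d) (g n k.+1) om - A (letter0 d) (g n k) om = h n.
  by rewrite /time_extended unlift_none gridS.
have L k : (k <= n.+1)%N -> L1 (fun om => Z om * sig v (g n k) om).
  by move=> kn; apply: L2M => //; apply: (signature_L2 S_sig) => //; exact: g_in.
have Z1 k j : (j <= n.+1)%N -> mean (fun om => Z om * (A (letter0 d) (g n k.+1) om - A (letter0 d) (g n k) om) * sig v (g n j) om) =
    h n * mean (fun om => Z om * sig v (g n j) om).
  by move=> jn; rewrite -meanZ; [apply: eq_mean => om; rewrite A0 mulrAC mulrC|exact: L].
rewrite -sumrB; apply: (le_trans (ler_norm_sum _ _ _)).
apply: (@le_trans _ _ (\sum_(k < n.+1) h n * (nrm Z * C * Num.sqrt (h n)))); last first.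
  by rewrite -mulr_suml grid_sum subr0 mulrA.
apply: ler_sum => k _; have kn : (k <= n.+1)%N by exact: ltnW.
rewrite !Z1//.
have -> : 2^-1 * (h n * mean (fun om => Z om * sig v (g n k) om) + h n * mean (fun om => Z om * sig v (g n k.+1) om)) -
    h n * mean (fun om => Z om * sig v (g n k) om) = h n * (2^-1 *
    (mean (fun om => Z om * sig v (g n k.+1) om) - mean (fun om => Z om * sig v (g n k) om))) by field.
rewrite normrM ger0_norm// ler_wpM2l// normrM ger0_norm ?invr_ge0// -meanB; [|exact: L|exact: L].
apply: (@le_trans _ _ `|mean (fun om => Z om * (sig v (g n k.+1) om - sig v (g n k) om))|).
  under eq_mean do rewrite -mulrBr.
  by rewrite ler_piMl ?normr_ge0 ?invf_le1 ?ler1n.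
apply: (le_trans (mean_le_nrm _ _)) => //.
  by apply: L2B; apply: (signature_L2 S_sig) => //; exact: g_in.
rewrite -mulrA ler_wpM2l ?nrm_ge0// -(gridS 0 t n k).
by apply: hC; [exact: g_ge0|exact/ltW/g_lt|exact: g_leT].
Qed.

Lemma expansion_L2 (I : finType) (f : I -> R) (u : I -> word d) s : 0 <= s <= T ->
  L2 (fun om => \sum_(p : I) f p * sig (u p) s om).
Proof. by move=> sT; apply: L2_sum => p; apply: L2Z; exact: (signature_L2 S_sig). Qed.

Lemma mean_expansion (I : finType) (f : I -> R) (u : I -> word d) s Y : 0 <= s <= T -> L2 Y ->
  mean (fun om => Y om * \sum_(p : I) f p * sig (u p) s om) =
  \sum_(p : I) f p * mean (fun om => Y om * sig (u p) s om).
Proof.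
move=> sT hY; have hS p : L2 (sig (u p) s) by exact: (signature_L2 S_sig).
rewrite (@eq_mean _ _ _ _ _ (fun om => \sum_(p : I) f p * (Y om * sig (u p) s om))); last first.
  by move=> om; rewrite mulr_sumr; apply: eq_bigr => p _; rewrite mulrCA.
rewrite mean_sum; last by move=> p; apply: L1Z; exact: L2M.
by apply: eq_bigr => p _; rewrite meanZ//; exact: L2M.
Qed.

Definition transfers w := forall s, 0 <= s <= T -> forall Y, aem P (Gs T) Y -> L2 Y ->
  mean (fun om => Y om * hat w s om) = mean (fun om => Y om * ou_tensor kappa theta (S s om) w).

Let ou_row w : exists (I : finType) (f : I -> R) (u : I -> word d),
  forall x, ou_tensor kappa theta x w = \sum_(p : I) f p * x (u p).
Proof. by have [hrow _] := expandable_row (ou_tensor_expandable kappa w); exact: hrow. Qed.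

(** [Z] times an increment of [A a] depends on the path of [W] only, so [transfers w] replaces the
    lift by a finite combination of signature coordinates. What remains are tested trapezoidal sums
    of the signature itself, whose limits carry the letter [a] appended. *)
Lemma first_order w a : transfers w ->
  \sum_(k < n.+1) 2^-1 *
    (mean (fun om => Z om * (A a (g n k.+1) om - A a (g n k) om) * hat w (g n k) om) +
     mean (fun om => Z om * (A a (g n k.+1) om - A a (g n k) om) * hat w (g n k.+1) om)) @[n --> \oo] -->
  mean (fun om => Z om * ou_tensor kappa theta (shift a (S t om)) w).
Proof.
move=> tw; have [I [f [u E]]] := ou_row w.
have -> : mean (fun om => Z om * ou_tensor kappa theta (shift a (S t om)) w) =
    \sum_(p : I) f p * mean (fun om => Z om * sig (rcons (u p) a) t om).
  rewrite -(mean_expansion _ (fun p => rcons (u p) a))//.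
  by apply: eq_mean => om; rewrite E.
rewrite (_ : (fun n => _) = fun n => \sum_(p : I) f p *
    mean (fun om => Z om * trapezoid (sig (u p)) (A a) 0 t n om)); last first.
  apply/funext => n.
  have hA k : (k <= n)%N -> L2 (fun om => A a (g n k.+1) om - A a (g n k) om).
    by move=> kn; apply: time_step_L2_W => //; [exact/g_ge0/leqW|exact: g_leT].
  have hZA k : (k <= n)%N -> L2 (fun om => Z om * (A a (g n k.+1) om - A a (g n k) om)).
    by move=> kn; apply: (L2_boundedM mZ ZK); exact: hA.
  have aZA k : (k <= n)%N -> aem P (Gs T) (fun om => Z om * (A a (g n k.+1) om - A a (g n k) om)).
    move=> kn; apply: aemM => //; apply: aemB => //; apply: (aem_time_extended W_bm) => //.
    - exact: g_ge0.
    - exact: g_leT.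
    - exact/g_ge0/leqW.
    - exact/g_leT/leqW.
  have tr k j : (k <= n)%N -> (j <= n.+1)%N ->
      mean (fun om => Z om * (A a (g n k.+1) om - A a (g n k) om) * hat w (g n j) om) =
      \sum_(p : I) f p * mean (fun om => Z om * (A a (g n k.+1) om - A a (g n k) om) * sig (u p) (g n j) om).
    move=> kn jn; rewrite tw ?g_in//; [|exact: aZA|exact: hZA].
    rewrite -mean_expansion ?g_in//; last exact: hZA.
    by apply: eq_mean => om; rewrite E.
  under [RHS]eq_bigr => p _.
    rewrite (mean_trapezoid mZ ZK); [|by move=> k kn; apply: (signature_L2 S_sig); exact: g_in|exact: hA].
    rewrite mulr_sumr; over.
  rewrite exchange_big; apply: eq_bigr => k _ /=.
  have kn : (k <= n)%N by rewrite -ltnS.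
  rewrite !tr//; last exact: leqW.
  by rewrite -big_split mulr_sumr; apply: eq_bigr => p _ /=; ring.
apply: cvg_big => [|p _]; first exact: add_continuous.
by apply: cvgM; [exact: cvg_cst|exact: cvg_mean_signature].
Qed.

Let gen_sub s : 0 <= s <= T -> Gs T `<=` Es s.
Proof. by move=> sT; apply: sigma_joinl; exact: generated_setT. Qed.

Let sE s : 0 <= s <= T -> sub_sigma (Es s).
Proof. exact: (fbm_sigma fbmE). Qed.

Section perpendicular_step.
Variables (s u : R).
Hypotheses (s0 : 0 <= s) (su : s < u) (uT : u <= T).

Let sI : 0 <= s <= T. Proof. by rewrite s0 (le_trans (ltW su)). Qed.
Let uI : 0 <= u <= T. Proof. by rewrite uT (le_trans s0)// ltW. Qed.
Let aZE : aem P (Es s) Z. Proof. by apply: aem_sub aZ; exact: gen_sub. Qed.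

Lemma mean_perp_hat w i : mean (fun om => Z om * (Wperp u i om - Wperp s i om) * hat w s om) = 0.
Proof.
under eq_mean do rewrite mulrAC.
apply: (mean_adapted_increment fbmE s0 su uT).
  by apply: aemM => //; [exact: sE|exact: hat_adapted].
by apply: (L1_boundedM mZ ZK); apply: L2_L1; exact: hat_L2.
Qed.

Lemma adapted_perp_L1 Y i : aem P (Es s) Y -> L1 Y ->
  L1 (fun om => Y om * (Wperp u i om - Wperp s i om)).
Proof.
move=> aY hY; have hi := Wperp_step_L2 i s0 su uT.
by have [] := @aem_mulM _ _ _ _ _ _ _ _ fbmE s u s0 su uT Y i i fst aY (@measurable_fst _ _ _ _) hY (L2_L1 hi).
Qed.

Lemma adapted_perp2_L1 Y i j : aem P (Es s) Y -> L1 Y ->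
  L1 (fun om => Y om * ((Wperp u i om - Wperp s i om) * (Wperp u j om - Wperp s j om))).
Proof.
move=> aY hY; have hi := Wperp_step_L2 i s0 su uT; have hj := Wperp_step_L2 j s0 su uT.
have mg : measurable_fun setT (fun z : R * R => z.1 * z.2) by exact: measurable_funM.
by have [] := @aem_mulM _ _ _ _ _ _ _ _ fbmE s u s0 su uT Y i j _ aY mg hY (L2M hi hj).
Qed.

(** The step of [B] splits in two. The part along [W] belongs to the enlarged filtration already at
    time [s], so its product with the step of [Wperp] has mean 0; the part along [Wperp] contributes
    [u - s] when the letters agree. *)
Lemma main_term w j i :
  mean (fun om => Z om * (Wperp u i om - Wperp s i om) * (hat w s om * (Bt j u om - Bt j s om))) =
  (j == letter i)%:R * b_ i * ((u - s) * mean (fun om => Z om * hat w s om)).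
Proof.
have hZh : L1 (fun om => Z om * hat w s om).
  by apply: (L1_boundedM mZ ZK); apply: L2_L1; exact: hat_L2.
have aZh : aem P (Es s) (fun om => Z om * hat w s om).
  by apply: aemM => //; [exact: sE|exact: hat_adapted].
pose Y om := Z om * hat w s om * (A j u om - A j s om).
have aY : aem P (Es s) Y.
  apply: aemM => //; first exact: sE.
  apply: (@aem_sub _ _ _ _ (Gs T)); first exact: gen_sub.
  have s_u := ltW su.
  apply: aemB => //; apply: (aem_time_extended W_bm) => //; first exact: le_trans s_u.
  exact: le_trans uT.
have hY : L1 Y.
  rewrite /Y; under eq_fun do rewrite -mulrA.
  apply: (L1_boundedM mZ ZK); apply: L2M; first exact: hat_L2.
  exact: time_step_L2_W.
have hY1 := adapted_perp_L1 i aY hY.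
have m1 := mean_adapted_increment fbmE s0 su uT aY i hY.
rewrite (@eq_mean _ _ _ _ _ (fun om => e_ j * (Y om * (Wperp u i om - Wperp s i om)) +
    (Z om * hat w s om) * (perp_step j s u om * (Wperp u i om - Wperp s i om)))); last first.
  by move=> om; rewrite ou_step /Y; ring.
rewrite /perp_step; case: unliftP => [j' ->|->].
  have h2 := adapted_perp2_L1 j' i aZh hZh.
  have E om : Z om * hat w s om * (b_ j' * (Wperp u j' om - Wperp s j' om) * (Wperp u i om - Wperp s i om)) =
      b_ j' * (Z om * hat w s om * ((Wperp u j' om - Wperp s j' om) * (Wperp u i om - Wperp s i om))) by ring.
  under eq_mean do rewrite E.
  rewrite meanD; [|exact: L1Z|exact: L1Z].
  rewrite !meanZ// m1 mulr0 add0r (mean_adapted_increments fbmE s0 su uT aZh)//.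
  rewrite /letter (inj_eq lift_inj); have [->|] := eqVneq j' i; last by rewrite !mul0r mulr0.
  by rewrite !mul1r.
under eq_mean do rewrite mul0r mulr0 addr0.
by rewrite meanZ// m1 mulr0 (negbTE (neq_lift _ _)) !mul0r.
Qed.

(** Lifting keeps the norm of the remainder at [O(u - s)], and the isometry adds [sqrt (u - s)];
    terms of order 3/2 are negligible when summed over a grid. *)
Lemma remainder_term w j i C : nrm (fun om => sig (rcons w j) u om - sig (rcons w j) s om -
      sig w s om * (A j u om - A j s om)) <= C * (u - s) ->
  let rem om := hat (rcons w j) u om - hat (rcons w j) s om - hat w s om * (Bt j u om - Bt j s om) in
  L2 rem /\ `|mean (fun om => Z om * (Wperp u i om - Wperp s i om) * rem om)| <=
    nrm Z * C * (u - s) * Num.sqrt (u - s).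
Proof.
move=> hC rem.
have l : is_lift (fun om => sig (rcons w j) u om - sig (rcons w j) s om -
      sig w s om * (A j u om - A j s om)) rem.
  apply: liftB; first by apply: liftB; exact: hat_lift.
  by apply: liftM; [exact: hat_lift|apply: liftB; exact: lift_time].
have [hr nr] := lift_L2 W_bm Wperp_bm indep kappa0 theta0 T0 l (L2_remainder W_bm S_sig w j s0 su uT).
split=> //.
have [hZW nZW] := L2_adapted_increment fbmE s0 su uT aZE i hZ.
apply: (le_trans (mean_le_nrm hZW hr)); rewrite nr.
have us0 : 0 <= u - s by rewrite subr_ge0 ltW.
have -> : nrm (fun om => Z om * (Wperp u i om - Wperp s i om)) = nrm Z * Num.sqrt (u - s).
  have c0 : 0 <= nrm Z * Num.sqrt (u - s) by apply: mulr_ge0; [exact: nrm_ge0|exact: sqrtr_ge0].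
  apply/eqP; rewrite -(@eqrXn2 _ 2)// ?nrm_ge0//; apply/eqP.
  by rewrite exprMn (sqr_sqrtr us0) nZW mulrC.
rewrite (_ : nrm Z * C * (u - s) * Num.sqrt (u - s) = nrm Z * Num.sqrt (u - s) * (C * (u - s))); last by ring.
by apply: ler_wpM2l => //; apply: mulr_ge0; [exact: nrm_ge0|exact: sqrtr_ge0].
Qed.

End perpendicular_step.

Lemma hat_nil s : 0 <= s <= T -> hat [::] s = (fun=> 1) %[ae P].
Proof.
move=> sT; have l := hat_lift [::] sT; rewrite (signature_nil S_sig sT) in l.
exact: (lift_ae W_bm Wperp_bm indep kappa0 theta0 T0 l (lift_cst _ _ _ _ _ _ 1) (ae_eq_refl _ _ _)).
Qed.

(** For the empty word the lift is constant in time and both sides vanish. Otherwise the main terms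
    form a Riemann sum in time of the lift of the word without its last letter, which [transfers]
    and [riemann_sum] evaluate; the time integral is the appended letter 0. *)
Lemma second_order w i : (forall w' j, w = rcons w' j -> transfers w') ->
  \sum_(k < n.+1) mean (fun om => Z om * (Wperp (g n k.+1) i om - Wperp (g n k) i om) *
     (hat w (g n k.+1) om - hat w (g n k) om)) @[n --> \oo] -->
  b_ i * mean (fun om => Z om * graft (letter i) (ou_tensor kappa theta (shift (letter0 d) (S t om))) w).
Proof.
have hWp n k : (k <= n)%N -> L2 (fun om => Z om * (Wperp (g n k.+1) i om - Wperp (g n k) i om)).
  move=> kn; apply: (L2_boundedM mZ ZK); apply: Wperp_step_L2 => //.
  - exact/g_ge0/leqW.
  - exact: g_leT.
case/lastP: w => [_|w j /(_ w j erefl) tw].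
  under [X in b_ i * X]eq_mean do rewrite graft_nil mulr0.
  rewrite mean_cst mulr0 (_ : (fun n => _) = fun=> 0); first exact: cvg_cst.
  apply/funext => n; rewrite big1// => k _.
  have kn : (k <= n)%N by rewrite -ltnS.
  rewrite -[RHS](mean_cst P 0); apply: mean_ae => //.
    apply: measurable_funM; first exact: L2_measurable (hWp n k kn).
    by apply: measurable_funB; apply: L2_measurable; apply: hat_L2; apply: g_in => //; exact: leqW.
  have h1 := hat_nil (g_in (ltn_ord k)); have h2 := hat_nil (g_in (leqW kn)).
  by apply: filterS2 h1 h2 => om e1 e2 _; rewrite e1// e2// subrr mulr0.
have [C C0 hC] := signature_expands W_bm S_sig w j T0.
have [I [f [u E]]] := ou_row w.
pose main n := \sum_(k < n.+1) (j == letter i)%:R * b_ i *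
  (h n * mean (fun om => Z om * hat w (g n k) om)).
apply: (@cvg_sqrt_mesh R t (t * (nrm Z * C)) main).
  move=> n; rewrite /main -sumrB; apply: (le_trans (ler_norm_sum _ _ _)).
  apply: (@le_trans _ _ (\sum_(k < n.+1) h n * (nrm Z * C * Num.sqrt (h n)))); last first.
    by rewrite -mulr_suml grid_sum subr0 mulrA.
  apply: ler_sum => k _; have kn : (k <= n)%N by rewrite -ltnS.
  have k0 := g_ge0 (leqW kn); have kT := g_leT (ltn_ord k); have kk := g_lt n k.
  have [hr er] := @remainder_term _ _ k0 kk kT w j i C (hC _ _ k0 kk kT).
  rewrite -[h n](gridS 0 t n k) -main_term// distrC -meanB; last 2 first.
  - apply: L2M; first exact: hWp.
    by apply: L2B; apply: hat_L2; apply: g_in => //; exact: leqW.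
  - have -> : (fun om => Z om * (Wperp (g n k.+1) i om - Wperp (g n k) i om) *
        (hat w (g n k) om * (Bt j (g n k.+1) om - Bt j (g n k) om))) =
      fun om => Z om * (Wperp (g n k.+1) i om - Wperp (g n k) i om) *
         (hat (rcons w j) (g n k.+1) om - hat (rcons w j) (g n k) om) -
        Z om * (Wperp (g n k.+1) i om - Wperp (g n k) i om) *
         (hat (rcons w j) (g n k.+1) om - hat (rcons w j) (g n k) om - hat w (g n k) om * (Bt j (g n k.+1) om - Bt j (g n k) om)).
      by apply/funext => om; ring.
    apply: L1B; apply: L2M => //; try exact: hWp.
    by apply: L2B; apply: hat_L2; apply: g_in => //; exact: leqW.
  rewrite [leRHS](_ : _ = nrm Z * C * (g n k.+1 - g n k) * Num.sqrt (g n k.+1 - g n k)); last by rewrite mulrCA mulrA.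
  move: er; congr (_ <= _); congr `|_|; apply: eq_mean => om; rewrite -mulrBr; congr (_ * _).
rewrite (_ : main = fun n => (j == letter i)%:R * b_ i *
    \sum_(p : I) f p * \sum_(k < n.+1) h n * mean (fun om => Z om * sig (u p) (g n k) om)); last first.
  apply/funext => n; rewrite /main -mulr_sumr; congr (_ * _).
  under [RHS]eq_bigr do rewrite mulr_sumr.
  rewrite exchange_big; apply: eq_bigr => k _ /=.
  have kI : 0 <= g n k <= T by apply: g_in; exact: ltnW.
  rewrite tw// (_ : (fun om => _) = fun om => Z om * \sum_(p : I) f p * sig (u p) (g n k) om); last first.
    by apply/funext => om; rewrite E.
  rewrite mean_expansion// mulr_sumr; apply: eq_bigr => p _; exact: mulrCA.
have -> : b_ i * mean (fun om => Z om * graft (letter i) (ou_tensor kappa theta (shift (letter0 d) (S t om))) (rcons w j)) =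
    (j == letter i)%:R * b_ i * \sum_(p : I) f p * mean (fun om => Z om * sig (rcons (u p) (letter0 d)) t om).
  rewrite -(mean_expansion _ (fun p => rcons (u p) (letter0 d)))//.
  rewrite [_%:R * _]mulrC -mulrA; congr (_ * _); rewrite -meanZ.
    by apply: eq_mean => om; rewrite graft_rcons E mulrCA.
  by apply: L2M => //; exact: expansion_L2.
apply: cvgM; first exact: cvg_cst.
apply: cvg_big => [|p _]; first exact: add_continuous.
by apply: cvgM; [exact: cvg_cst|exact: riemann_sum].
Qed.

Lemma shift_L2 w a s : 0 <= s <= T -> L2 (fun om => ou_tensor kappa theta (shift a (S s om)) w).
Proof.
move=> sT; have [I [f [u E]]] := ou_row w; under eq_fun do rewrite E.
exact: (expansion_L2 _ (fun p => rcons (u p) a)).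
Qed.

Lemma graft_L2 w a s : 0 <= s <= T ->
  L2 (fun om => graft a (ou_tensor kappa theta (shift (letter0 d) (S s om))) w).
Proof.
move=> sT; case/lastP: w => [|w b].
  by under eq_fun do rewrite graft_nil; exact: L2_cst.
by under eq_fun do rewrite graft_rcons; apply: L2Z; exact: shift_L2.
Qed.

Lemma transfer_bounded w a : transfers w -> (forall w' j, w = rcons w' j -> transfers w') ->
  mean (fun om => Z om * hat (rcons w a) t om) =
  mean (fun om => Z om * ou_tensor kappa theta (S t om) (rcons w a)).
Proof.
move=> tw tw'.
pose G om := graft a (ou_tensor kappa theta (shift (letter0 d) (S t om))) w.
pose c := (1 - expR (- (2 * coef kappa a * theta))) / 2.
pose F n := \sum_(k < n.+1) 2^-1 *
    (mean (fun om => Z om * (A a (g n k.+1) om - A a (g n k) om) * hat w (g n k) om) +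
     mean (fun om => Z om * (A a (g n k.+1) om - A a (g n k) om) * hat w (g n k.+1) om)).
pose Q n := \sum_(k < n.+1) 2^-1 *
    (mean (fun om => Z om * perp_step a (g n k) (g n k.+1) om * hat w (g n k) om) +
     mean (fun om => Z om * perp_step a (g n k) (g n k.+1) om * hat w (g n k.+1) om)).
have FQ n : mean (fun om => Z om * trapezoid (hat w) (Bt a) 0 t n om) = e_ a * F n + Q n.
  have gk k : (k <= n)%N -> 0 <= g n k /\ g n k.+1 <= T.
    by move=> kn; split; [exact/g_ge0/leqW|exact: g_leT].
  rewrite (mean_trapezoid mZ ZK); last 2 first.
  - by move=> k kn; apply: hat_L2; exact: g_in.
  - by move=> k kn; have [k0 kT] := gk k kn; exact: time_step_L2_ou.
  rewrite /F /Q mulr_sumr -big_split; apply: eq_bigr => k _ /=.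
  have kn : (k <= n)%N by rewrite -ltnS.
  have [k0 kT] := gk k kn.
  have sp m : (m <= n.+1)%N ->
      mean (fun om => Z om * (Bt a (g n k.+1) om - Bt a (g n k) om) * hat w (g n m) om) =
      e_ a * mean (fun om => Z om * (A a (g n k.+1) om - A a (g n k) om) * hat w (g n m) om) +
      mean (fun om => Z om * perp_step a (g n k) (g n k.+1) om * hat w (g n m) om).
    move=> mn; have hm := hat_L2 w (g_in mn).
    have l1 : L1 (fun om => Z om * (A a (g n k.+1) om - A a (g n k) om) * hat w (g n m) om).
      by apply: L2M => //; apply: (L2_boundedM mZ ZK); exact: time_step_L2_W.
    have l2 : L1 (fun om => Z om * perp_step a (g n k) (g n k.+1) om * hat w (g n m) om).
      by apply: L2M => //; apply: (L2_boundedM mZ ZK); exact: perp_step_L2.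
    rewrite -meanZ// -meanD//; last exact: L1Z.
    by apply: eq_mean => om; rewrite ou_step; ring.
  by rewrite !sp//; [ring|exact: leqW].
have cQ : Q n @[n --> \oo] --> c * mean (fun om => Z om * G om).
  rewrite /Q /c /G /coef /perp_step; case: unliftP => [i ->|->]; last first.
    rewrite mulr0 mul0r oppr0 expR0 subrr !mul0r (_ : (fun n => _) = fun=> 0); first exact: cvg_cst.
    apply/funext => n; rewrite big1// => k _.
    have z0 (Y : Omega -> R) : mean (fun om => Z om * 0 * Y om) = 0.
      by under eq_mean do rewrite mulr0 mul0r; rewrite mean_cst.
    by rewrite !z0 addr0 mulr0.
  (* One factor [b_ i] stems from the integrator, the other from the lift of [w], and 1/2 from the
     trapezoidal rule. *)
  rewrite (_ : (1 - _) / 2 * _ = 2^-1 * b_ i * (b_ i * mean (fun om => Z om *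
      graft (letter i) (ou_tensor kappa theta (shift (letter0 d) (S t om))) w))); last first.
    rewrite mulrA -[2^-1 * _ * _]mulrA -expr2 ou_b_sqr//; congr (_ * _); exact: mulrC.
  (* Left endpoints have mean 0 against the step of [Wperp]; subtracting them turns the right
     endpoints into increments. *)
  rewrite (_ : (fun n => _) = fun n => 2^-1 * b_ i * \sum_(k < n.+1) mean (fun om => Z om * (Wperp (g n k.+1) i om - Wperp (g n k) i om) *
     (hat w (g n k.+1) om - hat w (g n k) om))); last first.
    apply/funext => n; rewrite mulr_sumr; apply: eq_bigr => k _.
    have kn : (k <= n)%N by rewrite -ltnS.
    have k0 := g_ge0 (leqW kn); have kT := g_leT (ltn_ord k); have kk := g_lt n k.
    have hP := L2_boundedM mZ ZK (Wperp_step_L2 i k0 kk kT).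
    have l m : (m <= n.+1)%N -> L1 (fun om => Z om * (Wperp (g n k.+1) i om - Wperp (g n k) i om) * hat w (g n m) om).
      by move=> mn; apply: L2M => //; apply: hat_L2; exact: g_in.
    have sc m : (m <= n.+1)%N -> mean (fun om => Z om * (b_ i * (Wperp (g n k.+1) i om - Wperp (g n k) i om)) * hat w (g n m) om) =
        b_ i * mean (fun om => Z om * (Wperp (g n k.+1) i om - Wperp (g n k) i om) * hat w (g n m) om).
      by move=> mn; rewrite -meanZ; [apply: eq_mean => om; ring|exact: l].
    rewrite !sc//; last exact: leqW.
    under [in RHS]eq_mean do rewrite mulrBr.
    rewrite meanB; [|exact: l|by apply: l; exact: leqW].
    by rewrite (mean_perp_hat k0 kk kT) mulr0 add0r subr0 mulrA.
  by apply: cvgM; [exact: cvg_cst|exact: second_order].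
have cF : F n @[n --> \oo] --> mean (fun om => Z om * ou_tensor kappa theta (shift a (S t om)) w) by exact: first_order.
have lim1 := @cvg_mean_hat w a.
have lim2 : mean (fun om => Z om * trapezoid (hat w) (Bt a) 0 t n om) @[n --> \oo] -->
    e_ a * mean (fun om => Z om * ou_tensor kappa theta (shift a (S t om)) w) + c * mean (fun om => Z om * G om).
  under eq_fun do rewrite FQ.
  by apply: cvgD => //; apply: cvgM => //; exact: cvg_cst.
rewrite -(cvg_lim (@norm_hausdorff _ _) lim1) (cvg_lim (@norm_hausdorff _ _) lim2).
have l1 := L2M hZ (shift_L2 w a tI); have l2 := L2M hZ (graft_L2 w a tI).
rewrite -!meanZ// -meanD; [|exact: L1Z|exact: L1Z].
by apply: eq_mean => om; rewrite ou_tensor_rcons -/c /G; ring.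
Qed.

End test.
Lemma ou_tensor_L2 w s : 0 <= s <= T -> L2 (fun om => ou_tensor kappa theta (S s om) w).
Proof.
move=> sT; have [h _] := expandable_row (ou_tensor_expandable kappa w).
have [I [f [u E]]] := h theta; under eq_fun do rewrite E; exact: expansion_L2.
Qed.

Lemma shift_signature0 w a : {ae P, forall om, ou_tensor kappa theta (shift a (S 0 om)) w = 0}.
Proof.
have [h _] := expandable_row (ou_tensor_expandable kappa w).
have [I [f [u E]]] := h theta.
have h0 : {ae P, forall om, forall p, S 0 om (rcons (u p) a) = 0}.
  apply: filter_forall => p; apply: filterS (signature0 S_sig (u p) a T0) => om; exact.
apply: filterS h0 => om h1; rewrite E big1// => p _.
by rewrite /shift h1 mulr0.
Qed.

Lemma ou_tensor_signature0 w a : (fun om => ou_tensor kappa theta (S 0 om) (rcons w a)) = (fun=> 0) %[ae P].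
Proof.
case/lastP: w => [|w b].
  apply: filterS (shift_signature0 [::] a) => om e _.
  by rewrite ou_tensor_rcons e graft_nil !mulr0 addr0.
apply: filterS2 (shift_signature0 (rcons w b) a) (shift_signature0 w (letter0 d)) => om e1 e2 _.
by rewrite ou_tensor_rcons e1 graft_rcons e2 !mulr0 addr0.
Qed.

Lemma hat_signature0 w a : hat (rcons w a) 0 = (fun=> 0) %[ae P].
Proof.
have T00 : 0 <= (0 : R) <= T by apply/andP; split.
exact: (lift_ae W_bm Wperp_bm indep kappa0 theta0 T0 (hat_lift (rcons w a) T00) (lift_cst _ _ _ _ _ _ 0)
  (signature0 S_sig w a T0)).
Qed.

(** The test variable is truncated, and both means converge by [cvg_mean_clip]. *)
Lemma transfers_bounded w : (forall s, 0 <= s <= T -> forall Y K, aem P (Gs T) Y ->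
    (forall om, `|Y om| <= K) ->
    mean (fun om => Y om * hat w s om) = mean (fun om => Y om * ou_tensor kappa theta (S s om) w)) ->
  transfers w.
Proof.
move=> h s sT Y aY hY; have mY := aY.1.
have hh := hat_L2 w sT; have hE := ou_tensor_L2 w sT.
have c1 := cvg_mean_clip mY (L2_L1 hh) (L2M hY hh).
have c2 := cvg_mean_clip mY (L2_L1 hE) (L2M hY hE).
rewrite -(cvg_lim (@norm_hausdorff _ _) c1) -(cvg_lim (@norm_hausdorff _ _) c2).
suff -> : (fun n => mean (fun om => clip n%:R (Y om) * hat w s om)) =
  (fun n => mean (fun om => clip n%:R (Y om) * ou_tensor kappa theta (S s om) w)) by [].
apply/funext => n; apply: (h s sT (fun om => clip n%:R (Y om)) n%:R).
  apply: (@aem_comp2 _ _ _ _ _ sG (fun x _ => clip n%:R x) Y Y) => //.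
  by rewrite /clip; apply: measurable_maxr => //; apply: measurable_minr.
by move=> om; apply: clip_abs.
Qed.

Lemma signature_transfers w : transfers w.
Proof.
have [n] := ubnP (size w); elim: n w => // n IH w; case/lastP: w => [_|w a].
  apply: transfers_bounded => s sT Y K aY YK.
  have hY : L2 Y by exact: L2_bounded aY.1 YK.
  apply: mean_ae.
  - by apply: measurable_funM; [exact: aY.1|exact: L2_measurable (hat_L2 _ sT)].
  - by apply: measurable_funM; [exact: aY.1|exact: L2_measurable (ou_tensor_L2 _ sT)].
  - apply: filterS (hat_nil sT) => om e _.
    by rewrite e// ou_tensor_nil; have := congr1 (fun f => f om) (signature_nil S_sig sT) => /= ->.
rewrite size_rcons ltnS => wn; apply: transfers_bounded => s sT Y K aY YK.
(* Grids need an interval of positive length; at time 0 both integrands vanish almost surely. *)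
case/andP: (sT); rewrite le_eqVlt => /predU1P[s0|s0] sT'.
  have T00 : 0 <= (0 : R) <= T by apply/andP; split.
  rewrite -s0; apply: mean_ae.
  - by apply: measurable_funM; [exact: aY.1|exact: L2_measurable (hat_L2 _ T00)].
  - by apply: measurable_funM; [exact: aY.1|exact: L2_measurable (ou_tensor_L2 _ T00)].
  - by apply: filterS2 (hat_signature0 w a) (ou_tensor_signature0 w a) => om e1 e2 _; rewrite e1// e2.
apply: (transfer_bounded aY YK) => //; first exact: IH.
by move=> w' j e; apply: IH; apply: leq_trans wn; rewrite e size_rcons.
Qed.

End transfer.

(** * The generator *)

Section conditional_expectation.
Context {R : realType} {disp : measure_display} {Omega : measurableType disp}.
Variables (P : probability Omega R) (G : set (set Omega)).
Hypothesis sG : sub_sigma G.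
Implicit Types X Y : Omega -> R.

Lemma L1_indicM A X : measurable A -> L1 P X -> L1 P (fun w => \1_A w * X w).
Proof.
move=> mA; apply: (@L1_boundedM _ _ _ _ _ 1); first exact: measurable_indic.
by move=> w; rewrite indicE normr_nat; case: (_ \in _).
Qed.

Lemma integral_mean_indic A X : measurable A -> L1 P X ->
  (\int[P]_(w in A) (X w)%:E = (mean P (fun w => \1_A w * X w))%:E)%E.
Proof.
move=> mA hX; rewrite integral_mkcond -L1_integral.
  apply: eq_integral => w _; rewrite patchE indicE; case: ifP => _; first by rewrite mul1r.
  by rewrite mul0r.
exact: L1_indicM.
Qed.

Lemma aem_indic A : G A -> aem P G (\1_A : Omega -> R).
Proof.
move=> GA; apply: aem_wrt => //; apply/(measurable_wrtP _ sG.1).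
by apply: measurable_indic; apply: sub_sigma_algebra.
Qed.

(** Tested on the event that the difference [D] is positive and on its complement, the defining
    identities give [E|D| = 0]. *)
Lemma is_condexp_unique X Y Y' : is_condexp P G X Y -> is_condexp P G X Y' -> Y = Y' %[ae P].
Proof.
move=> [iX iY mY eY] [_ iY' mY' eY'].
pose D w := Y w - Y' w.
have hD : L1 P D by exact: L1B.
have mD : measurable_wrt G D.
  by apply/(measurable_wrtP _ sG.1); apply: measurable_funB; exact/(measurable_wrtP _ sG.1).
have m0 A : G A -> mean P (fun w => \1_A w * D w) = 0.
  move=> GA; have mA : measurable A by exact: sG.2.
  under eq_mean do rewrite mulrBr.
  rewrite meanB; [|exact: L1_indicM|exact: L1_indicM].
  apply/eqP; rewrite subr_eq0; apply/eqP; apply: EFin_inj.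
  by rewrite -!integral_mean_indic// eY// eY'.
pose A := D @^-1` `]0, +oo[.
have GA : G A by exact: mD.
have GA' : G (~` A) by rewrite -setTD; have [[_ GC _] _] := sG; exact: GC.
have abs0 : mean P (fun w => `|D w|) = 0.
  have mI (E : set Omega) : G E -> L1 P (fun w => \1_E w * D w).
    by move=> GE; apply: L1_indicM hD; exact: sG.2.
  rewrite (@eq_mean _ _ _ _ _ (fun w => \1_A w * D w - \1_(~` A) w * D w)).
    by rewrite meanB ?m0 ?subrr//; exact: mI.
  move=> w; rewrite !indicE in_setC; have [Dw|Dw] := ltrP 0 (D w).
    have -> : w \in A by rewrite inE /A /= in_itv /= Dw.
    by rewrite mul1r mul0r subr0 gtr0_norm.
  have -> : (w \in A) = false by apply/negbTE/negP; rewrite inE /A /= in_itv /= andbT ltNge Dw.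
  by rewrite mul0r mul1r sub0r ler0_norm.
have := @ae_eq_integral_abs _ _ _ P setT measurableT (EFin \o D).
have mD' : measurable_fun setT (EFin \o D) by apply/measurable_EFinP; exact: L1_measurable hD.
move=> /(_ mD')[+ _]; case.
  transitivity ((mean P (fun w => `|D w|))%:E); last by rewrite abs0.
  by rewrite -L1_integral//; exact: L1_abs.
move=> N [mN PN sub]; exists N; split => // w /= hw; apply: sub => /= h; apply: hw => _.
by have [] := h Logic.I => /eqP; rewrite subr_eq0 => /eqP.
Qed.

(* Testing against indicators of [G] suffices; [xget] then selects a version of the unique class. *)
Lemma condexp_eq X Y : L1 P X -> L1 P Y -> aem P G Y ->
  (forall A, G A -> mean P (fun w => \1_A w * X w) = mean P (fun w => \1_A w * Y w)) ->
  L1 P (condexp P G X) /\ condexp P G X = Y %[ae P].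
Proof.
move=> hX hY [mY [Y0 mY0 eY0]] h.
have mY0' := measurable_wrt_measurable sG mY0.
have hY0 : L1 P Y0 by exact: L1_ae eY0 hY.
have c0 : is_condexp P G X Y0.
  split => // A GA; have mA : measurable A by exact: sG.2.
  have mI : measurable_fun setT (\1_A : Omega -> R) by exact: measurable_indic.
  rewrite !integral_mean_indic// h//; congr EFin; apply: mean_ae.
  - exact: measurable_funM.
  - exact: measurable_funM.
  - by apply: filterS eY0 => w e _; rewrite e.
have c1 : is_condexp P G X (condexp P G X).
  exact: (@xgetPex _ (cst 0) [set Y | is_condexp P G X Y] (ex_intro _ Y0 c0)).
split; first by case: c1.
have e1 := is_condexp_unique c1 c0.
by apply: filterS2 e1 eY0 => w h1 h2 _; rewrite h1// h2.
Qed.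

End conditional_expectation.

(** * Semigroup and generator on the signature coordinates *)

Section generator.
Context {R : realType} {d : nat} {disp : measure_display} {Omega : measurableType disp}.
Variables (P : probability Omega R) (T : R) (W Wperp : process R d Omega).
Hypotheses (T_gt0 : 0 < T) (W_bm : brownian_motion P T W) (Wperp_bm : brownian_motion P T Wperp).
Hypothesis indep : independent_sigma P (generated_sigma T W) (generated_sigma T Wperp).
Variables (S : R -> Omega -> tseries R d) (S_sig : brownian_signature P T W S).
Variables (kappa : 'I_d -> R) (kappa0 : forall i, 0 <= kappa i).
Variables (t : R) (tI : 0 <= t <= T).

Local Notation Gs := (generated_sigma T W).
Local Notation F w := (fun omega => S t omega w).
Local Notation L2 := (L2 P).
Local Notation nrm := (nrm P).

Let TT : 0 <= T <= T. Proof. by rewrite (ltW T_gt0) lexx. Qed.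
Let sG : sub_sigma Gs. Proof. exact: (fbm_sigma (filtered_bm_generated W_bm) TT). Qed.

Lemma expansion_aem (I : finType) (f : I -> R) (u : I -> word d) :
  aem P Gs (fun om => \sum_(p : I) f p * S t om (u p)).
Proof. by apply: aem_sum => // p; apply: aemZ => //; exact: (signature_aem W_bm S_sig). Qed.

(** The coordinate of [ou_tensor] is measurable for the path of [W] up to null sets, and by
    [signature_transfers] it has the right mean over each of its events. Measurability of the chosen
    version is recorded for the norms of the difference quotients. *)
Lemma ou_semigroup_signature theta w : 0 <= theta ->
  measurable_fun setT (ou_semigroup P T W Wperp kappa theta (F w)) /\
  ou_semigroup P T W Wperp kappa theta (F w) = (fun om => ou_tensor kappa theta (S t om) w) %[ae P].
Proof.
move=> theta0.
have hh := hat_L2 T_gt0 W_bm Wperp_bm indep S_sig kappa0 theta0 w tI.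
have hE := ou_tensor_L2 S_sig kappa theta w tI.
have aE : aem P Gs (fun om => ou_tensor kappa theta (S t om) w).
  have [h _] := expandable_row (ou_tensor_expandable kappa w).
  by have [I [f [u E]]] := h theta; under eq_fun do rewrite E; exact: expansion_aem.
have [h1 h2] : L1 P (ou_semigroup P T W Wperp kappa theta (F w)) /\
    ou_semigroup P T W Wperp kappa theta (F w) = (fun om => ou_tensor kappa theta (S t om) w) %[ae P].
  apply: condexp_eq => //; [exact: L2_L1 hh|exact: L2_L1|].
  move=> A GA; apply: (signature_transfers T_gt0 W_bm Wperp_bm indep S_sig kappa0 theta0 w tI).
    exact: aem_indic.
  apply: (@L2_bounded _ _ _ _ _ 1); first by apply: measurable_indic; exact: sG.2.
  by move=> om; rewrite indicE normr_nat; case: (_ \in _).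
by split=> //; exact: L1_measurable h1.
Qed.

Lemma aem_L2_of X : L2 X -> aem P Gs X -> L2_of P T W X.
Proof. by move=> hX [_ [X' h1 h2]]; split; [exact/Lfun2P|exists X']. Qed.

Lemma difference_quotient (f : R -> R) f' : is_derive (0 : R) 1 f f' ->
  forall e, 0 < e -> \forall h \near 0^'+, `|h^-1 * (f h - f 0) - f'| <= e.
Proof.
move=> [df ef] e e0.
have c : h^-1 *: (f (h *: 1 + 0) - f 0) @[h --> 0^'] --> f' by rewrite -ef; exact: df.
have /cvgrPdist_le/(_ e e0) := c.
rewrite /dnbhs /at_right !near_withinE; apply: filterS => h hh h0.
have hn : h != 0 by rewrite gt_eqF.
have := hh hn.
by rewrite distrC addr0 [h *: 1]mulr1.
Qed.

(** By [ou_tensor_expandable] the difference quotient minus the generator is, almost surely, a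
    finite sum of scalar errors times signature coordinates that do not depend on [theta]. *)
Lemma generator_signature w :
  is_generator P T W Wperp kappa (F w) (fun om => generator_tensor kappa (S t om) w).
Proof.
have [I [f [f' [v [hPhi hder hGam]]]]] := ou_tensor_expandable kappa w.
have hS p : L2 (F (v p)) by exact: (signature_L2 S_sig).
have hG : L2 (fun om => generator_tensor kappa (S t om) w).
  by under eq_fun do rewrite hGam; apply: L2_sum => p; exact: L2Z.
split.
- by apply: aem_L2_of; [exact: (signature_L2 S_sig)|exact: (signature_aem W_bm S_sig)].
- by apply: aem_L2_of => //; under eq_fun do rewrite hGam; exact: expansion_aem.
pose X (theta : R) om := theta^-1 * (ou_semigroup P T W Wperp kappa theta (F w) om
   - ou_semigroup P T W Wperp kappa 0 (F w) om) - generator_tensor kappa (S t om) w.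
have key e : 0 < e -> \forall theta \near 0^'+, L2 (X theta) /\ nrm (X theta) <= e.
  move=> e0; pose c := \sum_(p : I) nrm (F (v p)).
  have c0 : 0 < c + 1 by rewrite ltr_wpDl// sumr_ge0// => p _; exact: nrm_ge0.
  (* Scalar errors of at most [e / (c + 1)] give a norm of at most [e * c / (c + 1) <= e]; the [+ 1]
     covers [c = 0]. *)
  have nr : \forall theta \near 0^'+, forall p, `|theta^-1 * (f p theta - f p 0) - f' p| <= e / (c + 1).
    apply: filter_forall => p; apply: difference_quotient => //; exact: divr_gt0.
  near=> theta.
  have th0 : 0 < theta by near: theta; exact: nbhs_right_gt.
  have q : forall p, `|theta^-1 * (f p theta - f p 0) - f' p| <= e / (c + 1) by near: theta.
  have [m1 e1] := ou_semigroup_signature w (ltW th0).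
  have [m2 e2] := ou_semigroup_signature w (lexx 0).
  pose Y om := \sum_(p : I) (theta^-1 * (f p theta - f p 0) - f' p) * S t om (v p).
  have hY : L2 Y by apply: L2_sum => p; exact: L2Z.
  have mX : measurable_fun setT (X theta).
    apply: measurable_funB; last exact: L2_measurable hG.
    by apply: measurable_funM => //; exact: measurable_funB.
  have eXY : Y = X theta %[ae P].
    apply: filterS2 e1 e2 => om h1 h2 _; rewrite /X h1// h2// !hPhi hGam /Y.
    rewrite -sumrB mulr_sumr -sumrB; apply: eq_bigr => p _; ring.
  split; first exact: L2_ae eXY hY.
  rewrite -(nrm_ae (L2_measurable hY) mX eXY).
  have hYp p : L2 (fun om => (theta^-1 * (f p theta - f p 0) - f' p) * S t om (v p)) by exact: L2Z.
  apply: (le_trans (nrm_sum _ hYp)).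
  apply: (@le_trans _ _ (\sum_(p : I) e / (c + 1) * nrm (F (v p)))).
    by apply: ler_sum => p _; rewrite nrmZ// ler_wpM2r ?nrm_ge0.
  rewrite -mulr_sumr mulrAC ler_pdivrMr// ler_wpM2l ?(ltW e0)//.
  by rewrite lerDl.
apply/fine_cvgP; split.
  near=> theta; have [hX _] : L2 (X theta) /\ nrm (X theta) <= 1 by near: theta; exact: key.
  by rewrite (Lnorm_nrm hX).
apply/cvgrPdist_le => e e0; near=> theta.
have [hX nX] : L2 (X theta) /\ nrm (X theta) <= e by near: theta; exact: key.
by rewrite /= (Lnorm_nrm hX) /= sub0r normrN ger0_norm ?nrm_ge0.
Unshelve. all: end_near. Qed.

(** [ou_generator] selects some limit, so its value is known only through uniqueness: two L2 limits
    of the same quotients lie within [e / 2 + e / 2] of each other. *)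
Lemma generator_unique w G1 G2 : is_generator P T W Wperp kappa (F w) G1 ->
  is_generator P T W Wperp kappa (F w) G2 -> G1 = G2 %[ae P].
Proof.
pose Q (theta : R) om := theta^-1 * (ou_semigroup P T W Wperp kappa theta (F w) om
   - ou_semigroup P T W Wperp kappa 0 (F w) om).
have near_le G : is_generator P T W Wperp kappa (F w) G -> L2 G /\ forall e, 0 < e ->
    \forall theta \near 0^'+, L2 (fun om => Q theta om - G om) /\ nrm (fun om => Q theta om - G om) <= e.
  move=> [_ [/Lfun2P hG _] /fine_cvgP[hf /cvgrPdist_le hc]]; split=> // e e0.
  near=> theta.
  have th0 : 0 < theta by near: theta; exact: nbhs_right_gt.
  have [m1 _] := ou_semigroup_signature w (ltW th0).
  have [m2 _] := ou_semigroup_signature w (lexx 0).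
  have mX : measurable_fun setT (fun om => Q theta om - G om).
    apply: measurable_funB; last exact: L2_measurable hG.
    by apply: measurable_funM => //; exact: measurable_funB.
  have fin : ('N[P]_2%:E[EFin \o (fun om => (Q theta om - G om)%R)] \is a fin_num)%E by near: theta; exact: hf.
  have hX : L2 (fun om => Q theta om - G om).
    by apply: Lnorm_lty_L2 => //; rewrite ltey_eq fin.
  split=> //; have : `|0 - fine ('N[P]_2%:E[EFin \o (fun om => (Q theta om - G om)%R)])%E| <= e.
    by near: theta; exact: hc.
  by rewrite (Lnorm_nrm hX) /= sub0r normrN ger0_norm ?nrm_ge0.
move=> /near_le[h1 n1] /near_le[h2 n2].
have h12 : L2 (fun om => G1 om - G2 om) by exact: L2B.
suff n0 : nrm (fun om => G1 om - G2 om) = 0.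
  have := nrm_eq0_ae h12 n0; apply: filterS => om h /h e.
  by apply/eqP; rewrite -subr_eq0; apply/eqP.
apply/eqP; rewrite eq_le nrm_ge0 andbT; apply/ler_addgt0Pr => e e0; rewrite add0r.
have e20 : 0 < e / 2 by exact: divr_gt0.
have [theta [[a1 b1] [a2 b2]]] := @filter_ex _ (0 : R)^'+ _ _ (filterI (n1 _ e20) (n2 _ e20)).
have := nrmB a2 a1; rewrite (_ : (fun om => _ - _) = fun om => G1 om - G2 om); last first.
  by apply/funext => om; ring.
by move=> h; apply: (le_trans h); rewrite (splitr e); exact: lerD.
Unshelve. all: end_near. Qed.

End generator.

Theorem theorem5p13 (R : realType) (d : nat) (disp : measure_display)
    (Omega : measurableType disp) (P : probability Omega R)
    (T : R) (T_gt0 : 0 < T)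
    (W Wperp : process R d Omega)
    (W_bm : brownian_motion P T W) (Wperp_bm : brownian_motion P T Wperp)
    (W_Wperp_indep :
       independent_sigma P (generated_sigma T W) (generated_sigma T Wperp))
    (S : R -> Omega -> tseries R d) (S_sig : brownian_signature P T W S)
    (kappa : 'I_d -> R) (kappa_ge0 : forall i, 0 <= kappa i)
    (vartheta : R) (vartheta_ge0 : 0 <= vartheta)
    (t : R) (t_itv : 0 <= t <= T) :
  [/\ forall w : word d,
        ou_semigroup P T W Wperp kappa vartheta (fun omega => S t omega w)
        = (fun omega => ou_tensor kappa vartheta (S t omega) w) %[ae P],
      forall w : word d,
        ou_domain P T W Wperp kappa (fun omega => S t omega w)
        /\ ou_generator P T W Wperp kappa (fun omega => S t omega w)
           = (fun omega => generator_tensor kappa (S t omega) w) %[ae P],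
      is_adjoint (ou_tensor kappa vartheta)
        (prod_op (fun i => J i (kappa i * vartheta))
         \o exp_op (\sum_(i < d)
              ((1 - expR (- (2 * kappa i * vartheta))) / 2)
                *: Psi [:: letter i; letter i] [:: letter0 d]))
    & is_adjoint (generator_tensor kappa)
        (\sum_(i < d) kappa i *:
           (Psi [:: letter i; letter i] [:: letter0 d] - Lambda i))].
Proof.
split.
- move=> w.
  by have [] := ou_semigroup_signature T_gt0 W_bm Wperp_bm W_Wperp_indep S_sig kappa_ge0 t_itv w vartheta_ge0.
- move=> w.
  have hg := generator_signature T_gt0 W_bm Wperp_bm W_Wperp_indep S_sig kappa_ge0 t_itv w.
  have hex : ou_domain P T W Wperp kappa (fun omega => S t omega w) by eexists; exact: hg.
  split=> //.
  have hx : is_generator P T W Wperp kappa (fun omega => S t omega w)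
      (ou_generator P T W Wperp kappa (fun omega => S t omega w)).
    exact: (@xgetPex _ (cst 0) [set G | is_generator P T W Wperp kappa (fun omega => S t omega w) G] hex).
  exact: (generator_unique T_gt0 W_bm Wperp_bm W_Wperp_indep S_sig kappa_ge0 t_itv hx hg).
- exact: ou_tensor_adjoint.
- exact: generator_tensor_adjoint.
Qed.
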